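(* Let $p\ge1$, let $q\in(1,\infty]$ satisfy $\frac1p+\frac1q=1$, and let $b(n,p)$ be the smallest constant such that for any anti-blocking bodies $A,B,C\subset\mathbb{R}^n_+$, $$|A|\,|A\oplus_p(-B)\oplus_p(-C)|\le b(n,p)\,|A\oplus_p(-B)|\,|A\oplus_p(-C)|.$$ Then $$b(n,p)=\max_{i,j}\left(d_{n,2}(i,j)\,\frac{\Gamma\left(1+\frac{i+j-n}{q}\right)\Gamma\left(1+\frac nq\right)}{\Gamma\left(1+\frac iq\right)\Gamma\left(1+\frac jq\right)}\right),$$ where the maximum is over all integers $0\le i,j\le n$ with $i+j-n\ge0$ and $$d_{n,2}(i,j)=\frac{\binom{i}{i+j-n}\binom{j}{i+j-n}}{\binom{n}{i+j-n}}.$$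
   Context: $\mathbb{R}^n_+=[0,\infty)^n$. A convex body is a nonempty compact convex set. A coordinate subspace is one spanned by a subset of the standard basis $e_1,\dots,e_n$. A convex body $K\subset\mathbb{R}^n_+$ is anti-blocking if $P_EK=K\cap E$ for every coordinate subspace $E$, where $P_E$ is the orthogonal projection onto $E$. The $L_p$-sum of $K,L\subset\mathbb{R}^n$ is, for $p>1$, $K\oplus_pL=\{(1-t)^{1/q}x+t^{1/q}y:x\in K,y\in L,t\in[0,1]\}$ with $\frac1p+\frac1q=1$; for $p=1$, $K\oplus_1L=K+L$ is the Minkowski sum. When $p=1$, $q=\infty$ and $x/q=0$. $|\cdot|$ is $n$-dimensional Lebesgue measure. *)

(* Defs.v *)
(* MathComp-Analysis, over an abstract R : realType; points of R^n are rows 'rV[R]_n. *)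
From HB Require Import structures.
From mathcomp Require Import all_boot all_order all_algebra.
From mathcomp Require Import all_classical all_reals all_analysis.

Set Implicit Arguments.
Unset Strict Implicit.
Unset Printing Implicit Defensive.

Import Order.TTheory GRing.Theory Num.Theory.
Import numFieldNormedType.Exports.

Local Open Scope classical_set_scope.
Local Open Scope ring_scope.

Section tuple_product.
Context {R : realType} (n : nat).

Local Notation tupleR k := (k.-tuple (measurableTypeR R)).

Variable mu : {sigma_finite_measure set (tupleR n) -> \bar R}.

Definition tuple_cons (x : measurableTypeR R * tupleR n) : tupleR n.+1 :=
  [tuple of x.1 :: x.2].

Lemma measurable_tuple_cons : measurable_fun setT tuple_cons.
Proof. exact: measurable_cons. Qed.

Definition tuple_uncons (t : tupleR n.+1) : measurableTypeR R * tupleR n :=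
  (thead t, [tuple of behead t]).

Lemma measurable_tuple_uncons : measurable_fun setT tuple_uncons.
Proof.
by apply/measurable_fun_pairP; split;
  [exact: measurable_tnth|exact: measurable_behead].
Qed.

Lemma tuple_consK : cancel tuple_cons tuple_uncons.
Proof.
by move=> [x t]; rewrite /tuple_uncons theadE; congr pair; exact/val_inj.
Qed.

(* The product of one-dimensional Lebesgue measure and mu. *)
Definition tuple_product : set (tupleR n.+1) -> \bar R :=
  pushforward (@lebesgue_measure R \x mu)%E tuple_cons.

Let tuple_product0 : tuple_product set0 = 0%E.
Proof. by rewrite /tuple_product /pushforward preimage_set0 measure0. Qed.

Let tuple_product_ge0 A : (0 <= tuple_product A)%E.
Proof. by rewrite /tuple_product /pushforward; exact: measure_ge0. Qed.

Let tuple_product_sigma_additive : semi_sigma_additive tuple_product.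
Proof.
move=> F mF tF mUF; rewrite /tuple_product /pushforward preimage_bigcup.
apply: measure_semi_sigma_additive.
- by move=> k; rewrite -[X in measurable X]setTI; exact: measurable_tuple_cons.
- apply/trivIsetP => /= i j _ _ ij; rewrite -preimage_setI.
  by move/trivIsetP : tF => /(_ _ _ _ _ ij) ->//; rewrite preimage_set0.
- rewrite -preimage_bigcup -[X in measurable X]setTI.
  exact: measurable_tuple_cons.
Qed.

HB.instance Definition _ := isMeasure.Build _ _ _ tuple_product
  tuple_product0 tuple_product_ge0 tuple_product_sigma_additive.

Let tuple_product_sigma_finite : sigma_finite setT tuple_product.
Proof.
have /sigma_finiteP[F [TF ndF Foo]] := sigma_finiteT (@lebesgue_measure R).
have /sigma_finiteP[G [TG ndG Goo]] := sigma_finiteT mu.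
exists (fun k => tuple_uncons @^-1` (F k `*` G k)).
  apply/seteqP; split=> // t _; set u := tuple_uncons t.
  have [k _ Fk] : (\bigcup_k F k) u.1 by rewrite -TF.
  have [l _ Gl] : (\bigcup_k G k) u.2 by rewrite -TG.
  exists (maxn k l) => //; split.
  - by move: u.1 Fk; exact/subsetPset/ndF/leq_maxl.
  - by move: u.2 Gl; exact/subsetPset/ndG/leq_maxr.
move=> k; have [mF Fk] := Foo k; have [mG Gk] := Goo k; split.
  by rewrite -[X in measurable X]setTI; apply: measurable_tuple_uncons => //;
    exact: measurableX.
rewrite /tuple_product /pushforward (_ : _ @^-1` _ = F k `*` G k); last first.
  by apply/funext => x; rewrite /preimage /mkset tuple_consK.
by rewrite product_measure1E// lte_mul_pinfty// ge0_fin_numE.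
Qed.

HB.instance Definition _ := Measure_isSigmaFinite.Build _ _ _ tuple_product
  tuple_product_sigma_finite.

End tuple_product.

Fixpoint lebesgue_tuple (R : realType) (n : nat) :
    {sigma_finite_measure set (n.-tuple (measurableTypeR R)) -> \bar R} :=
  match n with
  | 0 => dirac [tuple]
  | k.+1 => tuple_product (lebesgue_tuple R k)
  end.

(* n-dimensional Lebesgue measure; meaningful for Borel A, in particular for compact A. *)
Definition volume (R : realType) (n : nat) (A : set 'rV[R]_n) : \bar R :=
  lebesgue_tuple R n [set t | A (\row_i tnth t i)].

Section box.
Context {R : realType}.

Let box n (a b : 'I_n -> R) : set (n.-tuple (measurableTypeR R)) :=
  [set t | forall i, tnth t i \in `[a i, b i]].

Let measurable_box n (a b : 'I_n -> R) : measurable (box a b).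
Proof.
rewrite (_ : box a b = \bigcap_(i in [set: 'I_n])
  ((fun t : n.-tuple (measurableTypeR R) => tnth t i) @^-1` [set` `[a i, b i]])).
  apply: fin_bigcap_measurable; first exact: finite_finset.
  move=> i _; rewrite -[X in measurable X]setTI.
  by apply: measurable_tnth => //; exact: measurable_itv.
by apply/seteqP; split=> t /= h i => [_|]; [exact: h|exact: (h i I)].
Qed.

Lemma volume_box n (a b : 'I_n -> R) : (forall i, a i <= b i) ->
  volume [set x : 'rV[R]_n | forall i, x 0 i \in `[a i, b i]] =
    (\prod_(i < n) (b i - a i))%:E.
Proof.
move=> ab; rewrite /volume (_ : [set t | _] = box a b); last first.
  by apply/seteqP; split=> t /= h i; move: (h i); rewrite mxE.
elim: n a b ab => [|n IH] a b ab.
  rewrite big_ord0 /= diracE mem_set//.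
  by case.
rewrite /= /tuple_product /pushforward.
rewrite (_ : _ @^-1` _ = [set` `[a ord0, b ord0]] `*`
    box (fun i => a (lift ord0 i)) (fun i => b (lift ord0 i))); last first.
  apply/seteqP; split=> [[x t]|[x t]] /=.
    by move=> h; split=> [|i /=]; [have := h ord0|have := h (lift ord0 i)];
      rewrite /tuple_cons/= ?tnth0 ?tnthS.
  move=> [hx ht] i; rewrite /tuple_cons/=.
  by case: (unliftP ord0 i) => [j|] ->; rewrite ?tnthS ?tnth0//; exact: ht.
rewrite product_measure1E//; last exact: measurable_box.
rewrite IH; last by move=> i; exact: ab.
have := lebesgue_measure_itv `[a ord0, b ord0]; rewrite /= => ->.
rewrite lte_fin big_ord_recl EFinM.
case: ltP => [//|ba]; have /eqP -> : a ord0 == b ord0 by rewrite eq_le ab.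
by rewrite subrr.
Qed.

End box.

Definition convex_body (R : realType) (n : nat) (K : set 'rV[R]_n) : Prop :=
  [/\ K !=set0, compact K & convex_set K].

Definition coord_subspace (R : realType) (n : nat) (J : {set 'I_n}) :
    {vspace 'rV[R]_n} :=
  (\sum_(i in J) <[delta_mx ord0 i]>)%VS.

Definition dotrow (R : realType) (n : nat) (x y : 'rV[R]_n) : R :=
  \sum_(i < n) x 0 i * y 0 i.

Definition is_orth_proj (R : realType) (n : nat) (E : {vspace 'rV[R]_n})
    (x y : 'rV[R]_n) : Prop :=
  y \in E /\ forall z, z \in E -> dotrow (x - y) z = 0.

Definition orth_proj_set (R : realType) (n : nat) (E : {vspace 'rV[R]_n})
    (K : set 'rV[R]_n) : set 'rV[R]_n :=
  [set y | exists2 x, K x & is_orth_proj E x y].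

Definition anti_blocking (R : realType) (n : nat) (K : set 'rV[R]_n) : Prop :=
  [/\ convex_body K,
      (forall x, K x -> forall i, 0 <= x 0 i)
    & (forall J : {set 'I_n}, orth_proj_set (coord_subspace R J) K =
         K `&` [set x | x \in coord_subspace R J])].

(* The general formula at p = 1 would rely on 0 `^ 0 = 1; hence the case split. *)
Definition lp_sum (R : realType) (n : nat) (p : R) (K L : set 'rV[R]_n) :
    set 'rV[R]_n :=
  if p == 1 then [set x + y | x in K & y in L]
  else let rq := fine (hoelder_conjugate p%:E)^-1%E in
    [set z | exists x y (t : R), [/\ K x, L y, 0 <= t <= 1 &
      z = (1 - t) `^ rq *: x + t `^ rq *: y]].

Definition neg_set (R : realType) (n : nat) (K : set 'rV[R]_n) :
    set 'rV[R]_n :=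
  [set - x | x in K].

Definition volume_bound (R : realType) (n : nat) (p : R) (c : R) : Prop :=
  forall A B C : set 'rV[R]_n,
    anti_blocking A -> anti_blocking B -> anti_blocking C ->
    (volume A * volume (lp_sum p (lp_sum p A (neg_set B)) (neg_set C)) <=
     c%:E * volume (lp_sum p A (neg_set B)) * volume (lp_sum p A (neg_set C)))%E.

Definition is_smallest_bound (R : realType) (n : nat) (p : R) (b : R) : Prop :=
  volume_bound n p b /\ lbound [set c | volume_bound n p c] b.

(* Euler's integral; the Gamma function only for x > 0. *)
Definition Gamma (R : realType) (x : R) : R :=
  \int[@lebesgue_measure R]_(t in `]0, +oo[) (t `^ (x - 1) * expR (- t)).

(* For n <= i + j; the subtraction is the truncated one of nat. *)
Definition dn2 (R : realType) (n i j : nat) : R :=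
  ('C(i, i + j - n) * 'C(j, i + j - n))%:R / 'C(n, i + j - n)%:R.

(* Positive for i, j <= n <= i + j, and (i, j) = (n, n) is such a pair, so a maximum over
   these pairs may be taken with default value 0. Since (+oo)^-1 = 0, rq = 0 when q = +oo. *)
Definition bterm (R : realType) (n : nat) (q : \bar R) (i j : nat) : R :=
  let rq := fine q^-1%E in
  dn2 R n i j *
    (Gamma (1 + (i + j - n)%:R * rq) * Gamma (1 + n%:R * rq) /
     (Gamma (1 + i%:R * rq) * Gamma (1 + j%:R * rq))).

(* Main.v *)
(** Sums are cut one coordinate direction at a time. If A, B, C are anti-blocking, a line parallel
to e_i meets the p-sum of A, -B, -C in an interval contained in [-(b + c), a], where a, b, c are the
largest coordinates attainable by a summand when the two others vanish at i, and meets the p-sum of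
A, -B in exactly [-b, a]. Iterating over the coordinates bounds the volume of the p-sum by the sum,
over all colourings of the coordinates by A, B, C, of the volumes of the p-sums of the coordinate
sections prescribed by the colouring, with equality when only A and B are present. These sections
are mutually orthogonal, and Euler's integral turns the volume of their p-sum into the product of
their volumes times Gamma factors. A colouring with blocks G, K, H corresponds to the pair of
two-block partitions (G + K, H), (G + H, K), and distinct colourings give distinct pairs, so the
inequality follows termwise from the local Loomis-Whitney inequality
  |A| |A_G| <= d |A_(G+K)| |A_(G+H)|,
obtained from Brunn-Minkowski through Berwald's inequality. For sharpness, let B and C be cubes of
side tending to infinity in the coordinates H and K, so that a single colouring dominates, and let
A be a body with equality in the local Loomis-Whitney inequality. *)
Require Import Defs.
From mathcomp Require Import all_boot all_order all_algebra.
From mathcomp Require Import all_classical all_reals all_analysis.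
From mathcomp Require Import measurable_realfun.
From mathcomp Require Import ring lra zify.

Set Implicit Arguments.
Unset Strict Implicit.
Unset Printing Implicit Defensive.

Import Order.TTheory GRing.Theory Num.Theory.
Import numFieldNormedType.Exports.

Local Open Scope classical_set_scope.
Local Open Scope ring_scope.

(** * Iterated integrals *)

(** All sums are encoded by triples of summands, [psum], with weights in a simplex and with
    [[set 0]] as third body in the sums of two. Colouring a coordinate then just sets two of its
    three entries to zero, which closure under shrinking permits; p = 1 is covered too, since the
    exponent r = 1 - 1/p is then 0 and 0^0 = 1. Cutting along e_i requires i to be the innermost
    variable, hence the integrals over lists of coordinates, the others being frozen; these also
    give the volumes of sections. Closure under shrinking also makes one-dimensional superlevel sets
    intervals starting at 0, so that the one-dimensional Prékopa-Leindler inequality becomes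
    elementary. The binomials are beta integrals: a fibre of A over A_G lies in the product of its
    K- and H-sections, the weighted inequality of the means separates this product into two moments
    of order k + h, and Berwald's inequality compares each with the moment of a cone. All these
    steps are equalities when the fibres are cubes whose side decreases linearly over a simplex,
    which is the extremal body. *)

Lemma ge0_le_integralT d (T : measurableType d) (R : realType)
    (mu : {measure set T -> \bar R}) (f g : T -> \bar R) :
  (forall x, 0 <= f x)%E -> (forall x, f x <= g x)%E ->
  (\int[mu]_x f x <= \int[mu]_x g x)%E.
Proof.
move=> f0 fg; have g0 x : (0 <= g x)%E by exact: le_trans (f0 x) (fg x).
(* The integral of a nonnegative function is a supremum over the simple functions below it, so
   pointwise comparison suffices for arbitrary functions. *)
rewrite !ge0_integralTE//; apply: ereal_sup_le => _ [h hf <-].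
by exists h => // x; exact: le_trans (hf x) (fg x).
Qed.

Section iterated_integral.
Context {R : realType} {n : nat}.
Local Notation pt := 'rV[R]_n.
Local Notation tup := (n.-tuple (measurableTypeR R)).
Local Notation leb := (@lebesgue_measure R).
Implicit Types (x y : pt) (i j : 'I_n) (s : seq 'I_n) (f g : pt -> \bar R).

Definition rowt (t : tup) : pt := \row_i tnth t i.

Definition upd x i (r : R) : pt := \row_j (if j == i then r else x 0 j).

Lemma updE x i r j : upd x i r 0 j = if j == i then r else x 0 j.
Proof. by rewrite mxE. Qed.

Lemma updC x i j r r' : i != j -> upd (upd x i r) j r' = upd (upd x j r') i r.
Proof.
move=> ij; apply/rowP => k; rewrite !updE.
by have [->|//] := eqVneq k j; rewrite eq_sym (negbTE ij).
Qed.

(** The head of [s] is the outermost variable; coordinates outside [s] stay frozen at their values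
    in [x]. *)
Fixpoint iint s f x : \bar R :=
  if s is i :: s' then (\int[leb]_r iint s' f (upd x i r))%E else f x.

Lemma iint_cat s1 s2 f x : iint (s1 ++ s2) f x = iint s1 (iint s2 f) x.
Proof. by elim: s1 x => //= i s IH x; apply: eq_integral => r _; rewrite IH. Qed.

Lemma iint_ge0 s f x : (forall x, 0 <= f x)%E -> (0 <= iint s f x)%E.
Proof. by move=> f0; elim: s x => //= i s IH x; apply: integral_ge0 => r _. Qed.

Lemma le_iint s f g x : (forall x, 0 <= f x)%E -> (forall x, f x <= g x)%E ->
  (iint s f x <= iint s g x)%E.
Proof.
move=> f0 fg; elim: s x => //= i s IH x.
by apply: ge0_le_integralT => r //; exact: iint_ge0.
Qed.

Lemma eq_iint_off s f g x y :
  (forall x' y', (forall i, i \notin s -> x' 0 i = x 0 i) ->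
     (forall i, i \notin s -> y' 0 i = y 0 i) ->
     (forall i, i \in s -> x' 0 i = y' 0 i) -> f x' = g y') ->
  iint s f x = iint s g y.
Proof.
elim: s x y => /= [|i s IH] x y fg; first by apply: fg.
apply: eq_integral => r _; apply: IH => x' y' hx hy hxy; apply: fg.
- move=> j; rewrite inE negb_or => /andP[ji js].
  by rewrite hx// updE (negbTE ji).
- move=> j; rewrite inE negb_or => /andP[ji js].
  by rewrite hy// updE (negbTE ji).
- move=> j; rewrite inE => /orP[/eqP ->|]; last exact: hxy.
  have [/hxy//|si] := boolP (i \in s).
  by rewrite hx// hy// !updE eqxx.
Qed.

Lemma eq_iint s f g x : f =1 g -> iint s f x = iint s g x.
Proof. by move=> /funext ->. Qed.

(** Measurability is tested on tuples, the space on which [volume] is defined. *)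
Definition mfun (f : pt -> \bar R) := measurable_fun [set: tup] (f \o rowt).

Lemma measurable_coord i : measurable_fun [set: tup] (fun t => rowt t 0 i).
Proof.
rewrite (_ : (fun _ => _) = fun t => tnth t i); last first.
  by apply/funext => t; rewrite mxE.
exact: measurable_tnth.
Qed.

Section joint.
Context d (P : measurableType d).

(** Joint measurability in a parameter and a point, as Tonelli's theorem requires when a level or a
    dilation factor is integrated together with the coordinates. *)
Definition jmeas (f : P -> pt -> \bar R) :=
  measurable_fun [set: P * tup] (fun p => f p.1 (rowt p.2)).

Lemma jmeas_comp d' (Q : measurableType d') (f : P -> pt -> \bar R)
    (h : Q -> P) (u : Q -> pt) : jmeas f -> measurable_fun setT h ->
  (forall i, measurable_fun setT (fun q => u q 0 i)) ->
  measurable_fun [set: Q] (fun q => f (h q) (u q)).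
Proof.
move=> mf mh mu.
pose v q : tup := [tuple u q 0 i | i < n].
have mv : measurable_fun setT (fun q => (h q, v q)).
  apply/measurable_fun_pairP; split=> //=; apply/measurable_fun_tnthP => j.
  by apply: (eq_measurable_fun (fun q => u q 0 j)) => // q _ /=;
    rewrite tnth_mktuple.
have := measurableT_comp mf mv.
apply: eq_measurable_fun => q _ /=; congr f.
by apply/rowP => j; rewrite !mxE tnth_mktuple.
Qed.

Lemma jmeas_cst (f : pt -> \bar R) : mfun f -> jmeas (fun _ => f).
Proof. by move=> mf; exact: (measurableT_comp mf). Qed.

Lemma jmeas_mfun (f : P -> pt -> \bar R) p : jmeas f -> mfun (f p).
Proof.
move=> mf; have := @jmeas_comp _ tup f (cst p) rowt mf; apply => //.
exact: measurable_coord.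
Qed.

Lemma jmeas_upd (f : P -> pt -> \bar R) i : jmeas f ->
  measurable_fun [set: (P * tup) * R]
    (fun p => f p.1.1 (upd (rowt p.1.2) i p.2)).
Proof.
move=> mf; apply: (jmeas_comp mf).
  exact: (measurableT_comp measurable_fst measurable_fst).
move=> j; rewrite (_ : (fun _ => _) =
    if j == i then snd else fun p : (P * tup) * R => rowt p.1.2 0 j); last first.
  by apply/funext => p /=; rewrite updE; case: eqP.
case: ifP => _ //; apply: (measurableT_comp (measurable_coord j)).
exact: (measurableT_comp measurable_snd measurable_fst).
Qed.

Lemma jmeas_iint s (f : P -> pt -> \bar R) : (forall p x, 0 <= f p x)%E ->
  jmeas f -> jmeas (fun p => iint s (f p)).
Proof.
move=> f0 mf; elim: s => //= i s IH.
have mg := jmeas_upd i IH.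
have := @measurable_fun_fubini_tonelli_F _ _ _ _ R leb _ mg; apply => p.
exact: iint_ge0.
Qed.

Lemma iint_integral (mu : {sigma_finite_measure set P -> \bar R}) s
    (f : P -> pt -> \bar R) x : (forall p x, 0 <= f p x)%E -> jmeas f ->
  (\int[mu]_p iint s (f p) x)%E = iint s (fun y => \int[mu]_p f p y)%E x.
Proof.
move=> f0 mf; elim: s x => //= i s IH x.
under [RHS]eq_integral do rewrite -IH.
rewrite [LHS](@fubini_tonelli _ _ _ _ R mu leb
  (fun p => iint s (f p.1) (upd x i p.2)))//=.
  apply: (jmeas_comp (jmeas_iint s f0 mf)) => // j.
  rewrite (_ : (fun _ => _) = if j == i then snd else cst (x 0 j)).
    by case: ifP.
  by apply/funext => p /=; rewrite updE; case: eqP.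
by move=> p; exact: iint_ge0.
Qed.

End joint.

Lemma mfun_comp d (Q : measurableType d) f (u : Q -> pt) : mfun f ->
  (forall i, measurable_fun setT (fun q => u q 0 i)) ->
  measurable_fun [set: Q] (fun q => f (u q)).
Proof.
move=> mf mu.
apply: (@jmeas_comp _ (measurableTypeR R) _ Q (fun _ => f) (cst 0) u) => //.
exact: jmeas_cst.
Qed.

Lemma mfun_upd f x i : mfun f -> measurable_fun [set: R] (fun r => f (upd x i r)).
Proof.
move=> mf; apply: (mfun_comp mf) => j.
rewrite (_ : (fun _ => _) = if j == i then id else cst (x 0 j)).
  by case: ifP.
by apply/funext => p /=; rewrite updE; case: eqP.
Qed.

Lemma mfun_iint s f : (forall x, 0 <= f x)%E -> mfun f -> mfun (iint s f).
Proof.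
move=> f0 mf; apply: (@jmeas_mfun _ (measurableTypeR R) (fun _ => iint s f) 0).
by apply: jmeas_iint => //; exact: jmeas_cst.
Qed.

Lemma iint_swap i j f x : (forall x, 0 <= f x)%E -> mfun f ->
  iint [:: i; j] f x = iint [:: j; i] f x.
Proof.
move=> f0 mf; have [->//|ij] := eqVneq i j; rewrite /=.
pose F (p : R * R) := f (upd (upd x i p.1) j p.2).
have mF : measurable_fun setT F.
  apply: (mfun_comp mf) => k.
  rewrite (_ : (fun _ => _) = if k == j then snd else
     if k == i then fst else cst (x 0 k)).
    by case: ifP => // _; case: ifP.
  by apply/funext => p /=; rewrite !updE; case: eqP => // _; case: eqP.
have F0 p : (0 <= F p)%E by exact: f0.
apply: etrans (@fubini_tonelli _ _ _ _ R leb leb F mF F0) _.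
by apply: eq_integral => r _; apply: eq_integral => r' _; rewrite /F /= updC.
Qed.

Lemma iint_rot1 i s f x : (forall x, 0 <= f x)%E -> mfun f ->
  iint (i :: s) f x = iint (rcons s i) f x.
Proof.
move=> f0 mf; elim: s x => // j s IH x.
rewrite -[i :: j :: s]/([:: i; j] ++ s) iint_cat iint_swap; last 2 first.
  by move=> y; exact: iint_ge0.
  exact: mfun_iint.
rewrite rcons_cons -iint_cat; apply: eq_integral => r _; exact: IH.
Qed.

(** Tonelli's theorem exchanges neighbouring variables, and such exchanges generate all
    permutations. *)
Lemma iint_perm s1 s2 f x : (forall x, 0 <= f x)%E -> mfun f ->
  perm_eq s1 s2 -> iint s1 f x = iint s2 f x.
Proof.
move=> f0 mf; elim: s1 s2 x => [|i s IH] s2 x.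
  by move=> /perm_size/esym/size0nil ->.
move=> h; have : i \in s2 by rewrite -(perm_mem h) mem_head.
move=> /path.splitPr def_s2; case: def_s2 h => a b.
move=> h0; have {h0}h : perm_eq s (a ++ b).
  by rewrite -(perm_cons i) (perm_trans h0)// -[i :: b]cat1s perm_catCA.
rewrite -cat_rcons !iint_cat.
transitivity (iint (i :: a) (iint b f) x).
  by apply: eq_integral => r _; exact: etrans (IH _ _ h) (iint_cat _ _ _ _).
by rewrite iint_rot1//; [move=> y; exact: iint_ge0|exact: mfun_iint].
Qed.

End iterated_integral.

(** * Volumes as iterated integrals *)

Section one_dim.
Context {R : realType}.
Local Notation leb := (@lebesgue_measure R).

(** The rescaled pushforward agrees with Lebesgue measure on half-open intervals, hence everywhere
    by uniqueness. *)
Lemma lebesgue_measure_scale (c : R) (A : set (measurableTypeR R)) : 0 < c ->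
  measurable A -> leb A = (c%:E * leb ((fun r => (c * r)%R) @^-1` A))%E.
Proof.
move=> c0 mA.
pose h : measurableTypeR R -> measurableTypeR R := fun r => c * r.
have mh : measurable_fun setT h by exact: mulrl_measurable.
pose M : {measure set (measurableTypeR R) -> \bar R} :=
  measure_function_pushforward__canonical__measure_function_Measure leb mh.
have := @lebesgue_measure_unique R (mscale (NngNum (ltW c0)) M).
move=> -> //= _ [[a b]] _ <-.
have E : h @^-1` `]a, b] = `]a / c, b / c]%classic.
  by apply/seteqP; split => r /=; rewrite !in_itv/= ltr_pdivrMr// ler_pdivlMr// mulrC.
transitivity (c%:E * leb (h @^-1` `]a, b]))%E => //; rewrite E.
rewrite !lebesgue_measure_itv/= !lte_fin ltr_pM2r ?invr_gt0//.
case: ifP => _; last by rewrite mule0.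
by rewrite -!EFinD -EFinM mulrBr !(mulrC c) !divfK// gt_eqF.
Qed.

Lemma ge0_integral_scale (c : R) (f : R -> \bar R) : 0 < c ->
  measurable_fun setT f -> (forall r, 0 <= f r)%E ->
  (\int[leb]_r f r = c%:E * \int[leb]_r f (c * r)%R)%E.
Proof.
move=> c0 mf f0.
pose h : measurableTypeR R -> measurableTypeR R := fun r => c * r.
have mh : measurable_fun setT h by exact: mulrl_measurable.
pose M : {measure set (measurableTypeR R) -> \bar R} :=
  measure_function_pushforward__canonical__measure_function_Measure leb mh.
transitivity (\int[mscale (NngNum (ltW c0)) M]_r f r)%E.
  by apply: eq_measure_integral => A mA _; exact: (lebesgue_measure_scale c0 mA).
rewrite ge0_integral_mscale//; congr (_ * _)%E.
by rewrite [LHS](@ge0_integral_pushforward _ _ _ _ _ _ mh).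
Qed.

Definition ind {T} (A : set T) (x : T) : \bar R := (\1_A x)%:E.

Lemma ind_ge0 T (A : set T) x : (0 <= ind A x)%E.
Proof. by rewrite /ind lee_fin indicE. Qed.

Lemma le_ind T T' (A : set T) (B : set T') x y :
  (A x -> B y) -> (ind A x <= ind B y)%E.
Proof.
move=> AB; rewrite /ind !indicE lee_fin ler_nat.
by case: (boolP (x \in A)) => // /set_mem/AB/mem_set ->.
Qed.

Lemma eq_ind T T' (A : set T) (B : set T') x y :
  (A x <-> B y) -> ind A x = ind B y.
Proof.
by move=> [h1 h2]; apply/eqP; rewrite eq_le !le_ind.
Qed.

Lemma ind1 T (A : set T) x : A x -> ind A x = 1%E.
Proof. by move=> Ax; rewrite /ind indicE mem_set. Qed.

Lemma ind0 T (A : set T) x : ~ A x -> ind A x = 0%E.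
Proof. by move=> Ax; rewrite /ind indicE memNset. Qed.

Lemma integral_ind (A : set R) : measurable A ->
  (\int[leb]_r ind A r = leb A)%E.
Proof. by move=> mA; rewrite integral_indic// setIT. Qed.

Definition down1 (X : set R) := forall a b, 0 <= b -> b <= a -> X a -> X b.

(** Such a set is an interval from 0 to its supremum, with or without the right endpoint, which does
    not affect the measure. *)
Lemma down1_measure (X : set R) (M : R) : down1 X -> (forall a, X a -> 0 <= a <= M) ->
  X !=set0 -> measurable X /\ leb X = (sup X)%:E /\ (forall a, X a -> 0 <= a <= sup X).
Proof.
move=> dX bX X0.
have hs : has_sup X by split => //; exists M => a /bX/andP[].
have le_sup a : X a -> a <= sup X by move=> Xa; apply: sup_upper_bound.
have mX : measurable X.
  apply: is_interval_measurable => a b Xa Xb c /andP[ac cb].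
  by apply: (dX b) => //; have /andP[? _] := bX _ Xa; exact: le_trans ac.
have s0 : 0 <= sup X.
  by case: X0 => a Xa; have /andP[a0 _] := bX _ Xa; exact: le_trans a0 (le_sup _ Xa).
split => //; split; last by move=> a Xa; rewrite le_sup// andbT; case/andP: (bX _ Xa).
apply/eqP; rewrite eq_le; apply/andP; split.
  apply: (@le_trans _ _ (leb `[0, sup X]%classic)).
    apply: le_measure; rewrite ?inE//= => a Xa /=; rewrite in_itv/= le_sup// andbT.
    by case/andP: (bX _ Xa).
  by rewrite lebesgue_measure_itv/= lte_fin; case: ifP => // _; rewrite -EFinD subr0.
apply: (@le_trans _ _ (leb `[0, sup X[%classic)).
  rewrite lebesgue_measure_itv/= lte_fin; case: ifPn => [_|]; first by rewrite -EFinD subr0.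
  by rewrite -leNgt => h; rewrite lee_fin.
apply: le_measure; rewrite ?inE//= => a /=; rewrite in_itv/= => /andP[a0 aX].
have [] := @sup_adherent R X (sup X - a) _ hs; first by rewrite subr_gt0.
move=> b Xb; rewrite opprB addrC subrK => ab.
by apply: (dX b) => //; exact: ltW.
Qed.

End one_dim.

Section volume_iint.
Context {R : realType}.
Local Notation leb := (@lebesgue_measure R).

Definition mset n (A : set 'rV[R]_n) :=
  measurable [set t : n.-tuple (measurableTypeR R) | A (rowt t)].

Lemma mfun_ind n (A : set 'rV[R]_n) : mset A -> mfun (ind A).
Proof.
move=> mA.
have := @measurable_indic _ _ R setT _ mA.
move/measurable_EFinP; apply: eq_measurable_fun => t _ /=.
by apply: eq_ind.
Qed.

Definition consr n (r : R) (x : 'rV[R]_n) : 'rV[R]_n.+1 :=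
  \row_i (if unlift ord0 i is Some j then x 0 j else r).

Lemma upd_consr n r (x : 'rV[R]_n) i v :
  upd (consr r x) (lift ord0 i) v = consr r (upd x i v).
Proof.
apply/rowP => j; rewrite updE !mxE; case: unliftP => [k ->|->] /=.
  by rewrite (inj_eq lift_inj) !mxE.
by [].
Qed.

Lemma iint_consr n r (x : 'rV[R]_n) s (f : 'rV[R]_n.+1 -> \bar R) :
  iint (map (lift ord0) s) f (consr r x) = iint s (f \o consr r) x.
Proof.
elim: s x => //= i s IH x; apply: eq_integral => v _.
by rewrite upd_consr; exact: IH.
Qed.

Lemma enum_ordSl n : enum 'I_n.+1 = ord0 :: map (lift ord0) (enum 'I_n).
Proof. exact: enum_ordSl. Qed.

(** The base point is arbitrary because every coordinate gets integrated. In the induction, a slice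
    of the product measure is a section at a first coordinate, written [consr r]. *)
Lemma volume_iint n (A : set 'rV[R]_n) x : 
  volume A = iint (enum 'I_n) (ind A) x.
Proof.
rewrite /volume -/(rowt _).
elim: n A x => [|n IH] A x.
  rewrite enum_ord0 /= diracE /ind indicE; congr (_%:R%:E); congr nat_of_bool.
  apply/idP/idP => /set_mem/= h; apply/mem_set => /=; move: h; congr A;
   by apply/rowP => -[].
rewrite enum_ordSl /= /tuple_product /pushforward /= /product_measure1.
apply: eq_integral => r _ /=.
rewrite (@eq_iint_off _ _ _ (ind A) (ind A) _ (consr r 0)); last first.
  move=> x' y' hx hy hxy; congr ind; apply/rowP => i.
  have [/hxy//|hi] := boolP (i \in [seq lift ord0 k | k <- enum 'I_n]).
  rewrite hx// hy// updE mxE; case: unliftP hi => [k ->|->].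
    by rewrite map_f// mem_enum.
  by rewrite eqxx.
rewrite iint_consr -(IH (fun y => A (consr r y)) 0) /xsection /=.
congr (lebesgue_tuple R n _); apply/seteqP; split => t /=; rewrite ?inE /=;
  congr A; apply/rowP => i; rewrite !mxE; case: unliftP => [k ->|->];
  by rewrite ?mxE ?tnthS ?tnth0.
Qed.

End volume_iint.

(** * Measurability of closed sets *)

Section closed_measurable.
Context {R : realType} {n : nat}.

Lemma mset_box (a b : 'I_n -> R) :
  mset [set x : 'rV[R]_n | forall i, x 0 i \in `[a i, b i]].
Proof.
rewrite /mset (_ : [set t | _] = \bigcap_(i in [set: 'I_n])
  ((fun t : n.-tuple (measurableTypeR R) => rowt t 0 i) @^-1` [set` `[a i, b i]])).
  apply: fin_bigcap_measurable; first exact: finite_finset.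
  move=> i _; rewrite -[X in measurable X]setTI.
  by apply: measurable_coord => //; exact: measurable_itv.
by apply/seteqP; split=> t /= h i => [_|]; [exact: h|exact: (h i I)].
Qed.

(** A closed set is the intersection over k of the unions of those cells of the grid of mesh 1/(k+1)
    that meet it; each union is countable. *)
Lemma closed_mset (A : set 'rV[R]_n) : closed A -> mset A.
Proof.
move=> cA.
pose box k (m : {ffun 'I_n -> int}) : set 'rV[R]_n :=
  [set x | forall i, x 0 i \in `[(m i)%:~R / k.+1%:R, ((m i)%:~R + 1) / k.+1%:R]].
pose U k m := [set t : n.-tuple (measurableTypeR R) |
   box k m (rowt t) /\ box k m `&` A !=set0].
rewrite /mset (_ : [set t | _] = \bigcap_k \bigcup_m U k m).
  apply: bigcapT_measurable => k; apply: countable_bigcupT_measurable.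
    exact: countableP.
  move=> m; have [hA|hA] := pselect (box k m `&` A !=set0).
    rewrite (_ : U k m = [set t | box k m (rowt t)]); first exact: mset_box.
    by apply/seteqP; split => t //= [].
  rewrite (_ : U k m = set0); first exact: measurable0.
  by apply/seteqP; split => t //= [].
apply/seteqP; split => t /=.
  move=> At k _; exists [ffun i => Num.floor (rowt t 0 i * k.+1%:R)] => //.
  have H : box k [ffun i => Num.floor (rowt t 0 i * k.+1%:R)] (rowt t).
    move=> i; rewrite ffunE in_itv/= ler_pdivrMr// ler_pdivlMr//.
    rewrite floor_le/= ltW// -[X in _ + X](_ : 1%:~R = 1)// -intrD.
    exact: floorD1_gt.
  by split=> //; exists (rowt t).
move=> H; apply: cA => B /nbhs_ballP[e /= e0 eB].
have [k ke] : exists k : nat, k.+1%:R^-1 < e.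
  exists (Num.truncn e^-1); rewrite invf_plt ?posrE//.
  exact: Num.Theory.truncnS_gt.
have [m _ [tm [y [ym Ay]]]] := H k I.
exists y; split => //; apply: eB; split => // i j /=; rewrite ord1.
rewrite /ball/=; apply: le_lt_trans ke.
have := tm j; have := ym j; rewrite !in_itv/= => /andP[y1 y2] /andP[t1 t2].
have E : ((m j)%:~R + 1) / k.+1%:R = (m j)%:~R / k.+1%:R + k.+1%:R^-1 :> R by rewrite mulrDl mul1r.
move: y2 t2 y1 t1; rewrite E ler_norml; move: ((m j)%:~R / k.+1%:R) => u; move: (k.+1%:R^-1) => v.
by move: (rowt t 0 j) (y 0 j) => a b *; apply/andP; split; lra.
Qed.

Lemma compact_mset (A : set 'rV[R]_n) : compact A -> mset A.
Proof. by move=> cA; apply: closed_mset; apply: compact_closed. Qed.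

End closed_measurable.

Section continuity.
Context {R : realType} {n : nat}.

Lemma continuous_rV (T : topologicalType) (f : T -> 'rV[R]_n) :
  (forall i, continuous (fun x => f x 0 i)) -> continuous f.
Proof.
move=> cf x B /nbhs_ballP[e /= e0 eB].
have H i : \forall y \near x, ball (f x 0 i) e (f y 0 i).
  by apply: (cf i x); apply: nbhsx_ballx.
apply: filterS (filter_forall _ H) => y hy.
by apply: eB; split => // i j; rewrite ord1; exact: hy.
Qed.

(** The absolute value gives continuity on the whole line, although only nonnegative weights matter.
    For r = 0 the function is constant, as 0^0 = 1. *)
Lemma continuous_norm_powR (r : R) : 0 <= r -> continuous (fun t : R => `|t| `^ r).
Proof.
rewrite le_eqVlt => /orP[/eqP <-|r0].
  rewrite (_ : (fun _ => _) = cst 1); first by move=> t; exact: cvg_cst.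
  by apply/funext => t; rewrite powRr0.
move=> t; have [->|t0] := eqVneq t 0; last first.
  apply: (@continuous_comp _ _ _ (fun t : R => `|t|) (fun t => t `^ r)).
    exact: norm_continuous.
  apply/differentiable_continuous/derivable1_diffP.
  by apply: derivable_powR; rewrite in_itv/= andbT normr_gt0.
apply/cvgrPdist_lt => e e0; near=> s.
rewrite normr0 powR0 ?gt_eqF// sub0r normrN ger0_norm ?powR_ge0//.
rewrite -[ltRHS](_ : (e `^ r^-1) `^ r = e); last first.
  by rewrite -powRrM mulVf ?gt_eqF// powRr1// ltW.
rewrite gt0_ltr_powR// ?nnegrE ?powR_ge0//.
near: s; apply/nbhs_ballP; exists (e `^ r^-1) => /=; first by rewrite powR_gt0.
by move=> s; rewrite /ball/= sub0r normrN.
Unshelve. all: by end_near. Qed.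

End continuity.

(** * Coloured sections of sums and their compactness *)

Section sections.
Context {R : realType} {n : nat}.
Local Notation pt := 'rV[R]_n.

(** Triples of summands of the p-sum of three bodies, with r = 1/q and weights in a simplex instead
    of iterated binary weights. For r = 0 the condition reads X_k in A_k, which is the Minkowski
    sum. *)
Definition psum (r : R) (A : 'I_3 -> set pt) (X : 'I_3 -> pt) : Prop :=
  exists tau : 'I_3 -> R, [/\ forall k, 0 <= tau k, \sum_k tau k = 1 &
    forall k, exists2 a, A k a & X k = tau k `^ r *: a].

Definition mask (c : option 'I_3) (k : 'I_3) : R :=
  if c is Some h then (k == h)%:R else if k == ord0 then 1 else -1.

(* The coordinate i of a point is X_0 - X_1 - X_2 if [c i = None]; if [c i = Some h], then only the
   summand X_h is nonzero at i, and it enters with a positive sign. *)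
Definition sect (D : ('I_3 -> pt) -> Prop) (c : 'I_n -> option 'I_3) : set pt :=
  [set w | exists2 X, D X & forall i,
     w 0 i = \sum_k mask (c i) k * X k 0 i /\
     (forall k h, c i = Some h -> k != h -> X k 0 i = 0)].

(** The section is the continuous image of a compact parameter set: weights in [0, 1] and points of
    the three bodies, cut out by the closed conditions that the weights sum to 1 and that the
    suppressed entries vanish. *)
Lemma compact_sect r A c : 0 <= r -> (forall k, compact (A k)) ->
  compact (sect (psum r A) c).
Proof.
move=> r0 cA.
pose P := ((R * R * R) * (pt * pt * pt))%type.
pose T (p : P) (k : 'I_3) : R :=
  match val k with 0 => p.1.1.1 | 1 => p.1.1.2 | _ => p.1.2 end.
pose a (p : P) (k : 'I_3) : pt :=
  match val k with 0 => p.2.1.1 | 1 => p.2.1.2 | _ => p.2.2 end.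
have cT k : continuous (fun p => T p k).
  rewrite /T; case: k => -[|[|k]] _ /= p.
  - apply: (@continuous_comp _ _ _ (fun p : P => p.1.1) fst); last exact: cvg_fst.
    by apply: (@continuous_comp _ _ _ fst fst); exact: cvg_fst.
  - apply: (@continuous_comp _ _ _ (fun p : P => p.1.1) snd); last exact: cvg_snd.
    by apply: (@continuous_comp _ _ _ fst fst); exact: cvg_fst.
  - by apply: (@continuous_comp _ _ _ fst snd); [exact: cvg_fst|exact: cvg_snd].
have ca k : continuous (fun p => a p k).
  rewrite /a; case: k => -[|[|k]] _ /= p.
  - apply: (@continuous_comp _ _ _ (fun p : P => p.2.1) fst); last exact: cvg_fst.
    by apply: (@continuous_comp _ _ _ snd fst); [exact: cvg_snd|exact: cvg_fst].
  - apply: (@continuous_comp _ _ _ (fun p : P => p.2.1) snd); last exact: cvg_snd.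
    by apply: (@continuous_comp _ _ _ snd fst); [exact: cvg_snd|exact: cvg_fst].
  - by apply: (@continuous_comp _ _ _ snd snd); exact: cvg_snd.
pose X (p : P) (k : 'I_3) (i : 'I_n) : R := `|T p k| `^ r * a p k 0 i.
have cX k i : continuous (fun p => X p k i).
  move=> p; apply: cvgM.
    apply: (@continuous_comp _ _ _ (fun p => T p k) (fun t : R => `|t| `^ r)).
      exact: cT.
    exact: continuous_norm_powR.
  apply: (@continuous_comp _ _ _ (fun p => a p k) (fun x : pt => x 0 i)).
    exact: ca.
  exact: coord_continuous.
have csum (F : P -> 'I_3 -> R) : (forall k, continuous (F^~ k)) ->
    continuous (fun p => \sum_k F p k).
  move=> cF p; apply: cvg_big => //=; first exact: add_continuous.
  by move=> k _; exact: cF.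
pose W p : pt := \row_i \sum_k mask (c i) k * X p k i.
have cW : continuous W.
  apply: continuous_rV => i; rewrite (_ : (fun _ => _) =
    fun p => \sum_k mask (c i) k * X p k i); last first.
    by apply/funext => p; rewrite mxE.
  apply: csum => k p; apply: cvgM; first exact: cvg_cst.
  exact: cX.
pose K := ((`[0, 1] `*` `[0, 1] `*` `[0, 1]) `*` (A ord0 `*` A (inord 1) `*` A (inord 2)))
  : set P.
pose C1 := [set p : P | \sum_k T p k = 1].
pose C2 := \bigcap_(j in [set u : 'I_n * 'I_3 * 'I_3 | c u.1.1 = Some u.1.2 /\ u.2 != u.1.2])
   [set p : P | X p j.2 j.1.1 = 0].
have cC1 : closed C1.
  have /continuous_closedP h := csum T cT. exact: (h [set x | x = 1] (@closed_eq _ _)).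

have cC2 : closed C2.
  apply: closed_bigI => -[[i h] k] _ /=.
  by have /continuous_closedP h' := cX k i; exact: (h' [set x | x = 0] (@closed_eq _ _)).
have -> : sect (psum r A) c = W @` (K `&` (C1 `&` C2)).
  have i1 : val (inord 1 : 'I_3) = 1%N by rewrite /= inordK.
  have i2 : val (inord 2 : 'I_3) = 2%N by rewrite /= inordK.
  apply/seteqP; split => w /=.
    move=> [Y [tau [t0 t1 tY]] wY].
    have [b hb] : {b : 'I_3 -> pt & forall k, A k (b k) /\ Y k = tau k `^ r *: b k}.
      by apply: (boolp.choice (P := fun k b => A k b /\ Y k = tau k `^ r *: b)) => k;
        have [b] := tY k; exists b.
    pose p : P := ((tau ord0, tau (inord 1), tau (inord 2)),
      (b ord0, b (inord 1), b (inord 2))).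
    have TE k : T p k = tau k.
      by rewrite /T; case: k => -[|[|[|//]]] h /=; congr tau; apply: val_inj => //=; rewrite inordK.
    have aE k : a p k = b k.
      by rewrite /a; case: k => -[|[|[|//]]] h /=; congr b; apply: val_inj => //=; rewrite inordK.
    have XE k i : X p k i = Y k 0 i.
      by rewrite /X TE aE (hb k).2 mxE ger0_norm.
    have tle k : tau k <= 1.
      by rewrite -t1 (bigD1 k)//= lerDl sumr_ge0.
    exists p; last by apply/rowP => i; rewrite mxE (wY i).1; apply: eq_bigr => k _; rewrite XE.
    split.
      by split; split; try split; rewrite /= ?in_itv/= ?t0 ?tle//; exact: (hb _).1.
    split; first by rewrite /C1/= -[RHS]t1; apply: eq_bigr => k _; rewrite TE.
    by move=> [[i h] k] /= [ci kh]; rewrite XE; exact: (wY i).2 ci kh.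
  move=> [p [[[[T0 T1] T2] [[a0 a1] a2]] [pC1 pC2]] <-].
  have Tk k : 0 <= T p k.
    rewrite /T; move: T0 T1 T2; rewrite /= !in_itv/= => /andP[? _] /andP[? _] /andP[? _].
    by case: k => -[|[|k]] h.
  exists (fun k => T p k `^ r *: a p k).
    exists (T p); split => // k; exists (a p k) => //.
    rewrite /a; case: k => -[|[|[|//]]] h /=.
    - by rewrite (_ : Ordinal h = ord0)//; exact: val_inj.
    - by rewrite (_ : Ordinal h = inord 1)//; apply: val_inj; rewrite i1.
    - by rewrite (_ : Ordinal h = inord 2)//; apply: val_inj; rewrite i2.
  have XE k i : (T p k `^ r *: a p k) 0 i = X p k i by rewrite mxE /X ger0_norm.
  move=> i; rewrite mxE; split; first by apply: eq_bigr => k _; rewrite XE.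
  by move=> k h ci kh; rewrite XE; exact: (pC2 (i, h, k)).
apply: continuous_compact.
  by apply: continuous_subspaceT => p; exact: cW.
apply: compact_closedI; last exact: closedI.
have cI : compact (`[0, 1]%classic : set R) by exact: segment_compact.
by apply: compact_setX; apply: compact_setX => //; exact: compact_setX.
Qed.

End sections.

(** * One-dimensional sections of sums *)

Section colorings.
Context {R : realType} {n : nat}.
Local Notation pt := 'rV[R]_n.
Local Notation leb := (@lebesgue_measure R).
Implicit Types (w : pt) (X : 'I_3 -> pt) (c : 'I_n -> option 'I_3) (d : 'I_n -> 'I_3) (D : ('I_3
  -> pt) -> Prop).

Definition down_family D :=
  (forall X, D X -> forall k i, 0 <= X k 0 i) /\
  (forall X Y : 'I_3 -> pt, D X -> (forall k i, 0 <= Y k 0 i <= X k 0 i) -> D Y).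

Definition recolor_option c i (h : option 'I_3) : 'I_n -> option 'I_3 :=
  fun j => if j == i then h else c j.

(** Closure under shrinking allows the three entries at [i] to be lowered to any [y] independently,
    all other coordinates of the summands being kept. Every comparison of slices below is an
    instance. *)
Lemma sect_upd D c i h w X (y : 'I_3 -> R) : down_family D -> D X ->
  (forall j, j != i -> w 0 j = \sum_k mask (c j) k * X k 0 j /\
     (forall k e, c j = Some e -> k != e -> X k 0 j = 0)) ->
  (forall k, 0 <= y k <= X k 0 i) ->
  (forall k e, h = Some e -> k != e -> y k = 0) ->
  sect D (recolor_option c i h) (upd w i (\sum_k mask h k * y k)).
Proof.
move=> [D0 dD] DX Xw yX yh; exists (fun k => upd (X k) i (y k)).
  by apply: (dD _ _ DX) => k j; rewrite updE; case: eqP => [->|_]; rewrite ?yX// lexx D0.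
move=> j; rewrite updE /recolor_option; have [->|ji] := eqVneq j i.
  split; first by apply: eq_bigr => k _; rewrite updE eqxx.
  by move=> k e he ke; rewrite updE eqxx; exact: yh he ke.
have [-> X0] := Xw _ ji; split.
  by apply: eq_bigr => k _; rewrite updE (negbTE ji).
by move=> k e he ke; rewrite updE (negbTE ji); exact: X0 he ke.
Qed.

Lemma sum_mask_Some (e : 'I_3) (y : 'I_3 -> R) : \sum_k mask (Some e) k * y k = y e.
Proof.
rewrite (bigD1 e)//= eqxx mul1r big1 ?addr0// => k /negbTE ke.
by rewrite /mask ke mul0r.
Qed.

Section slices.
Variables (D : ('I_3 -> pt) -> Prop) (M : R).
Hypotheses (dD : down_family D) (bD : forall X, D X -> forall k i, X k 0 i <= M).
Variables (c : 'I_n -> option 'I_3) (i : 'I_n) (w : pt).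
Hypothesis ci : c i = None.

Let Z := [set r | sect D c (upd w i r)].
Let Xs k := [set r | sect D (recolor_option c i (Some k)) (upd w i r)].

Let csetK : recolor_option c i None = c.
Proof. by apply/funext => j; rewrite /recolor_option; case: eqP => // ->. Qed.

(** A decomposition of r at coordinate [i] restricts to each colour by annihilating the other two
    entries. *)
Let Z_Xs r : Z r -> exists2 x : 'I_3 -> R,
  (forall k, Xs k (x k)) & r = \sum_k mask None k * x k.
Proof.
move=> [X DX wX]; exists (fun k => X k 0 i); last first.
  by have [] := wX i; rewrite updE eqxx ci.
move=> e; rewrite /Xs/=.
pose y k := if k == e then X k 0 i else 0.
rewrite [X in upd _ _ X](_ : _ = \sum_k mask (Some e) k * y k); last first.
  by rewrite sum_mask_Some /y eqxx.
apply: (sect_upd dD DX) => [j ji|k|k h [<-]]; last by rewrite /y => /negbTE ->.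
  by have := wX j; rewrite updE (negbTE ji).
by rewrite /y; case: ifP => _; rewrite !(dD.1 _ DX) ?lexx.
Qed.

Let Xs_Z k r : Xs k r -> Z (mask None k * r).
Proof.
move=> [X DX wX]; rewrite /Z/= -csetK.
have [+ X0] := wX i; rewrite updE eqxx /recolor_option eqxx sum_mask_Some => ->.
rewrite [X in upd _ _ X](_ : _ = \sum_k0 mask None k0 * X k0 0 i); last first.
  rewrite (bigD1 k)//= big1 ?addr0// => h hk.
  by rewrite (X0 h k)// /recolor_option ?eqxx// mulr0.
apply: (sect_upd dD DX) => [j ji|h|//]; last by rewrite lexx (dD.1 _ DX).
by have := wX j; rewrite updE /recolor_option (negbTE ji).
Qed.

Let down_Xs k : down1 (Xs k).
Proof.
move=> a b b0 ba [X DX wX]; rewrite /Xs/=.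
have [aE X0] := wX i; move: aE; rewrite updE eqxx /recolor_option eqxx sum_mask_Some => aE.
rewrite (_ : b = \sum_h mask (Some k) h * (if h == k then b else 0)); last first.
  by rewrite sum_mask_Some eqxx.
apply: (sect_upd dD DX) => [j ji|h|h e [<-]]; last by move=> /negbTE ->.
  by have := wX j; rewrite updE /recolor_option (negbTE ji).
by case: eqP => [->|_]; rewrite ?b0 -?aE ?ba ?lexx// (dD.1 _ DX).
Qed.

Let bound_Xs k a : Xs k a -> 0 <= a <= M.
Proof.
move=> [X DX wX]; have [+ _] := wX i.
by rewrite updE eqxx /recolor_option eqxx sum_mask_Some => ->; rewrite (dD.1 _ DX) bD.
Qed.

Let Xs_measure : Z !=set0 -> forall k, [/\ Xs k 0,
  (\int[leb]_r ind (Xs k) r = (sup (Xs k))%:E)%E, forall a, Xs k a -> 0 <= a <= sup (Xs k)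
  & forall a, 0 <= a < sup (Xs k) -> Xs k a].
Proof.
move=> [r Zr] k; have [x Xx _] := Z_Xs Zr.
have X0 : Xs k !=set0 by exists (x k).
have [mX [eX sX]] := down1_measure (@down_Xs k) (@bound_Xs k) X0.
split => //.
- by apply: (down_Xs _ _ (Xx k)) => //; have /andP[] := bound_Xs (Xx k).
- by rewrite integral_ind.
- move=> a /andP[a0 ax].
  have hs : has_sup (Xs k) by split => //; exists M => b /bound_Xs/andP[].
  have [] := @sup_adherent R (Xs k) (sup (Xs k) - a) _ hs; first by rewrite subr_gt0.
  move=> b Xb; rewrite opprB addrC subrK => ab.
  by apply: (down_Xs a0 _ Xb); exact: ltW.
Qed.

Let Xs_empty : ~ (Z !=set0) -> forall k r, ind (Xs k) r = 0%E :> \bar R.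
Proof. by move=> Z0 k r; apply: ind0 => /Xs_Z ?; apply: Z0; eexists; eassumption. Qed.

Let leb_itv (a b : R) (l r : bool) : a <= b ->
  (\int[leb]_x ind [set` Interval (BSide l a) (BSide r b)] x = (b - a)%:E)%E.
Proof.
move=> ab; rewrite integral_ind// lebesgue_measure_itv/= lte_fin.
case: ltP => ab'; first by rewrite -EFinD.
have -> : a = b by apply/eqP; rewrite eq_le ab.
by rewrite subrr.
Qed.

Lemma slice_le : (\int[leb]_r ind Z r <= \sum_k \int[leb]_r ind (Xs k) r)%E.
Proof.
have [Z0|Z0] := pselect (Z !=set0); last first.
  rewrite [leLHS]integral0_eq.
    by apply: sume_ge0 => k _; apply: integral_ge0 => r _; exact: ind_ge0.
  by move=> r _; apply: ind0 => Zr; apply: Z0; exists r.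
rewrite (eq_bigr (fun k => (sup (Xs k))%:E)); last first.
  by move=> k _; have [_ -> _ _] := Xs_measure Z0 k.
have s0 k : 0 <= sup (Xs k).
  by have [X0 _ /(_ _ X0) /andP[_ ->]] := Xs_measure Z0 k.
(* Left end of the interval that contains the slice: both negative summands at their largest, the
   positive one absent. *)
pose a := - (sup (Xs (lift ord0 ord0)) + sup (Xs (lift ord0 (lift ord0 ord0)))).
apply: (@le_trans _ _ (\int[leb]_x ind `[a, sup (Xs ord0)]%classic x)%E).
  apply: ge0_le_integralT => r; first exact: ind_ge0.
  apply: le_ind => /Z_Xs[x Xx ->] /=; rewrite in_itv/=.
  have H k : 0 <= x k <= sup (Xs k) by have [_ _ H _] := Xs_measure Z0 k; exact: H.
  rewrite !big_ord_recl big_ord0 /= !mulN1r mul1r addr0 /a.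
  have := H ord0; have := H (lift ord0 ord0); have := H (lift ord0 (lift ord0 ord0)).
  by move=> /andP[? ?] /andP[? ?] /andP[? ?]; apply/andP; split; lra.
rewrite leb_itv /a; last first.
  by have := s0 ord0; have := s0 (lift ord0 ord0); have := s0 (lift ord0 (lift ord0 ord0)); lra.
rewrite !big_ord_recl big_ord0 adde0 -!EFinD lee_fin; lra.
Qed.

(** The slice contains the slice of colour 0 and the reflected slice of colour 1, glued at 0. The
    interval is taken open because the suprema need not be attained. *)
Lemma slice_ge2 : (\int[leb]_r ind (Xs ord0) r +
  \int[leb]_r ind (Xs (lift ord0 ord0)) r <= \int[leb]_r ind Z r)%E.
Proof.
have [Z0|Z0] := pselect (Z !=set0); last first.
  under eq_integral do rewrite Xs_empty//.
  rewrite integral0 add0e.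
  under eq_integral do rewrite Xs_empty//.
  by rewrite integral0; apply: integral_ge0 => r _; exact: ind_ge0.
have [X0 -> b0 s0] := Xs_measure Z0 ord0.
have [X1 -> b1 s1] := Xs_measure Z0 (lift ord0 ord0).
have /andP[_ ?] := b0 _ X0. have /andP[_ ?] := b1 _ X1.
pose J : set R := `](- sup (Xs (lift ord0 ord0))), sup (Xs ord0)[%classic.
apply: (@le_trans _ _ (\int[leb]_x ind J x)%E).
  rewrite leb_itv; first by rewrite opprK EFinD.
  by lra.
apply: ge0_le_integralT => r; first exact: ind_ge0.
apply: le_ind; rewrite /J /= in_itv/= => /andP[r1 r2].
have [r0|r0] := leP 0 r.
  by rewrite -[r]mul1r; apply: (@Xs_Z ord0); apply: s0; rewrite r0.
rewrite -[r]opprK -mulN1r; apply: (@Xs_Z (lift ord0 ord0)); apply: s1.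
by apply/andP; split; lra.
Qed.

Lemma slice_ge1 k : (\int[leb]_r ind (Xs k) r <= \int[leb]_r ind Z r)%E.
Proof.
have [Z0|Z0] := pselect (Z !=set0); last first.
  under eq_integral do rewrite Xs_empty//.
  by rewrite integral0; apply: integral_ge0 => r _; exact: ind_ge0.
have [X0 -> b0 s0] := Xs_measure Z0 k.
have /andP[_ ?] := b0 _ X0.
have [k0|k0] := eqVneq k ord0.
  pose J : set R := `[0, sup (Xs k)[%classic.
  apply: (@le_trans _ _ (\int[leb]_x ind J x)%E).
    by rewrite leb_itv ?subr0.
  apply: ge0_le_integralT => r; first exact: ind_ge0.
  apply: le_ind; rewrite /J /= in_itv/= => r0.
  by rewrite -[r]mul1r -[1](_ : mask None k = 1) ?k0//; apply: Xs_Z; rewrite -k0; exact: s0.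
pose J : set R := `](- sup (Xs k)), 0]%classic.
apply: (@le_trans _ _ (\int[leb]_x ind J x)%E).
  by rewrite leb_itv ?sub0r ?opprK// oppr_le0.
apply: ge0_le_integralT => r; first exact: ind_ge0.
apply: le_ind; rewrite /J /= in_itv/= => /andP[r1 r2].
rewrite -[r]opprK -mulN1r -[-1](_ : mask None k = -1); last by rewrite /mask (negbTE k0).
by apply: Xs_Z; apply: s0; apply/andP; split; lra.
Qed.

End slices.
End colorings.

(** * Sums over colourings *)

Section iint_algebra.
Context {R : realType} {n : nat}.
Local Notation pt := 'rV[R]_n.
Implicit Types (x y : pt) (s : seq 'I_n).

Lemma iint_sum (I : Type) (r : seq I) (F : I -> pt -> \bar R) s x :
  (forall k y, 0 <= F k y)%E -> (forall k, mfun (F k)) ->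
  iint s (fun y => \sum_(k <- r) F k y)%E x = (\sum_(k <- r) iint s (F k) x)%E.
Proof.
move=> F0 mF; elim: s x => //= i s IH x.
under eq_integral do rewrite IH.
rewrite ge0_integral_sum// => k; last by move=> *; exact: iint_ge0.
by apply: mfun_upd; exact: mfun_iint.
Qed.

Lemma iint_scalel (f g : pt -> \bar R) s x : (forall x, 0 <= f x)%E ->
  (forall x, 0 <= g x)%E -> mfun g ->
  (forall y, (forall i, i \notin s -> y 0 i = x 0 i) -> f y = f x) ->
  iint s (fun y => f y * g y)%E x = (f x * iint s g x)%E.
Proof.
move=> f0 g0 mg; elim: s x => //= i s IH x fx.
have E r : iint s (fun y => f y * g y)%E (upd x i r) = (f x * iint s g (upd x i r))%E.
  rewrite IH; last first.
    move=> y hy; rewrite [in RHS]fx; last first.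
      by move=> j; rewrite inE negb_or updE => /andP[/negbTE ->].
    apply: fx => j; rewrite inE negb_or => /andP[ji js].
    by rewrite hy// updE (negbTE ji).
  congr (_ * _)%E; apply: fx => j.
  by rewrite inE negb_or updE => /andP[/negbTE ->].
under eq_integral do rewrite E.
rewrite ge0_integralZl//; first by apply: mfun_upd; exact: mfun_iint.
by move=> r _; exact: iint_ge0.
Qed.

Lemma iint_scale (f : pt -> \bar R) s (a : R) x : 0 < a -> (forall x, 0 <= f x)%E ->
  mfun f -> uniq s ->
  iint s f (a *: x) = ((a ^+ size s)%:E * iint s (fun y => f (a *: y)) x)%E.
Proof.
move=> a0 f0 mf; elim: s x => [|i s IH] x; first by rewrite /= expr0 mul1e.
move=> /= /andP[_ us].
have mfa : mfun (fun y : pt => f (a *: y)).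
  apply: (mfun_comp mf) => j; under eq_fun do rewrite mxE.
  by apply: measurable_funM => //; exact: measurable_coord.
rewrite (ge0_integral_scale a0); last 2 first.
- by apply: mfun_upd; exact: mfun_iint.
- by move=> r; exact: iint_ge0.
rewrite exprS EFinM -muleA; congr (_ * _)%E.
rewrite -ge0_integralZl//; last 3 first.
- by apply: mfun_upd; apply: mfun_iint.
- by move=> r _; exact: iint_ge0.
- by rewrite lee_fin exprn_ge0// ltW.
apply: eq_integral => r _.
rewrite -IH//; congr iint; apply/rowP => j.
by rewrite !mxE; case: eqP.
Qed.

End iint_algebra.

Section trees.
Context {R : realType} {n : nat}.
Local Notation pt := 'rV[R]_n.
Implicit Types (d : 'I_n -> 'I_3) (l : seq 'I_n).

Definition recolor d i k : 'I_n -> 'I_3 := fun j => if j == i then k else d j.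

(** The sum of [Phi] over all recolourings of the coordinates in [l], arranged as a tree so that one
    induction on [l] treats one coordinate at a time. *)
Fixpoint ctree (K : seq 'I_3) l (Phi : ('I_n -> 'I_3) -> R) d : R :=
  if l is i :: l' then \sum_(k <- K) ctree K l' Phi (recolor d i k) else Phi d.

Lemma ctree_ge0 K l Phi d : (forall d, 0 <= Phi d) -> 0 <= ctree K l Phi d.
Proof. by move=> P0; elim: l d => //= i l IH d; apply: sumr_ge0. Qed.

Definition col0 : 'I_3 := ord0.
Definition col1 : 'I_3 := lift ord0 ord0.
Definition col2 : 'I_3 := lift ord0 (lift ord0 ord0).

(** Colours 0, 1, 2 stand for A, B, C. [pi1] gives the block of C to A, while [pi2] gives the block
    of B to A and renames C as the second colour. *)
Definition pi1 (k : 'I_3) : 'I_3 := if k == col1 then col1 else col0.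
Definition pi2 (k : 'I_3) : 'I_3 := if k == col2 then col1 else col0.

(* The pair (pi1, pi2) embeds the three colours into {0, 1}^2. *)
Lemma ctree_mul (C : R) (Phi Psi1 Psi2 : ('I_n -> 'I_3) -> R) l d :
  0 <= C -> (forall d, 0 <= Psi1 d) -> (forall d, 0 <= Psi2 d) ->
  (forall d, Phi d <= C * (Psi1 (pi1 \o d) * Psi2 (pi2 \o d))) ->
  ctree [:: col0; col1; col2] l Phi d <=
    C * (ctree [:: col0; col1] l Psi1 (pi1 \o d) * ctree [:: col0; col1] l Psi2 (pi2 \o d)).
Proof.
move=> C0 P1 P2 H; elim: l d => [|i l IH] d /=; first exact: H.
have E pi k : pi \o recolor d i k = recolor (pi \o d) i (pi k).
  by apply/funext => j; rewrite /recolor /=; case: eqP.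
rewrite !big_cons !big_nil !addr0.
have := IH (recolor d i col0); have := IH (recolor d i col1); have := IH (recolor d i col2).
rewrite !E /pi1 /pi2 /=.
set a0 := ctree _ _ Psi1 (recolor _ _ col0); set a1 := ctree _ _ Psi1 (recolor _ _ col1).
set b0 := ctree _ _ Psi2 (recolor _ _ col0); set b1 := ctree _ _ Psi2 (recolor _ _ col1).
move=> h2 h1 h0.
(* Expanding the product gives four terms; the colours 0, 1, 2 use [a0 * b0], [a1 * b0], [a0 * b1],
   and the fourth is discarded as nonnegative. *)
have ? : 0 <= C * (a1 * b1) by rewrite !mulr_ge0// ctree_ge0.
rewrite mulrDl !mulrDr; lra.
Qed.

(** A partial colouring: coordinates in [l] are still free. It interpolates between the full sum and
    the section of colouring [d]. *)
Definition pc l d : 'I_n -> option 'I_3 := fun i => if i \in l then None else Some (d i).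

Section volumes.
Variables (D : ('I_3 -> pt) -> Prop) (M : R).
Hypotheses (dD : down_family D) (bD : forall X, D X -> forall k i, X k 0 i <= M).
Hypothesis mD : forall c, mset (sect D c).

Definition cvol c : \bar R := volume (sect D c).

Lemma cvol_fin c : (0 <= cvol c < +oo)%E.
Proof.
rewrite /cvol (volume_iint _ 0).
rewrite iint_ge0/=; last by move=> x; exact: ind_ge0.
pose M' := `|M| * 3.
pose B := [set x : pt | forall i, x 0 i \in `[- M', M']].
apply: (@le_lt_trans _ _ (iint (enum 'I_n) (ind B) 0)).
  apply: le_iint => x; first exact: ind_ge0.
  apply: le_ind => -[X DX wX] i; have [-> _] := wX i.
  rewrite in_itv/= -ler_norml (le_trans (ler_norm_sum _ _ _))//.
  rewrite (_ : M' = \sum_(k < 3) `|M|); last by rewrite sumr_const card_ord -mulr_natr.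
  apply: ler_sum => k _; rewrite normrM.
  have X0 : 0 <= X k 0 i := dD.1 _ DX k i.
  rewrite [`|X k 0 i|]ger0_norm// -[leRHS]mul1r ler_pM//.
    rewrite /mask; case: (c i) => [h|]; first by rewrite normr_nat; case: eqP.
    by case: eqP => _; rewrite ?normrN normr1.
  by rewrite (le_trans (bD DX k i))// ler_norm.
rewrite -(volume_iint B 0) volume_box ?ltry// => _.
by rewrite -subr_ge0 opprK addr_ge0// mulr_ge0.
Qed.

Let v c : R := fine (cvol c).

Let vE c : cvol c = (v c)%:E.
Proof.
rewrite /v fineK// ge0_fin_numE; first by have /andP[] := cvol_fin c.
by have /andP[] := cvol_fin c.
Qed.

(** With [i] innermost, inequalities between slices parallel to e_i integrate to inequalities
    between volumes. *)
Let split_last (c : 'I_n -> option 'I_3) (i : 'I_n) :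
  cvol c = iint (rem i (enum 'I_n))
    (fun x => \int[@lebesgue_measure R]_r ind (sect D c) (upd x i r))%E 0.
Proof.
rewrite /cvol (volume_iint _ 0) (@iint_perm _ _ _ (rcons (rem i (enum 'I_n)) i)).
- by rewrite -cats1 iint_cat.
- exact: ind_ge0.
- exact: mfun_ind.
- by rewrite perm_sym perm_rcons perm_sym perm_to_rem// mem_enum.
Qed.

Let mslice (c : 'I_n -> option 'I_3) (i : 'I_n) :
  mfun (fun x => \int[@lebesgue_measure R]_r ind (sect D c) (upd x i r))%E.
Proof. by apply: (@mfun_iint _ _ [:: i]); [exact: ind_ge0|exact: mfun_ind]. Qed.

Let pc_cons i l d k : i \notin l -> pc l (recolor d i k) = recolor_option (pc (i :: l) d) i
  (Some k).
Proof.
move=> il; apply/funext => j; rewrite /pc /recolor_option /recolor inE.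
by have [->|//] := eqVneq j i; rewrite (negbTE il).
Qed.

Lemma cvol_le_ctree l d : uniq l ->
  v (pc l d) <= ctree [:: col0; col1; col2] l (fun d => v (Some \o d)) d.
Proof.
elim: l d => [|i l IH] d; first by [].
move=> /= /andP[il ul].
have H : v (pc (i :: l) d) <= \sum_(k <- [:: col0; col1; col2]) v (pc l (recolor d i k)).
  rewrite -lee_fin -vE -sumEFin (split_last _ i).
  under eq_bigr do rewrite -vE (split_last _ i).
  rewrite -iint_sum//; last by move=> k x; apply: integral_ge0 => *; exact: ind_ge0.
  apply: le_iint => x; first by apply: integral_ge0 => *; exact: ind_ge0.
  have := @slice_le _ _ D M dD bD (pc (i :: l) d) i x.
  rewrite {1}/pc mem_head => /(_ erefl) /le_trans; apply.
  rewrite !big_ord_recl big_ord0 !big_cons big_nil.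
  by rewrite !pc_cons.
apply: (le_trans H); apply: ler_sum => k _; exact: IH.
Qed.

Lemma ctree_le_cvol l d : uniq l ->
  ctree [:: col0; col1] l (fun d => v (Some \o d)) d <= v (pc l d).
Proof.
elim: l d => [|i l IH] d; first by [].
move=> /= /andP[il ul].
have H : \sum_(k <- [:: col0; col1]) v (pc l (recolor d i k)) <= v (pc (i :: l) d).
  rewrite -lee_fin -vE -sumEFin (split_last _ i).
  under eq_bigr do rewrite -vE (split_last _ i).
  rewrite -iint_sum//; last by move=> k x; apply: integral_ge0 => *; exact: ind_ge0.
  apply: le_iint => x.
    by apply: sume_ge0 => k _; apply: integral_ge0 => *; exact: ind_ge0.
  have := @slice_ge2 _ _ D M dD bD (pc (i :: l) d) i x.
  rewrite {1}/pc mem_head => /(_ erefl) /(le_trans _); apply.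
  rewrite !big_cons big_nil adde0.
  by rewrite !pc_cons.
apply: le_trans H; apply: ler_sum => k _; exact: IH.
Qed.

(** Keeping one colour at each coordinate gives a lower bound for all three bodies at once;
    sharpness relies on it. *)
Lemma cvol_Some_le l d : uniq l -> v (Some \o d) <= v (pc l d).
Proof.
elim: l => [|i l IH]; first by [].
move=> /= /andP[il ul]; apply: (le_trans (IH ul)).
rewrite -lee_fin -!vE !(split_last _ i).
apply: le_iint => x; first by apply: integral_ge0 => *; exact: ind_ge0.
have := @slice_ge1 _ _ D M dD bD (pc (i :: l) d) i x.
rewrite {1}/pc mem_head => /(_ erefl (d i)) /(le_trans _); apply.
rewrite -pc_cons// (_ : recolor d i (d i) = d)//.
by apply/funext => j; rewrite /recolor; case: eqP => // ->.
Qed.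

End volumes.
End trees.

(** * Euler's integral *)

Lemma measurable_ind {R : realType} d (T : measurableType d) (A : set T) :
  measurable A -> measurable_fun setT (ind A : T -> \bar R).
Proof. by move=> mA; apply/measurable_EFinP; exact: measurable_indic. Qed.

Section exponential_weight.
Context {R : realType}.
Local Notation leb := (@lebesgue_measure R).

Definition expm (t : R) : R := if 0 < t then expR (- t) else 0.

Lemma expm_ge0 t : 0 <= expm t.
Proof. by rewrite /expm; case: ifP => // _; exact: expR_ge0. Qed.

Lemma measurable_expm : measurable_fun [set: R] expm.
Proof.
apply: measurable_fun_if => //.
  apply: (measurable_fun_bool true); rewrite setTI.
  rewrite (_ : _ @^-1` _ = `]0, +oo[%classic) ?measurable_itv//.
  by apply/seteqP; split => t /=; rewrite in_itv/= andbT.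
apply: measurable_funTS; apply: measurableT_comp => //.
Qed.

Lemma integral_expN_tail (N : R) :
  (\int[leb]_(t in `[N, +oo[) (expR (- t))%:E = (expR (- N))%:E)%E.
Proof.
rewrite (@ge0_continuous_FTC2y _ (fun t => expR (- t)) (fun t => - expR (- t)) N 0).
- by rewrite EFinN oppeK add0e.
- by move=> x _; exact: expR_ge0.
- apply: continuous_subspaceT => x.
  apply: (@continuous_comp _ _ _ -%R expR); first exact: opp_continuous.
  exact: continuous_expR.
- by rewrite -oppr0; apply: cvgN; exact: cvgr_expR.
- by move=> x _; exact: ex_derive.
- apply: cvgN; apply: cvg_at_right_filter.
  apply: (@continuous_comp _ _ _ -%R expR); first exact: opp_continuous.
  exact: continuous_expR.
- move=> x _; rewrite derive1E.
  have -> := @derive_val _ _ _ _ _ _ _ (is_deriveN (is_derive1_comp (is_derive_expR _)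
    (is_deriveNid _ _))).
  by rewrite /GRing.scale/= mulrN1 opprK.
Qed.

(** On the positive reals [T] is the half-line from [N], with or without its endpoint; elsewhere
    [expm] vanishes. Hence it does not matter whether a gauge is attained. *)
Lemma expm_tail (T : set R) (N : R) : 0 <= N -> (forall t, N < t -> T t) ->
  (forall t, 0 < t -> T t -> N <= t) ->
  (\int[leb]_t ((expm t)%:E * ind T t) = (expR (- N))%:E)%E.
Proof.
move=> N0 TN NT.
have E0 t : (0 <= (expm t)%:E * ind T t)%E by rewrite mule_ge0 ?lee_fin ?expm_ge0 ?ind_ge0.
have mexp A : measurable_fun A (fun t : R => (expR (- t))%:E).
  apply/measurable_EFinP; apply: measurable_funTS; exact: measurableT_comp.
apply/eqP; rewrite eq_le; apply/andP; split.
  rewrite -integral_expN_tail [leRHS]integral_mkcond.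
  apply: ge0_le_integralT => // t; rewrite /patch.
  have [Tt|Tt] := pselect (T t); last by rewrite ind0// mule0; case: ifP => // _;
    rewrite lee_fin expR_ge0.
  rewrite ind1// mule1 /expm; case: ltP => t0; last by case: ifP => // _; rewrite lee_fin expR_ge0.
  by rewrite mem_set//= in_itv/= andbT; exact: NT.
rewrite -integral_expN_tail -integral_itv_obnd_cbnd// [leLHS]integral_mkcond.
apply: ge0_le_integralT => t; rewrite /patch; case: ifPn => //.
rewrite inE/= in_itv/= andbT => Nt.
by rewrite ind1 ?mule1 /expm ?(le_lt_trans N0 Nt)//; exact: TN.
Qed.

(** This is Gamma (1 + a) in the extended reals. *)
Definition Gam (a : R) : \bar R := (\int[leb]_t ((expm t)%:E * (t `^ a)%:E))%E.

Lemma GammaE a : Gamma (1 + a) = fine (Gam a).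
Proof.
rewrite /Gamma /Gam /Rintegral; congr fine; rewrite [LHS]integral_mkcond.
apply: eq_integral => t _; rewrite /patch /expm; case: (ltP 0 t) => t0; last first.
  by rewrite memNset ?mul0e//= in_itv/= andbT; apply/negP; rewrite -leNgt.
by rewrite mem_set/= ?in_itv/= ?t0// mulrC EFinM; congr (_ * (_ `^ _)%:E)%E; lra.
Qed.

Lemma Gam_fin a : 0 <= a -> (0 < Gam a < +oo)%E.
Proof.
move=> a0; have E0 t : (0 <= (expm t)%:E * (t `^ a)%:E)%E.
  by rewrite -EFinM lee_fin mulr_ge0 ?expm_ge0 ?powR_ge0.
apply/andP; split.
  pose J : set R := `[1, 2]%classic.
  pose f t : \bar R := ((expR (- 2))%:E * ind J t)%E.
  apply: (@lt_le_trans _ _ (\int[leb]_t f t)%E).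
    rewrite ge0_integralZl//; last first.
    - by move=> x _; exact: ind_ge0.
    - by apply: (@measurable_ind _ _ (measurableTypeR R)); exact: measurable_itv.
    rewrite integral_ind /J// lebesgue_measure_itv/= lte_fin ltr1n -EFinD -EFinM lte_fin.
    by rewrite mulr_gt0 ?expR_gt0//; lra.
  apply: ge0_le_integralT => t.
    by rewrite /f mule_ge0 ?ind_ge0// lee_fin expR_ge0.
  rewrite /f; have [t12|t12] := pselect (J t); last by rewrite ind0// mule0.
  rewrite ind1//; move: t12; rewrite /J/= in_itv/= => /andP[t1 t2].
  rewrite -!EFinM lee_fin mulr1 /expm (lt_le_trans ltr01)// -[leLHS]mulr1.
  rewrite ler_pM ?expR_ge0// ?ler_expR ?lerN2//.
  by rewrite -[leLHS](powRr0 t) ler_powR.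
pose m := Num.truncn a.
(* This bounds t^a by [C] times exp (t/2): t^a is at most 1 + t^(m+1), and the exponential series
   gives (t/2)^(m+1) <= (m+1)! exp (t/2). The other half of exp (- t) remains integrable. *)
pose C : R := 1 + 2 ^+ m.+1 * (m.+1)`!%:R.
have C0 : 0 <= C by rewrite addr_ge0// mulr_ge0// exprn_ge0.
pose f t : \bar R := (C%:E * (expm (2^-1 * t))%:E)%E.
have mf : measurable_fun setT (fun t : R => (expm (2^-1 * t))%:E).
  apply/measurable_EFinP; apply: measurableT_comp; first exact: measurable_expm.
  exact: mulrl_measurable.
have et1 : (\int[leb]_t (expm t)%:E = 1)%E.
  have /(_ (lexx 0) (fun _ _ => I) (fun t h _ => ltW h)) := @expm_tail setT 0.
  by rewrite oppr0 expR0 => <-; apply: eq_integral => t _; rewrite ind1// mule1.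
apply: (@le_lt_trans _ _ (\int[leb]_t f t)%E).
  apply: ge0_le_integralT => // t; rewrite /f -!EFinM lee_fin /expm pmulr_rgt0 ?invr_gt0//.
  case: ifP => t0; last by rewrite mul0r mulr0.
  have -> : expR (- t) = expR (- (2^-1 * t)) * expR (- (2^-1 * t)).
    by rewrite -expRD; congr expR; lra.
  rewrite -mulrA mulrC ler_wpM2r ?expR_ge0// expRN mulrC ler_pdivrMr ?expR_gt0//.
  have t2 : 0 <= 2^-1 * t by rewrite mulr_ge0// ltW.
  have e1 : 1 <= expR (2^-1 * t) by rewrite -[leLHS]expR0 ler_expR.
  have em : (2^-1 * t) ^+ m.+1 <= (m.+1)`!%:R * expR (2^-1 * t).
    rewrite [leRHS]mulrC -ler_pdivrMr ?ltr0n ?fact_gt0//; apply: le_trans (expR_ge1Dxn m t2).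
    by rewrite lerDr.
  have ta : t `^ a <= 1 + t ^+ m.+1.
    have [t1|t1] := leP t 1.
      apply: (@le_trans _ _ 1); last by rewrite lerDl exprn_ge0// ltW.
      have := @ge0_ler_powR R a a0 t 1; rewrite !nnegrE ltW// => /(_ isT ler01 t1).
      by rewrite powR1.
    apply: (@le_trans _ _ (t `^ m.+1%:R)).
      by rewrite ler_powR ?(ltW t1)// ltW// truncnS_gt.
    by rewrite powR_mulrn ?lerDr//; exact: ltW.
  apply: (le_trans ta); rewrite /C mulrDl mul1r lerD//.
  rewrite -mulrA -ler_pdivrMl ?exprn_gt0//; apply: le_trans em.
  by rewrite exprMn exprVn.
rewrite ge0_integralZl//; last by move=> t _; rewrite lee_fin expm_ge0.
rewrite (@ge0_integral_scale _ 2)//; last by move=> t; rewrite lee_fin expm_ge0.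
have -> : (\int[leb]_t (expm (2^-1 * (2 * t)))%:E = 1)%E.
  by rewrite -et1; apply: eq_integral => t _; rewrite mulrA mulVf ?mul1r.
by rewrite mule1 -EFinM ltry.
Qed.

Lemma Gamma_gt0 a : 0 <= a -> 0 < Gamma (1 + a) :> R.
Proof. by move=> a0; rewrite GammaE fine_gt0// Gam_fin. Qed.

Lemma Gam_Gamma a : 0 <= a -> Gam a = (Gamma (1 + a))%:E.
Proof.
move=> a0; have /andP[G0 Goo] := Gam_fin a0.
by rewrite GammaE fineK// ge0_fin_numE// ltW.
Qed.

End exponential_weight.

(** * Sums of bodies in orthogonal coordinate subspaces *)

Section dilates.
Context {R : realType} {n : nat}.
Local Notation pt := 'rV[R]_n.
Local Notation leb := (@lebesgue_measure R).
Implicit Types (A B : set pt) (x y u w : pt) (s : seq 'I_n).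

Lemma iint0 s x : iint s (cst 0%E : pt -> \bar R) x = 0%E.
Proof.
elim: s x => //= i s IH x.
rewrite (eq_integral (cst 0%E)) ?integral0// => r _; exact: IH.
Qed.

(** An anti-blocking body stripped of convexity, which enters only through the Brunn-Minkowski
    inequality. *)
Definition down_body A := [/\ A 0, compact A, (forall x, A x -> forall i, 0 <= x 0 i)
  & (forall x y, A x -> (forall i, 0 <= y 0 i <= x 0 i) -> A y)].

(* This is exp (- gauge), written as an integral over t so that integrating it in u first yields
   the volume of B times a Gamma factor. *)
Definition eint (r : R) B u : \bar R :=
  (\int[leb]_t ((expm t)%:E * ind B (t `^ (- r) *: u)))%E.

Lemma eint_ge0 r B u : (0 <= eint r B u)%E.
Proof. by apply: integral_ge0 => t _; rewrite mule_ge0 ?ind_ge0// lee_fin expm_ge0. Qed.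

Let jmeas_eint r B : mset B ->
  jmeas (fun (t : measurableTypeR R) u => (expm t)%:E * ind B (t `^ (- r) *: u))%E.
Proof.
move=> mB; apply: emeasurable_funM.
  by apply/measurable_EFinP; apply: (measurableT_comp measurable_expm).
apply: (mfun_comp (mfun_ind mB)) => i; under eq_fun do rewrite mxE.
apply: measurable_funM.
  exact: (measurableT_comp (@measurable_powR R (- r))).
exact: (measurableT_comp (measurable_coord i)).
Qed.

Lemma mfun_eint r B : mset B -> mfun (eint r B).
Proof.
move=> mB; have mf := jmeas_eint r mB.
have := @measurable_fun_fubini_tonelli_G _ _ _ _ R leb _ mf; apply => -[t u] /=.
by rewrite mule_ge0 ?ind_ge0// lee_fin expm_ge0.
Qed.

(** After exchanging the integrals, the dilate t^r B contributes t^(r |s|) times the volume of B,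
    and the remaining integral in t is Euler's. *)
Lemma iint_eint r B s : 0 <= r -> mset B -> uniq s ->
  iint s (eint r B) 0 = (iint s (ind B) 0 * Gam ((size s)%:R * r))%E.
Proof.
move=> r0 mB us.
rewrite -(@iint_integral _ _ _ _ leb s
  (fun t u => (expm t)%:E * ind B (t `^ (- r) *: u))%E); last 2 first.
- by move=> t u; rewrite mule_ge0 ?ind_ge0// lee_fin expm_ge0.
- exact: jmeas_eint.
have I0 : (0 <= iint s (ind B) 0)%E by apply: iint_ge0 => x; exact: ind_ge0.
rewrite /Gam -ge0_integralZl//; last 2 first.
- apply: emeasurable_funM; apply/measurable_EFinP; first exact: measurable_expm.
  exact: measurable_powR.
- by move=> t _; rewrite mule_ge0// lee_fin ?expm_ge0// powR_ge0.
apply: eq_integral => t _.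
have [t0|t0] := leP t 0.
  rewrite /expm ltNge t0 /= mul0e mule0.
  rewrite (@eq_iint _ _ _ _ (cst 0%E)); last by move=> u; rewrite mul0e.
  exact: iint0.
rewrite (iint_scalel (f := fun _ => (expm t)%:E))//; last 3 first.
- by move=> _; rewrite lee_fin expm_ge0.
- by move=> *; exact: ind_ge0.
- apply: (mfun_comp (mfun_ind mB)) => i; under eq_fun do rewrite mxE.
  by apply: measurable_funM => //; exact: measurable_coord.
rewrite muleCA; congr (_ * _)%E.
have tr0 : 0 < t `^ r by rewrite powR_gt0.
have := @iint_scale _ _ (fun u => ind B (t `^ (- r) *: u)) s (t `^ r) 0 tr0.
rewrite scaler0 => ->//; last 2 first.
- by move=> *; exact: ind_ge0.
- apply: (mfun_comp (mfun_ind mB)) => i; under eq_fun do rewrite mxE.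
  by apply: measurable_funM => //; exact: measurable_coord.
rewrite muleC; congr (_ * _)%E.
  by apply: eq_iint => u; rewrite scalerA powRN mulVf ?gt_eqF// scale1r.
by congr (_%:E); rewrite mulrC powRrM powR_mulrn// ltW.
Qed.

Section gauge.
Variables (r : R) (r0 : 0 <= r) (A : set pt) (gA : down_body A).

Lemma dilE t u : 0 < t -> (A (t `^ (- r) *: u) <-> exists2 a, A a & u = t `^ r *: a).
Proof.
move=> t0; have tr0 : 0 < t `^ r by rewrite powR_gt0.
split => [Au|[a Aa ->]].
  by exists (t `^ (- r) *: u) => //; rewrite scalerA powRN mulfV ?gt_eqF// scale1r.
by rewrite scalerA powRN mulVf ?gt_eqF// scale1r.
Qed.

(** The dilates t^r A increase with t because [A] is closed under shrinking. The strict inequality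
    keeps [t] positive when [q = 0]. *)
Lemma dil_up t q a : 0 <= q -> q < t -> A a -> A (t `^ (- r) *: (q `^ r *: a)).
Proof.
move=> q0 qt Aa; have t0 : 0 < t by exact: le_lt_trans qt.
have [_ _ A0 Ad] := gA; apply: (Ad a) => // i.
have c0 : 0 <= t `^ (- r) * q `^ r by rewrite mulr_ge0 ?powR_ge0.
have c1 : t `^ (- r) * q `^ r <= 1.
  rewrite powRN mulrC ler_pdivrMr ?powR_gt0// mul1r.
  by rewrite ge0_ler_powR ?nnegrE// ltW.
have a0 := A0 _ Aa i; rewrite !mxE mulrA mulr_ge0//=.
by rewrite -[leRHS]mul1r ler_wpM2r.
Qed.

(** For r > 0 this is the power 1/r = q of the Minkowski gauge: the normalisation that is additive
    over orthogonal blocks of a p-sum. *)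
Definition gauge u := inf [set t | 0 < t /\ A (t `^ (- r) *: u)].

Lemma eint_empty u : (forall t, 0 < t -> ~ A (t `^ (- r) *: u)) -> eint r A u = 0%E.
Proof.
move=> h; apply: integral0_eq => t _; rewrite /expm; case: ifP => [t0|]; last by rewrite mul0e.
by rewrite ind0 ?mule0//; exact: h.
Qed.

Lemma gaugeP u t : 0 < t -> A (t `^ (- r) *: u) ->
  [/\ 0 <= gauge u, (forall q, gauge u < q -> A (q `^ (- r) *: u)),
      (forall q, 0 < q -> A (q `^ (- r) *: u) -> gauge u <= q) &
      eint r A u = (expR (- gauge u))%:E].
Proof.
move=> t0 At.
pose T := [set t | 0 < t /\ A (t `^ (- r) *: u)].
have hT : has_inf T by split; [exists t|exists 0 => ? [/ltW]].
have N0 : 0 <= gauge u by apply: lb_le_inf; [exists t|move=> ? [/ltW]].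
have up q : gauge u < q -> A (q `^ (- r) *: u).
  move=> Nq; have [] := @inf_adherent R T (q - gauge u) _ hT; first by rewrite subr_gt0.
  move=> q' [q'0 Aq']; rewrite addrC subrK => qq.
  have := dil_up (ltW q'0) qq Aq'; rewrite [X in _ *: X](_ : _ = u)//.
  by rewrite scalerA powRN mulfV ?scale1r// gt_eqF// powR_gt0.
have lo q : 0 < q -> A (q `^ (- r) *: u) -> gauge u <= q.
  by move=> q0 Aq; apply: (ge_inf hT.2).
split => //.
by rewrite /eint -(@expm_tail _ (fun t => A (t `^ (- r) *: u)) (gauge u)).
Qed.

Lemma gauge_dil q a : 0 <= q -> A a ->
  [/\ 0 < q + 1, A ((q + 1) `^ (- r) *: (q `^ r *: a)) & gauge (q `^ r *: a) <= q].
Proof.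
move=> q0 Aa.
have q1 : 0 < q + 1 by rewrite ltr_wpDl.
have A1 : A ((q + 1) `^ (- r) *: (q `^ r *: a)) by apply: dil_up => //; rewrite ltrDl.
have [_ _ lo _] := gaugeP q1 A1.
split => //; apply/ler_addgt0Pr => e e0; apply: lo; first by rewrite ltr_wpDl.
by apply: dil_up => //; rewrite ltrDl.
Qed.

End gauge.

Section product.
Variables (r : R) (r0 : 0 <= r) (A : 'I_3 -> set pt) (gA : forall k, down_body (A k)).
Variable d : 'I_n -> 'I_3.

Definition cproj (k : 'I_3) (w : pt) : pt := \row_i (if d i == k then w 0 i else 0).

Let Dd := sect (psum r A) (Some \o d).

Let DdP w : Dd w <-> exists tau : 'I_3 -> R, [/\ forall k, 0 <= tau k, \sum_k tau k = 1 &
  forall k, exists2 a, A k a & cproj k w = tau k `^ r *: a].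
Proof.
split=> [[X [tau [t0 t1 tX]] wX]|[tau [t0 t1 tX]]].
  exists tau; split => // k; have [a Aa XE] := tX k; exists a => //.
  rewrite -XE; apply/rowP => i; rewrite mxE; have [wE X0] := wX i.
  case: eqP => [<-|dk]; first by rewrite wE sum_mask_Some.
  by rewrite (X0 k (d i))//; apply/eqP => h; apply: dk.
exists (cproj^~ w); first by exists tau.
move=> i /=; rewrite sum_mask_Some mxE eqxx; split => // k h [<-].
by rewrite mxE eq_sym => /negbTE ->.
Qed.

Let compact_Dd : compact Dd.
Proof. by apply: compact_sect => // k; have [] := gA k. Qed.

Let cprojZ k (a : R) w : cproj k (a *: w) = a *: cproj k w.
Proof. by apply/rowP => i; rewrite !mxE; case: ifP => //; rewrite mulr0. Qed.

(** Dilating by t^r amounts to weights of total t instead of 1. *)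
Let dilD t w : 0 < t -> (Dd (t `^ (- r) *: w) <->
  exists tau : 'I_3 -> R, [/\ forall k, 0 <= tau k, \sum_k tau k = t &
  forall k, exists2 a, A k a & cproj k w = tau k `^ r *: a]).
Proof.
move=> t0; have tr0 : t `^ r != 0 by rewrite gt_eqF// powR_gt0.
split=> [/DdP[tau [p0 p1 pA]]|[tau [p0 p1 pA]]].
  exists (fun k => t * tau k); split.
  - by move=> k; rewrite mulr_ge0// ltW.
  - by rewrite -mulr_sumr p1 mulr1.
  - move=> k; have [a Aa aE] := pA k; exists a => //.
    rewrite powRM// ?(ltW t0)// -scalerA -aE cprojZ scalerA powRN mulfV// scale1r.
    by [].
apply/DdP; exists (fun k => t^-1 * tau k); split.
- by move=> k; rewrite mulr_ge0// invr_ge0 ltW.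
- by rewrite -mulr_sumr p1 mulVf// gt_eqF.
- move=> k; have [a Aa aE] := pA k; exists a => //.
  rewrite cprojZ aE scalerA powRM// ?invr_ge0 ?(ltW t0)//; congr (_ * _ *: _).
  by rewrite -powR_inv1 ?(ltW t0)// -powRrM mulN1r.
Qed.

(** A point lies in the dilate t^r of the sum exactly when its blocks lie in dilates of the A_k
    whose weights add up to t. The least total is the sum of the least weights, so the exponentials
    multiply; a block lying in no dilate makes both sides 0. *)
Lemma eint_sect w : eint r Dd w = (\prod_k eint r (A k) (cproj k w))%E.
Proof.
have [h|h] := pselect (forall k, exists2 t, 0 < t & A k (t `^ (- r) *: cproj k w)); last first.
  have [k hk] : exists k, ~ exists2 t, 0 < t & A k (t `^ (- r) *: cproj k w).
    exact/existsNP.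
  have E0 : eint r (A k) (cproj k w) = 0%E.
    by apply: eint_empty => t t0 At; apply: hk; exists t.
  rewrite (bigD1 k)//= E0 mul0e.
  apply: integral0_eq => t _; rewrite /expm; case: ifP => [t0|]; last by rewrite mul0e.
  rewrite ind0 ?mule0// => /(dilD _ t0)[tau [p0 p1 pA]]; apply: hk.
  have [a Aa aE] := pA k; have [q1 A1 _] := gauge_dil r0 (gA k) (p0 k) Aa.
  by exists (tau k + 1) => //; rewrite aE.
pose N k := gauge r (A k) (cproj k w).
have HN k : [/\ 0 <= N k, (forall q, N k < q -> A k (q `^ (- r) *: cproj k w)) &
    eint r (A k) (cproj k w) = (expR (- N k))%:E].
  by have [t t0 At] := h k; have [] := gaugeP r0 (gA k) t0 At.
rewrite (eq_bigr (fun k => (expR (- N k))%:E)); last by move=> k _; have [] := HN k.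
rewrite prodEFin -expR_sum sumrN.
apply: expm_tail.
- by apply: sumr_ge0 => k _; have [] := HN k.
- move=> t Nt; have t0 : 0 < t by apply: le_lt_trans Nt; apply: sumr_ge0 => k _; have [] := HN k.
  apply/(dilD _ t0).
  (* The surplus is shared among the three blocks, since no gauge need be attained. *)
  pose e := (t - \sum_k N k) / 3; have e0 : 0 < e by rewrite divr_gt0// subr_gt0.
  exists (fun k => N k + e); split.
  + by move=> k; rewrite addr_ge0 ?(ltW e0)//; have [] := HN k.
  + rewrite big_split /= sumr_const card_ord.
    have -> : e *+ 3 = t - \sum_k N k by rewrite /e -[LHS]mulr_natr divfK.
    by rewrite addrC subrK.
  + move=> k; have [N0 NA _] := HN k.
    have Ne : 0 < N k + e by rewrite ltr_wpDl.
    by apply/(dilE _ _ _ Ne); apply: NA; rewrite ltrDl.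
- move=> t t0 /(dilD _ t0)[tau [p0 <- pA]]; apply: ler_sum => k _.
  have [a Aa aE] := pA k; have [_ _] := gauge_dil r0 (gA k) (p0 k) Aa.
  by rewrite -aE.
Qed.

Definition cidx (k : 'I_3) := [seq i <- enum 'I_n | d i == k].

Lemma iint_factor (f : 'I_3 -> pt -> \bar R) (K : seq 'I_3) x :
  (forall k x, 0 <= f k x)%E -> (forall k, mfun (f k)) -> uniq K ->
  iint (flatten [seq cidx k | k <- K]) (fun w => \prod_(k <- K) f k (cproj k w))%E x =
  (\prod_(k <- K) iint (cidx k) (f k) 0)%E.
Proof.
move=> f0 mf; elim: K x => [|k K IH] x; first by rewrite /= !big_nil.
move=> /= /andP[kK uK]; rewrite iint_cat big_cons.
have mfc h : mfun (fun w => f h (cproj h w)).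
  apply: (mfun_comp (mf h)) => i; under eq_fun do rewrite mxE.
  by case: eqP => _; [exact: measurable_coord|exact: measurable_cst].
have mp (L : seq 'I_3) : mfun (fun w => \prod_(h <- L) f h (cproj h w))%E.
  rewrite /mfun; elim: L => [|h L IHL].
    by rewrite (_ : _ \o _ = cst 1%E)//; apply/funext => t /=; rewrite big_nil.
  rewrite (_ : _ \o _ = fun t => f h (cproj h (rowt t)) * \prod_(h <- L) f h (cproj h (rowt t)))%E.
    by apply: emeasurable_funM => //; exact: mfc.
  by apply/funext => t /=; rewrite big_cons.
have p0 (L : seq 'I_3) w : (0 <= \prod_(h <- L) f h (cproj h w))%E.
  by apply: prode_ge0 => h _; exact: f0.
pose c := (\prod_(h <- K) iint (cidx h) (f h) 0)%E.
have c0 : (0 <= c)%E.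
  by apply: prode_ge0 => h _; exact: iint_ge0.
rewrite (@eq_iint _ _ _ _ (fun w => c * f k (cproj k w))%E); last first.
  move=> w; under eq_iint do rewrite big_cons.
  rewrite (iint_scalel (f := fun w => f k (cproj k w)) (g := fun w =>
    \prod_(h <- K) f h (cproj h w))%E)//.
    by rewrite IH// muleC.
  move=> y yw; congr (f k); apply/rowP => i; rewrite !mxE; case: eqP => // ik.
  apply: yw; apply/flattenP => -[s /mapP[h hK ->]]; rewrite mem_filter ik => /andP[/eqP kh _].
  by rewrite kh hK in kK.
rewrite (iint_scalel (f := fun _ => c))// muleC; congr (_ * _)%E.
apply: eq_iint_off => x' y' hx hy hxy; congr (f k); apply/rowP => i; rewrite mxE.
case: eqP => dk; first by apply: hxy; rewrite mem_filter dk eqxx mem_enum.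
by rewrite hy ?mxE// mem_filter; case: eqP.
Qed.

(* Both sides are the integral of exp (- gauge of Dd), the gauge of Dd being the sum of those of
   the blocks. *)
Lemma volume_sect : (volume Dd * Gam (n%:R * r) =
  \prod_(k <- [:: col0; col1; col2])
    (iint (cidx k) (ind (A k)) 0 * Gam ((size (cidx k))%:R * r)))%E.
Proof.
have mA k : mset (A k) by apply: compact_mset; have [] := gA k.
have mDd : mset Dd by exact: compact_mset.
rewrite (volume_iint _ 0) -[X in X%:R * r](size_enum_ord n) -iint_eint// ?enum_uniq//.
under eq_iint do rewrite eint_sect.
pose K := [:: col0; col1; col2].
rewrite (@iint_perm _ _ _ (flatten [seq cidx k | k <- K])); last 3 first.
- by move=> x; apply: prode_ge0 => k _; exact: eint_ge0.
- rewrite (_ : (fun _ => _) = eint r Dd); first exact: mfun_eint.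
  by apply/funext => w; rewrite eint_sect.
- apply: uniq_perm; first exact: enum_uniq.
    have uc k : uniq (cidx k) by rewrite filter_uniq ?enum_uniq.
    have nh k h : k != h -> ~~ has (in_mem^~ (mem (cidx k))) (cidx h).
      move=> kh; apply/hasPn => i; rewrite !mem_filter => /andP[/eqP -> _].
      by rewrite eq_sym (negbTE kh).
    by rewrite /= cats0 !cat_uniq has_cat negb_or !uc !nh.
  move=> i; rewrite mem_enum inE; apply/esym/flattenP; exists (cidx (d i)).
    by apply: map_f; case: (d i) => -[|[|[|//]]] h; rewrite !inE.
  by rewrite mem_filter eqxx mem_enum.
transitivity (iint (flatten [seq cidx k | k <- K])
  (fun w => \prod_(k <- K) eint r (A k) (cproj k w))%E 0).
  apply: eq_iint => w; rewrite !big_ord_recl big_ord0 !big_cons big_nil.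
  by [].
rewrite (@iint_factor (fun k => eint r (A k)) K)//; last 2 first.
- by move=> *; exact: eint_ge0.
- by move=> k; exact: mfun_eint.
by apply: eq_bigr => k _; rewrite iint_eint// filter_uniq ?enum_uniq.
Qed.

End product.
End dilates.

(** * Prékopa–Leindler and Brunn–Minkowski inequalities *)

Section prekopa_leindler1.
Context {R : realType}.
Local Notation leb := (@lebesgue_measure R).

Lemma powRV (a x : R) : 0 <= a -> a^-1 `^ x = (a `^ x)^-1.
Proof. by move=> a0; rewrite -powR_inv1// -powRrM mulN1r powRN. Qed.

Definition lev (f : R -> R) (t : R) : set R := [set r | 0 < t <= f r].

Lemma measurable_gt0_le (d : measure_display) (T : measurableType d) (f g : T -> R) :
  measurable_fun setT f -> measurable_fun setT g ->
  measurable [set x | 0 < f x <= g x].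
Proof.
move=> mf mg.
have m1 : measurable_fun setT (fun x => 0 < f x) by exact: measurable_fun_ltr.
have m2 : measurable_fun setT (fun x => f x <= g x) by exact: measurable_fun_ler.
have := measurable_and m1 m2 measurableT (Y := [set true]) I.
by rewrite setTI; congr measurable; apply/seteqP; split.
Qed.

Lemma layer_cake (f : R -> R) : measurable_fun setT f -> (forall r, 0 <= f r) ->
  (\int[leb]_r (f r)%:E = \int[leb]_t \int[leb]_r ind (lev f t) r)%E.
Proof.
move=> mf f0.
rewrite [RHS](@fubini_tonelli _ _ _ _ R leb leb (fun p => ind (lev f p.1) p.2))/=; last 2 first.
- have := @measurable_gt0_le _ (measurableTypeR R * measurableTypeR R)%type
    (fun p => p.1) (fun p => f p.2) measurable_fst (measurableT_comp mf measurable_snd).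
  move/(measurable_ind (R := R)); apply: eq_measurable_fun => p _.
  exact: eq_ind.
- by move=> p; exact: ind_ge0.
apply: eq_integral => r _.
transitivity (leb `]0, f r]%classic).
  rewrite lebesgue_measure_itv/= lte_fin; case: ltP => h; first by rewrite -EFinD subr0.
  by have /eqP -> : f r == 0 by rewrite eq_le h f0.
rewrite -integral_ind//; apply: eq_integral => t _; exact: eq_ind.
Qed.

Lemma weighted_AMGM (l a b : R) : 0 < l < 1 -> 0 <= a -> 0 <= b ->
  a `^ (1 - l) * b `^ l <= (1 - l) * a + l * b.
Proof.
move=> /andP[l0 l1] a0 b0.
have l1' : 0 < 1 - l by rewrite subr_gt0.
have := @conjugate_powR R (a `^ (1 - l)) (b `^ l) (1 - l)^-1 l^-1.
rewrite !invrK subrK => /(_ (powR_ge0 _ _) (powR_ge0 _ _)).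
rewrite !invr_gt0 l0 l1' => /(_ isT isT erefl) /le_trans; apply.
by rewrite -!powRrM !mulfV ?gt_eqF// !powRr1// mulrC lerD// mulrC.
Qed.

(** Nonincreasing on [0, M] and zero outside. Nonempty superlevel sets at positive levels are
    intervals starting at 0, for which the one-dimensional Brunn-Minkowski inequality is
    immediate. *)
Definition decr1 (M : R) (f : R -> R) :=
  [/\ measurable_fun setT f, (forall r, 0 <= f r), (forall r, r < 0 -> f r = 0),
      (forall r, M < r -> f r = 0) & (forall a b, 0 <= a -> a <= b -> f b <= f a)].

Lemma lev_measure (M : R) (f : R -> R) t : decr1 M f -> 0 < t <= f 0 ->
  exists s : R, [/\ 0 <= s, (\int[leb]_r ind (lev f t) r = s%:E)%E &
    forall a, 0 <= a < s -> t <= f a].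
Proof.
move=> [mf f0 fN fM fd] /andP[t0 t1].
have M0 : 0 <= M by rewrite leNgt; apply/negP => /fM h; move: t1; rewrite h leNgt t0.
have bX r : lev f t r -> 0 <= r <= M.
  move=> /andP[_ h]; apply/andP; split; rewrite leNgt; apply/negP.
    by move=> /fN h'; move: h; rewrite h' leNgt t0.
  by move=> /fM h'; move: h; rewrite h' leNgt t0.
have dX : down1 (lev f t).
  move=> a b b0 ba /andP[_ h]; apply/andP; split => //.
  exact: le_trans h (fd _ _ b0 ba).
have X0 : lev f t !=set0 by exists 0; apply/andP.
have [mX [eX sX]] := down1_measure dX bX X0.
exists (sup (lev f t)); split.
- by have /andP[] := sX 0 (introT andP (conj t0 t1)).
- by rewrite integral_ind.
- move=> a /andP[a0 ax].
  have hs : has_sup (lev f t) by split => //; exists M => b /bX/andP[].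
  have [] := @sup_adherent R (lev f t) (sup (lev f t) - a) _ hs; first by rewrite subr_gt0.
  move=> b Xb; rewrite opprB addrC subrK => ab.
  by have /andP[] := dX b a a0 (ltW ab) Xb.
Qed.

Lemma lev_empty (M : R) (f : R -> R) t : decr1 M f -> ~~ (0 < t <= f 0) ->
  (\int[leb]_r ind (lev f t) r = 0)%E.
Proof.
move=> [_ _ fN _ fd] /negP ht; apply: integral0_eq => r _; apply: ind0 => /andP[t0 tr].
apply: ht; rewrite t0 /=; have [r0|r0] := leP 0 r; first exact: le_trans tr (fd _ _ (lexx _) r0).
by move: tr; rewrite fN// leNgt t0.
Qed.

(** Equal maxima make the superlevel sets of [f] and [g] nonempty for the same levels, those in ]0,
    1]. At each of them the combination of the two intervals lies in the superlevel set of [h];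
    integrating over the levels gives the arithmetic form. *)
Lemma PL1_normalized (M l : R) (f g h : R -> R) : 0 < l < 1 ->
  decr1 M f -> decr1 M g -> measurable_fun setT h -> (forall r, 0 <= h r) ->
  f 0 = 1 -> g 0 = 1 ->
  (forall a b, f a `^ (1 - l) * g b `^ l <= h ((1 - l) * a + l * b)) ->
  ((1 - l)%:E * \int[leb]_r (f r)%:E + l%:E * \int[leb]_r (g r)%:E <= \int[leb]_r (h r)%:E)%E.
Proof.
move=> /andP[l0 l1] df dg mh h0 f01 g01 fgh.
have l1' : 0 < 1 - l by rewrite subr_gt0.
have [mf f0 _ _ _] := df; have [mg g0 _ _ _] := dg.
rewrite !layer_cake//.
have mlev (k : R -> R) : measurable_fun setT k ->
    measurable_fun setT (fun t => \int[leb]_r ind (lev k t) r)%E.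
  move=> mk; apply: (@measurable_fun_fubini_tonelli_F _ _ _ _ R leb (fun p => ind (lev k p.1) p.2)).
    have := @measurable_gt0_le _ (measurableTypeR R * measurableTypeR R)%type
      (fun p => p.1) (fun p => k p.2) measurable_fst (measurableT_comp mk measurable_snd).
    move/(measurable_ind (R := R)); apply: eq_measurable_fun => p _.
    exact: eq_ind.
  by move=> p; exact: ind_ge0.
have I0 (k : R -> R) t : (0 <= \int[leb]_r ind (lev k t) r)%E.
  by apply: integral_ge0 => *; exact: ind_ge0.
rewrite -!ge0_integralZl ?lee_fin ?(ltW l0) ?(ltW l1')//; [|exact: mlev|exact: mlev].
rewrite -ge0_integralD//; last 4 first.
- by move=> t _; rewrite mule_ge0 ?lee_fin ?(ltW l1').
- by apply: measurable_funeM; exact: mlev.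
- by move=> t _; rewrite mule_ge0 ?lee_fin ?(ltW l0).
- by apply: measurable_funeM; exact: mlev.
apply: ge0_le_integralT => t.
  by rewrite adde_ge0// mule_ge0 ?lee_fin ?(ltW l0) ?(ltW l1').
have [t01|t01] := boolP (0 < t <= 1); last first.
  by rewrite (lev_empty df) ?f01// (lev_empty dg) ?g01// !mule0 adde0.
have [|sf [sf0 -> Hf]] := lev_measure df (t := t); first by rewrite f01.
have [|sg [sg0 -> Hg]] := lev_measure dg (t := t); first by rewrite g01.
pose S := (1 - l) * sf + l * sg.
have S0 : 0 <= S by rewrite addr_ge0// mulr_ge0// ltW.
rewrite -!EFinM -EFinD -/S.
pose J : set R := `[0, S[%classic.
apply: (@le_trans _ _ (\int[leb]_r ind J r)%E).
  rewrite integral_ind /J// lebesgue_measure_itv/= lte_fin; case: ltP => ?.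
    by rewrite -EFinD subr0.
  by rewrite lee_fin.
apply: ge0_le_integralT => u; first exact: ind_ge0.
apply: le_ind; rewrite /J /= in_itv/= => /andP[u0 uS].
have Sgt0 : 0 < S by exact: le_lt_trans uS.
have uS1 : 0 <= u / S < 1 by rewrite divr_ge0//= ltr_pdivrMr// mul1r.
case/andP: uS1 => uS0 uS1; case/andP: t01 => t0 t1; apply/andP; split => //.
(* A point u below S is split by taking the same fraction u / S of both intervals. *)
have key (k : R -> R) s : 0 <= s -> k 0 = 1 -> (forall a, 0 <= a < s -> t <= k a) ->
    t <= k (u / S * s).
  move=> s0 k1 H; move: s0; rewrite le_eqVlt => /predU1P[<-|s0]; first by rewrite mulr0 k1.
  by apply: H; rewrite mulr_ge0 ?(ltW s0)//= gtr_pMl.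
have := fgh (u / S * sf) (u / S * sg).
rewrite (_ : (1 - l) * _ + _ = u); last first.
  rewrite mulrCA [l * _]mulrCA -mulrDr -/S divfK// gt_eqF//.
apply: le_trans.
have -> : t = t `^ (1 - l) * t `^ l.
  by rewrite -powRD ?subrK ?powRr1 ?(ltW t0)//; apply/implyP => _; rewrite gt_eqF.
by rewrite ler_pM ?powR_ge0// ge0_ler_powR ?nnegrE ?(ltW l0) ?(ltW l1') ?(ltW t0) ?f0 ?g0//;
  apply: key.
Qed.

(** Dividing by the maxima reduces to the normalised case; the weighted inequality of the means then
    replaces the arithmetic mean by the geometric one. *)
Lemma PL1 (M l : R) (f g h : R -> R) : 0 < l < 1 ->
  decr1 M f -> decr1 M g -> measurable_fun setT h -> (forall r, 0 <= h r) ->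
  (\int[leb]_r (f r)%:E < +oo)%E -> (\int[leb]_r (g r)%:E < +oo)%E ->
  (\int[leb]_r (h r)%:E < +oo)%E ->
  (forall a b, f a `^ (1 - l) * g b `^ l <= h ((1 - l) * a + l * b)) ->
  fine (\int[leb]_r (f r)%:E)%E `^ (1 - l) * fine (\int[leb]_r (g r)%:E)%E `^ l
   <= fine (\int[leb]_r (h r)%:E)%E.
Proof.
move=> l01 df dg mh h0 If Ig Ih fgh.
have /andP[l0 l1] := l01; have l1' : 0 < 1 - l by rewrite subr_gt0.
have [mf f0 fN _ fd] := df; have [mg g0 gN _ gd] := dg.
have H0 : 0 <= fine (\int[leb]_r (h r)%:E)%E.
  by apply: fine_ge0; apply: integral_ge0 => r _; rewrite lee_fin.
have zero (k : R -> R) : (forall r, 0 <= k r) -> (forall r, r < 0 -> k r = 0) ->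
    (forall a b, 0 <= a -> a <= b -> k b <= k a) -> k 0 = 0 ->
    (\int[leb]_r (k r)%:E = 0)%E.
  move=> k0 kN kd k00; apply: integral0_eq => r _; have [r0|/kN -> //] := leP 0 r.
  by congr EFin; apply/eqP; rewrite eq_le k0 -{1}k00 kd.
have [f00|f00] := eqVneq (f 0) 0.
  by rewrite (zero f)//= powR0 ?mul0r// gt_eqF.
have [g00|g00] := eqVneq (g 0) 0.
  by rewrite (zero g)//= [0 `^ l]powR0 ?mulr0// gt_eqF.
have F0 : 0 < f 0 by rewrite lt_neqAle eq_sym f00 f0.
have G0 : 0 < g 0 by rewrite lt_neqAle eq_sym g00 g0.
(* The scale of [h] that corresponds to dividing [f] and [g] by their maxima. *)
pose c := f 0 `^ (1 - l) * g 0 `^ l.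
have c0 : 0 < c by rewrite mulr_gt0// powR_gt0.
have norm (k : R -> R) (e : R) : 0 < e -> measurable_fun setT k -> (forall r, 0 <= k r) ->
    (\int[leb]_r (k r)%:E < +oo)%E ->
    (\int[leb]_r (e^-1 * k r)%:E = (e^-1 * fine (\int[leb]_r (k r)%:E))%:E)%E.
  move=> e0 mk k0 Ik.
  under eq_integral do rewrite EFinM.
  rewrite ge0_integralZl//; last 3 first.
  - exact/measurable_EFinP.
  - by move=> r _; rewrite lee_fin.
  - by rewrite lee_fin invr_ge0 ltW.
  by rewrite EFinM fineK// ge0_fin_numE// integral_ge0// => r _; rewrite lee_fin.
have dec (k : R -> R) (e : R) : 0 < e -> decr1 M k -> decr1 M (fun r => e^-1 * k r).
  move=> e0 [mk k0 kN kM kd]; split.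
  - by apply: measurable_funM.
  - by move=> r; rewrite mulr_ge0// invr_ge0 ltW.
  - by move=> r /kN ->; rewrite mulr0.
  - by move=> r /kM ->; rewrite mulr0.
  - by move=> a b a0 ab; rewrite ler_wpM2l ?invr_ge0 ?(ltW e0)// kd.
have := @PL1_normalized M l (fun r => (f 0)^-1 * f r) (fun r => (g 0)^-1 * g r)
  (fun r => c^-1 * h r) l01 (dec _ _ F0 df) (dec _ _ G0 dg).
rewrite !mulVf// => /(_ _ _ erefl erefl) H.
have {}H : (1 - l) * ((f 0)^-1 * fine (\int[leb]_r (f r)%:E)%E) +
   l * ((g 0)^-1 * fine (\int[leb]_r (g r)%:E)%E) <= c^-1 * fine (\int[leb]_r (h r)%:E)%E.
  rewrite -lee_fin EFinD !(EFinM (1 - l)) !(EFinM l) -!norm//.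
  apply: H.
  - by apply: measurable_funM.
  - by move=> r; rewrite mulr_ge0// invr_ge0 ltW.
  - move=> a b; apply: le_trans (ler_wpM2l _ (fgh a b)); last by rewrite invr_ge0 ltW.
    rewrite !powRM ?invr_ge0 ?f0 ?g0// /c.
    by rewrite !powRV// invfM mulrACA.
pose F := fine (\int[leb]_r (f r)%:E)%E; pose G := fine (\int[leb]_r (g r)%:E)%E.
have F0' : 0 <= F by apply: fine_ge0; apply: integral_ge0 => r _; rewrite lee_fin.
have G0' : 0 <= G by apply: fine_ge0; apply: integral_ge0 => r _; rewrite lee_fin.
have := @weighted_AMGM l ((f 0)^-1 * F) ((g 0)^-1 * G) l01.
rewrite !mulr_ge0 ?invr_ge0// => /(_ isT isT) /le_trans /(_ H).
rewrite !powRM ?invr_ge0// !powRV// mulrACA -invfM ler_pM2l ?invr_gt0//.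
Qed.

End prekopa_leindler1.

Section prekopa_leindler.
Context {R : realType} {n : nat}.
Local Notation pt := 'rV[R]_n.
Local Notation leb := (@lebesgue_measure R).
Implicit Types (X Y Z : set pt) (x y : pt) (s : seq 'I_n).

Definition down_set (M : R) X := [/\ mset X, (forall x, X x -> forall i, 0 <= x 0 i <= M)
  & (forall x y, X x -> (forall i, 0 <= y 0 i <= x 0 i) -> X y)].

Lemma le_iint_off s (f g : pt -> \bar R) x y : (forall x, 0 <= f x)%E ->
  (forall x' y', (forall i, i \notin s -> x' ord0 i = x ord0 i) ->
     (forall i, i \notin s -> y' ord0 i = y ord0 i) ->
     (forall i, i \in s -> x' ord0 i = y' ord0 i) -> f x' <= g y')%E ->
  (iint s f x <= iint s g y)%E.
Proof.
move=> f0; elim: s x y => /= [|i s IH] x y fg; first by apply: fg.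
apply: ge0_le_integralT => r; first exact: iint_ge0.
apply: IH => x' y' hx hy hxy; apply: fg.
- move=> j; rewrite inE negb_or => /andP[ji js].
  by rewrite hx// updE (negbTE ji).
- move=> j; rewrite inE negb_or => /andP[ji js].
  by rewrite hy// updE (negbTE ji).
- move=> j; rewrite inE => /orP[/eqP ->|]; last exact: hxy.
  have [/hxy//|si] := boolP (i \in s).
  by rewrite hx// hy// !updE eqxx.
Qed.

Lemma iint_eq0 s (f : pt -> \bar R) x :
  (forall x', (forall i, i \notin s -> x' 0 i = x 0 i) -> f x' = 0%E) -> iint s f x = 0%E.
Proof.
move=> f0; rewrite -(iint0 s x); apply: eq_iint_off => x' y' hx _ _; exact: f0.
Qed.

Lemma iint_ind_le M s X x : 0 <= M -> uniq s ->
  (forall x, X x -> forall i, 0 <= x 0 i <= M) ->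
  (iint s (ind X) x <= (M ^+ size s)%:E)%E.
Proof.
move=> M0; elim: s x => [|i s IH] x /=.
  by rewrite expr0 /ind lee_fin indicE; case: (_ \in _).
move=> /andP[si us] bX.
pose J : set R := `[0, M]%classic.
apply: (@le_trans _ _ (\int[leb]_r ((M ^+ size s)%:E * ind J r))%E).
  apply: ge0_le_integralT => r; first by apply: iint_ge0 => z; exact: ind_ge0.
  have [Jr|Jr] := pselect (J r); first by rewrite ind1// mule1 IH.
  rewrite iint_eq0 ?mule_ge0 ?ind_ge0 ?lee_fin ?exprn_ge0// => x' hx; apply: ind0 => /bX/(_ i).
  by rewrite hx// updE eqxx => h; apply: Jr; rewrite /J/= in_itv.
rewrite ge0_integralZl//; last 3 first.
- by apply: (@measurable_ind _ _ (measurableTypeR R)); exact: measurable_itv.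
- by move=> r _; exact: ind_ge0.
- by rewrite lee_fin exprn_ge0.
rewrite integral_ind /J// lebesgue_measure_itv/= lte_fin exprSr.
case: ltP => _; last by rewrite mule0 lee_fin mulr_ge0 ?exprn_ge0.
by rewrite -EFinD subr0 -EFinM.
Qed.

(** The volume, in the coordinates [s], of the fibre of [X] with the other coordinates those of [x];
    at 0 it is the volume of a coordinate section. *)
Definition svol s X x : R := fine (iint s (ind X) x).

Lemma svol_ge0 s X x : 0 <= svol s X x.
Proof. by apply: fine_ge0; apply: iint_ge0 => y; exact: ind_ge0. Qed.

Lemma svolE M s X x : uniq s -> (forall x, X x -> forall i, 0 <= x 0 i <= M) ->
  iint s (ind X) x = (svol s X x)%:E.
Proof.
move=> us bX; rewrite /svol fineK// ge0_fin_numE; last first.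
  by apply: iint_ge0 => y; exact: ind_ge0.
have bX' z : X z -> forall i, 0 <= z 0 i <= `|M|.
  by move=> Xz i; have /andP[-> h] := bX z Xz i; rewrite (le_trans h)// ler_norm.
by apply: le_lt_trans (iint_ind_le x _ us bX') _; rewrite ?ltry.
Qed.

Lemma svol_decr M i s X x : down_set M X -> i \notin s -> uniq s ->
  decr1 M (fun r => svol s X (upd x i r)).
Proof.
move=> [mX bX dX] si us.
have z r : (~ 0 <= r <= M) -> svol s X (upd x i r) = 0.
  move=> h; rewrite /svol iint_eq0// => x' hx; apply: ind0 => /bX/(_ i).
  by rewrite hx// updE eqxx.
split.
- apply: (measurableT_comp (fine_measurable measurableT)).
  by apply: mfun_upd; apply: mfun_iint; [exact: ind_ge0|exact: mfun_ind].
- by move=> r; exact: svol_ge0.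
- by move=> r r0; apply: z; rewrite leNgt r0.
- by move=> r r0; apply: z; rewrite [r <= _]leNgt r0 andbF.
- move=> a b a0 ab; rewrite -lee_fin -!(svolE _ us bX).
  apply: le_iint_off => [y|x' y' hx hy hxy]; first exact: ind_ge0.
  apply: le_ind => Xx; apply: (dX _ _ Xx) => j.
  have /andP[x0 _] := bX _ Xx j.
  have [/hxy <-|js] := boolP (j \in s); first by rewrite x0 lexx.
  move: x0; rewrite hx// hy// !updE; case: eqP => _ x0; last by rewrite x0 lexx.
  by rewrite a0.
Qed.

(** Indicator functions suffice. As functions of one outer coordinate, the fibre volumes of sets
    closed under shrinking are of the class [decr1], so the one-dimensional inequality applies at
    every stage. *)
Lemma prekopa_leindler M (l : R) s X Y Z x y : 0 < l < 1 -> uniq s ->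
  down_set M X -> down_set M Y -> down_set M Z ->
  (forall x y, X x -> Y y -> Z ((1 - l) *: x + l *: y)) ->
  svol s X x `^ (1 - l) * svol s Y y `^ l <= svol s Z ((1 - l) *: x + l *: y).
Proof.
move=> l01 us dX dY dZ XYZ; have /andP[l0 l1] := l01.
have l1' : 0 < 1 - l by rewrite subr_gt0.
elim: s us x y => [|i s IH] us x y.
  rewrite /svol /= /ind !indicE /=.
  have [/set_mem Xx|_] := boolP (x \in X); last by rewrite powR0 ?mul0r// gt_eqF.
  have [/set_mem Yy|_] := boolP (y \in Y); last by rewrite [0 `^ l]powR0 ?mulr0// gt_eqF.
  by rewrite mem_set ?powR1 ?mulr1//; exact: XYZ.
move: us => /= /andP[si us].
have E (W : set pt) w : down_set M W ->
    iint (i :: s) (ind W) w = (\int[leb]_r (svol s W (upd w i r))%:E)%E.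
  by move=> [_ bW _]; apply: eq_integral => r _; rewrite -(svolE _ us bW).
have F (W : set pt) w : down_set M W -> (\int[leb]_r (svol s W (upd w i r))%:E < +oo)%E.
  move=> dW'; rewrite -E//; case: dW' => _ bW _.
  by rewrite (@svolE M) ?ltry//= si.
have V (W : set pt) w : down_set M W ->
    svol (i :: s) W w = fine (\int[leb]_r (svol s W (upd w i r))%:E)%E.
  by move=> dW'; rewrite /svol E.
rewrite !V//.
have [mh h0 _ _ _] := svol_decr ((1 - l) *: x + l *: y) dZ si us.
apply: (PL1 l01 (svol_decr x dX si us) (svol_decr y dY si us)) => //; try exact: F.
move=> a b; apply: (le_trans (IH us (upd x i a) (upd y i b))).
rewrite le_eqVlt; apply/orP; left; apply/eqP; congr svol; apply/rowP => j.
by rewrite !mxE; case: eqP.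
Qed.

End prekopa_leindler.

Section brunn_minkowski.
Context {R : realType} {n : nat}.
Local Notation pt := 'rV[R]_n.
Local Notation leb := (@lebesgue_measure R).
Implicit Types (X Y Z : set pt) (x y : pt) (s : seq 'I_n).

Lemma down_set_le M M' X : M <= M' -> down_set M X -> down_set M' X.
Proof.
move=> MM [mX bX dX]; split => // x Xx i.
by have /andP[-> h] := bX x Xx i; exact: le_trans MM.
Qed.

Lemma down_set_scale M a X : 0 < a -> down_set M X -> down_set (M / a) [set x | X (a *: x)].
Proof.
move=> a0 [mX bX dX]; split.
- rewrite /mset; pose u (t : n.-tuple (measurableTypeR R)) := a *: rowt t.
  have mu i : measurable_fun setT (fun t => u t 0 i).
    by under eq_fun do rewrite mxE; apply: measurable_funM => //; exact: measurable_coord.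
  have := mfun_comp (mfun_ind mX) mu; move=> /(_ measurableT [set 1%E] (emeasurable_set1 _)).
  rewrite setTI; congr measurable; apply/seteqP; split => t /=.
    by have [//|h] := pselect (X (u t)); rewrite ind0// => -[] /eqP; rewrite eq_sym oner_eq0.
  by move=> h; rewrite ind1.
- move=> x /= /bX h i; have := h i; rewrite mxE => /andP[h1 h2].
  by rewrite -(pmulr_rge0 _ a0) h1 /= ler_pdivlMr// mulrC.
- move=> x y /= Xx xy; apply: dX Xx _ => i; rewrite !mxE.
  have /andP[h1 h2] := xy i.
  by rewrite (mulr_ge0 (ltW a0))//= ler_pM2l.
Qed.

Lemma svol_scale M a s X : 0 < a -> uniq s -> down_set M X ->
  svol s X 0 = a ^+ size s * svol s [set x | X (a *: x)] 0.
Proof.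
move=> a0 us dX; have [mX bX _] := dX; have [_ bX' _] := down_set_scale a0 dX.
apply: EFin_inj; rewrite EFinM -(svolE 0 us bX) -(svolE 0 us bX').
rewrite -{1}(scaler0 _ a) iint_scale//; last 2 first.
- by move=> x; exact: ind_ge0.
- exact: mfun_ind.
Qed.

Lemma le_svol M M' s X Y x : uniq s -> down_set M X -> down_set M' Y ->
  (forall z, X z -> Y z) -> svol s X x <= svol s Y x.
Proof.
move=> us [_ bX _] [_ bY _] XY; rewrite -lee_fin -(svolE _ us bX) -(svolE _ us bY).
by apply: le_iint => z; [exact: ind_ge0|apply: le_ind; exact: XY].
Qed.

(** Lower bounds by powers avoid taking roots. If [al] or [be] is 0, then [Z] contains a dilate of
    the other set because 0 lies in both; otherwise dilation makes both volumes at least 1 and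
    Prékopa-Leindler applies with another weight. *)
Lemma brunn_minkowski M (l al be : R) s X Y Z : 0 < l < 1 -> uniq s ->
  down_set M X -> down_set M Y -> down_set M Z -> X 0 -> Y 0 ->
  (forall x y, X x -> Y y -> Z ((1 - l) *: x + l *: y)) ->
  0 <= al -> 0 <= be ->
  al ^+ size s <= svol s X 0 -> be ^+ size s <= svol s Y 0 ->
  ((1 - l) * al + l * be) ^+ size s <= svol s Z 0.
Proof.
move=> l01 us dX dY dZ X0 Y0 XYZ; have /andP[l0 l1] := l01.
have l1' : 0 < 1 - l by rewrite subr_gt0.
have one e W c : 0 < e -> down_set M W -> (forall w, W w -> Z (e *: w)) ->
    c ^+ size s <= svol s W 0 -> (e * c) ^+ size s <= svol s Z 0.
  move=> e0 dW WZ cW; rewrite (svol_scale e0 us dZ) exprMn ler_pM2l ?exprn_gt0//.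
  by apply: (le_trans cW); apply: (le_svol _ us dW (down_set_scale e0 dZ)).
rewrite le_eqVlt => /predU1P[<- _ _ bY|al0].
  rewrite mulr0 add0r; apply: (one l Y) => // w Yw.
  by have := XYZ 0 w X0 Yw; rewrite scaler0 add0r.
rewrite le_eqVlt => /predU1P[<- aX _|be0 aX bY].
  rewrite mulr0 addr0; apply: (one (1 - l) X) => // w Xw.
  by have := XYZ w 0 Xw Y0; rewrite scaler0 addr0.
pose S := (1 - l) * al + l * be.
have S0 : 0 < S by rewrite addr_gt0// mulr_gt0.
(* Chosen so that S ((1 - l') x + l' y) = (1 - l) (al x) + l (be y). *)
pose l' := l * be / S.
have l'0 : 0 < l' by rewrite divr_gt0// mulr_gt0.
have l'E : 1 - l' = (1 - l) * al / S.
  by apply: (mulIf (lt0r_neq0 S0)); rewrite mulrBl mul1r !divfK ?gt_eqF// /S addrK.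
have l'1 : l' < 1 by rewrite -subr_gt0 l'E divr_gt0// mulr_gt0.
pose X' := [set x | X (al *: x)]; pose Y' := [set x | Y (be *: x)].
pose Z' := [set x | Z (S *: x)].
pose M' := `|M| / al + `|M| / be + `|M| / S.
have MX c : 0 < c -> 0 <= `|M| / c by move=> c0; rewrite divr_ge0// ltW.
have dX' : down_set M' X'.
  apply: down_set_le (down_set_scale al0 (down_set_le (ler_norm M) dX)).
  by rewrite /M' -addrA lerDl addr_ge0 ?MX.
have dY' : down_set M' Y'.
  apply: down_set_le (down_set_scale be0 (down_set_le (ler_norm M) dY)).
  by rewrite /M' addrAC lerDr addr_ge0 ?MX.
have dZ' : down_set M' Z'.
  apply: down_set_le (down_set_scale S0 (down_set_le (ler_norm M) dZ)).
  by rewrite /M' lerDr addr_ge0 ?MX.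
have X1 : 1 <= svol s X' 0.
  by rewrite -(ler_pM2l (exprn_gt0 (size s) al0)) mulr1 -(svol_scale al0 us dX).
have Y1 : 1 <= svol s Y' 0.
  by rewrite -(ler_pM2l (exprn_gt0 (size s) be0)) mulr1 -(svol_scale be0 us dY).
have XYZ' x y : X' x -> Y' y -> Z' ((1 - l') *: x + l' *: y).
  move=> Xx Yy; have := XYZ _ _ Xx Yy.
  by rewrite /Z'/= l'E scalerDr !scalerA mulrCA [S * l']mulrCA !mulfV ?gt_eqF// !mulr1.
have l'01 : 0 < l' < 1 by rewrite l'0.
have := prekopa_leindler 0 0 l'01 us dX' dY' dZ' XYZ'.
rewrite !scaler0 addr0 => PL.
rewrite (svol_scale S0 us dZ) ler_peMr ?exprn_ge0 ?(ltW S0)//.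
apply: le_trans PL; rewrite -[leLHS]mulr1 ler_pM//.
  by rewrite -[leLHS](powRr0 (svol s X' 0)) ler_powR// subr_ge0 ltW.
by rewrite -[leLHS](powRr0 (svol s Y' 0)) ler_powR// ltW.
Qed.

End brunn_minkowski.

(** * Berwald's inequality and the local Loomis–Whitney inequality *)

Section beta_weights.
Context {R : realType}.
Local Notation leb := (@lebesgue_measure R).

(** The density whose integral up to c >= 0 is c^m, for m > 0. *)
Definition bw (m : nat) (s : R) : R := if 0 < s then m%:R * s ^+ m.-1 else 0.

(** For s between 0 and c, the share of the g-dimensional base that remains at height s in a cone of
    height c. *)
Definition cut (g : nat) (c s : R) : R := if s <= c then (1 - s / c) ^+ g else 0.

Lemma bw_ge0 m s : 0 <= bw m s.
Proof. by rewrite /bw; case: ifP => // s0; rewrite mulr_ge0// exprn_ge0// ltW. Qed.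

Lemma cut_ge0 g c s : 0 < c -> 0 <= cut g c s.
Proof.
move=> c0; rewrite /cut; case: ifP => // sc; rewrite exprn_ge0//.
by rewrite subr_ge0 ler_pdivrMr// mul1r.
Qed.

Lemma measurable_bw m : measurable_fun [set: R] (bw m).
Proof.
apply: measurable_fun_if => //; first exact: measurable_fun_ltr.
apply: measurable_funTS; apply: measurable_funM => //; exact: exprn_measurable.
Qed.

Lemma measurable_cut g c : measurable_fun [set: R] (cut g c).
Proof.
apply: measurable_fun_if => //; first exact: measurable_fun_ler.
apply: measurable_funTS; apply: measurable_funX; apply: measurable_funB => //.
exact: mulrr_measurable.
Qed.

(** After rescaling to c = 1 this is m B(m, g + 1), the reciprocal of a binomial; all binomials of
    [dn2] originate here. *)
Lemma integral_bw_cut m g (c : R) : 0 < c -> (0 < m)%N ->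
  (\int[leb]_s (bw m s * cut g c s)%:E = (c ^+ m / 'C(g + m, g)%:R)%:E)%E.
Proof.
move=> c0 m0.
have E1 : (\int[leb]_s (bw m s * cut g 1 s)%:E = ('C(g + m, g)%:R^-1)%:E)%E.
  transitivity (m%:R%:E * (beta_fun m g.+1 : R)%:E)%E; last first.
    rewrite -EFinM; congr EFin; case: m m0 => // m _.
    rewrite beta_fun_fact (_ : (m + g).+1 = (g + m.+1)%N); last by rewrite addnC addnS.
    have := bin_fact (leq_addr m.+1 g); rewrite addKn => E.
    have E' : 'C(g + m.+1, g)%:R * ((g`!)%:R * (m.+1)`!%:R) = (g + m.+1)`!%:R :> R.
      by rewrite -!natrM E.
    rewrite -E' factS !natrM.
    have h1 : 'C(g + m.+1, g)%:R != 0 :> R by rewrite pnatr_eq0 -lt0n bin_gt0 leq_addr.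
    have h2 : g`!%:R != 0 :> R by rewrite pnatr_eq0 -lt0n fact_gt0.
    have h3 : m`!%:R != 0 :> R by rewrite pnatr_eq0 -lt0n fact_gt0.
    by field; rewrite h1 h2 h3 nat1r pnatr_eq0.
  have -> : (beta_fun m g.+1 : R)%:E = (\int[leb]_(s in `]0%R, 1%R]) (XMonemX m.-1 g s)%:E)%E.
    rewrite EFin_beta_fun integral_XMonemX_restrict setTI -integral_itv_obnd_cbnd//.
    by apply/measurable_EFinP; exact: measurable_XMonemX.
  rewrite -ge0_integralZl//; last 2 first.
  - by apply/measurable_EFinP; exact: measurable_XMonemX.
  - move=> s; rewrite /= in_itv/= => /andP[s0 s1]; rewrite lee_fin XMonemX_ge0// in_itv/=.
    by rewrite (ltW s0).
  rewrite [RHS]integral_mkcond; apply: eq_integral => s _.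
  rewrite patchE /bw /cut; case: (ltP 0 s) => s0; last first.
    by rewrite mul0r memNset//= in_itv/= ltNge s0.
  case: (leP s 1) => s1; last by rewrite mulr0 memNset//= in_itv/= [s <= 1]leNgt s1 andbF.
  by rewrite mem_set/= ?in_itv/= ?s0// /XMonemX divr1 -EFinM mulrA.
rewrite (ge0_integral_scale c0); last 2 first.
- apply/measurable_EFinP; apply: measurable_funM; [exact: measurable_bw|exact: measurable_cut].
- by move=> s; rewrite lee_fin mulr_ge0 ?bw_ge0 ?cut_ge0.
have cm0 : 0 <= c ^+ m.-1 by rewrite exprn_ge0// ltW.
transitivity (c%:E * ((c ^+ m.-1)%:E * \int[leb]_s (bw m s * cut g 1 s)%:E))%E; last first.
  by rewrite E1 -!EFinM mulrA -exprS prednK.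
congr (_ * _)%E; rewrite -ge0_integralZl//; last 2 first.
- apply/measurable_EFinP; apply: measurable_funM; [exact: measurable_bw|exact: measurable_cut].
- by move=> s _; rewrite lee_fin mulr_ge0 ?bw_ge0 ?cut_ge0.
apply: eq_integral => s _; rewrite -EFinM; congr EFin.
rewrite /bw /cut pmulr_rgt0//; case: ifP => s0; last by rewrite !mul0r mulr0.
rewrite ger_pMr// divr1 [c * s / c]mulrAC mulfV ?gt_eqF// mul1r exprMn.
by move: (c ^+ _) (s ^+ m.-1) (if _ then _ else _) => x y z; ring.
Qed.

Lemma integral_bw_itv m (c : R) : 0 <= c -> (0 < m)%N ->
  (\int[leb]_s ((bw m s)%:E * ind [set s | (0 < s <= c)%R] s) = (c ^+ m)%:E)%E.
Proof.
rewrite le_eqVlt => /predU1P[<-|c0] m0.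
  rewrite expr0n gtn_eqF//= integral0_eq// => s _; rewrite ind0 ?mule0//=.
  by move=> /andP[h1 h2]; move: h1; rewrite ltNge h2.
have := integral_bw_cut 0 c0 m0; rewrite bin0 divr1 => <-.
apply: eq_integral => s _; rewrite EFinM /cut /bw expr0.
case: (ltP 0 s) => s0; last by rewrite !mul0e.
case: (leP s c) => sc; first by rewrite ind1//= s0.
by rewrite ind0//= s0 /= leNgt sc.
Qed.

End beta_weights.

Section crossing.
Context {R : realType}.
Local Notation leb := (@lebesgue_measure R).

(* N - D changes sign at most once, from + to -, and its moment of order k vanishes. *)
Lemma crossing_le (k h : nat) (N D : R -> R) (M : R) : (0 < k)%N ->
  measurable_fun setT N -> measurable_fun setT D ->
  (forall s, 0 <= N s) -> (forall s, 0 <= D s) ->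
  (forall s, M < s -> N s = 0) ->
  (forall s1 s2, 0 < s1 -> s1 < s2 -> D s2 < N s2 -> D s1 <= N s1) ->
  (\int[leb]_s (bw k s * N s)%:E = \int[leb]_s (bw k s * D s)%:E)%E ->
  (\int[leb]_s (bw k s * D s)%:E < +oo)%E ->
  (\int[leb]_s (bw (k + h) s * N s)%:E <= \int[leb]_s (bw (k + h) s * D s)%:E)%E.
Proof.
move=> k0 mN mD N0 D0 NM cross eqk fink.
have le_case : (forall s, 0 < s -> N s <= D s) ->
  (\int[leb]_s (bw (k + h) s * N s)%:E <= \int[leb]_s (bw (k + h) s * D s)%:E)%E.
  move=> ND; apply: ge0_le_integralT => s; first by rewrite lee_fin mulr_ge0// bw_ge0.
  rewrite lee_fin /bw; case: ifP => s0; last by rewrite !mul0r.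
  by rewrite ler_wpM2l ?ND// mulr_ge0// exprn_ge0// ltW.
pose S := [set s | 0 < s /\ D s < N s].
have [S0|S0] := pselect (S !=set0); last first.
  by apply: le_case => s s0; rewrite leNgt; apply/negP => h'; apply: S0; exists s.
have hS : has_sup S.
  split => //; exists M => s [s0 Ds]; rewrite leNgt; apply/negP => /NM h'.
  by move: Ds; rewrite h' ltNge D0.
pose z := sup S.
have z0 : 0 <= z by case: S0 => s [s0 Ds]; apply: le_trans (ltW s0) _; apply: sup_upper_bound.
have below s : 0 < s -> s < z -> D s <= N s.
  move=> s0 sz; have [] := @sup_adherent R S (z - s) _ hS; first by rewrite subr_gt0.
  by move=> t [t0 Dt]; rewrite -/z opprB addrC subrK => st; exact: cross st Dt.
have above s : 0 < s -> z < s -> N s <= D s.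
  move=> s0 sz; rewrite leNgt; apply/negP => Ds.
  by move: sz; rewrite ltNge (sup_upper_bound hS).
(* The quotient of the weights of orders k + h and k is (k + h)/k s^h, which equals [c] at the
   crossing point z. Subtracting [c] times the k-th moments makes the weight change sign together
   with D - N. *)
pose c : R := (k + h)%:R / k%:R * z ^+ h.
have c0 : 0 <= c by rewrite mulr_ge0// exprn_ge0.
have pt s : bw (k + h) s * N s + c * (bw k s * D s) <= bw (k + h) s * D s + c * (bw k s * N s).
  rewrite /bw; case: ifP => s0; last by rewrite !mul0r mulr0.
  have -> : s ^+ (k + h).-1 = s ^+ k.-1 * s ^+ h by rewrite -exprD; congr (_ ^+ _); lia.
  rewrite -subr_ge0.
  have -> : (k + h)%:R * (s ^+ k.-1 * s ^+ h) * D s + c * (k%:R * s ^+ k.-1 * N s) -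
    ((k + h)%:R * (s ^+ k.-1 * s ^+ h) * N s + c * (k%:R * s ^+ k.-1 * D s)) =
    (k + h)%:R * s ^+ k.-1 * ((s ^+ h - z ^+ h) * (D s - N s)).
    by rewrite /c; field; rewrite pnatr_eq0 -lt0n.
  rewrite mulr_ge0//; first by rewrite mulr_ge0// exprn_ge0// ltW.
  have [sz|sz|->] := ltgtP s z.
  - rewrite -mulrNN mulr_ge0// oppr_ge0 subr_le0 ?below//.
    by rewrite lerXn2r ?nnegrE// ?(ltW s0)// ltW.
  - rewrite mulr_ge0// subr_ge0 ?above//.
    by rewrite lerXn2r ?nnegrE// ?(ltW s0)// ltW.
  - by rewrite subrr mul0r.
have mb m (F : R -> R) : measurable_fun setT F -> measurable_fun setT (fun s => (bw m s * F s)%:E).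
  by move=> mF; apply/measurable_EFinP; apply: measurable_funM => //; exact: measurable_bw.
have mcb m (F : R -> R) : measurable_fun setT F -> measurable_fun setT (fun s =>
  c%:E * (bw m s * F s)%:E)%E.
  by move=> mF; apply: measurable_funeM; exact: mb.
have b0 m (F : R -> R) s : (forall s, 0 <= F s) -> (0 <= (bw m s * F s)%:E)%E.
  by move=> F0; rewrite lee_fin mulr_ge0 ?bw_ge0.
have lin (F G : R -> R) : measurable_fun setT F -> measurable_fun setT G ->
    (forall s, 0 <= F s) -> (forall s, 0 <= G s) ->
    (\int[leb]_s (bw (k + h) s * F s)%:E + c%:E * \int[leb]_s (bw k s * G s)%:E =
     \int[leb]_s (bw (k + h) s * F s + c * (bw k s * G s))%:E)%E.
  move=> mF mG F0 G0.
  rewrite -ge0_integralZl//; [|exact: mb|by move=> *; exact: b0].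
  rewrite -ge0_integralD//.
  - by move=> s _; exact: b0.
  - exact: mb.
  - by move=> s _; rewrite mule_ge0 ?lee_fin// -lee_fin b0.
  - exact: mcb.
have H : (\int[leb]_s (bw (k + h) s * N s)%:E + c%:E * \int[leb]_s (bw k s * D s)%:E <=
   \int[leb]_s (bw (k + h) s * D s)%:E + c%:E * \int[leb]_s (bw k s * N s)%:E)%E.
  rewrite !lin//; apply: ge0_le_integralT => s; last by rewrite lee_fin.
  by rewrite lee_fin; apply: addr_ge0; [|apply: mulr_ge0]; rewrite ?c0// mulr_ge0//; exact: bw_ge0.
move: H; rewrite eqk leeD2rE// fin_numM//.
by rewrite ge0_fin_numE//; apply: integral_ge0 => s _; exact: b0.
Qed.

End crossing.

Section berwald.
Context {R : realType} {n : nat}.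
Local Notation pt := 'rV[R]_n.
Local Notation leb := (@lebesgue_measure R).
Implicit Types (x y u : pt).
Variables (M : R) (A : set pt).
Hypotheses (dA : down_set M A) (A0 : A 0).
Hypothesis cA : forall (l : R) x y, 0 < l < 1 -> A x -> A y -> A ((1 - l) *: x + l *: y).

Lemma svol_anti (s : seq 'I_n) x y : uniq s -> (forall i, 0 <= y 0 i <= x 0 i) ->
  svol s A x <= svol s A y.
Proof.
move=> us xy; have [_ bA sA] := dA.
rewrite -lee_fin -!(svolE _ us bA); apply: le_iint_off => [z|x' y' hx hy hxy].
  exact: ind_ge0.
apply: le_ind => Ax; apply: (sA _ _ Ax) => i; have /andP[x0 _] := bA _ Ax i.
have [/hxy <-|si] := boolP (i \in s); first by rewrite x0 lexx.
by rewrite hx// hy.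
Qed.

(** By convexity the fibre over the combination contains the l-dilate of the fibre over y.
    Annihilating the coordinates of x in [s] keeps it in A and avoids a translation. *)
Lemma svol_slice_conv (s : seq 'I_n) l x y : uniq s -> 0 < l < 1 -> A x ->
  l ^+ size s * svol s A y <= svol s A ((1 - l) *: x + l *: y).
Proof.
move=> us l01 Ax; have [mA bA sA] := dA; have /andP[l0 l1] := l01.
pose x0 : pt := \row_i (if i \in s then 0 else x 0 i).
have Ax0 : A x0.
  apply: (sA _ _ Ax) => i; have /andP[h _] := bA _ Ax i; rewrite mxE.
  by case: ifP => _; rewrite ?h lexx.
rewrite -lee_fin EFinM -!(svolE _ us bA).
pose F z := ind A ((1 - l) *: x0 + z) : \bar R.
have mF : mfun F.
  apply: (mfun_comp (mfun_ind mA)) => i; under eq_fun do rewrite mxE.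
  by apply: measurable_funD => //; exact: measurable_coord.
rewrite [leRHS](_ : _ = iint s F (l *: y)); last first.
  apply: eq_iint_off => x' y' hx hy hxy; congr ind; apply/rowP => i; rewrite !mxE.
  have [si|si] := boolP (i \in s); first by rewrite mulr0 add0r hxy.
  by rewrite hx// hy// !mxE.
rewrite iint_scale//; last by move=> z; exact: ind_ge0.
rewrite lee_wpmul2l ?lee_fin ?exprn_ge0 ?(ltW l0)//.
apply: le_iint => z; first exact: ind_ge0.
by apply: le_ind => Az; exact: cA.
Qed.

Variables (sG sK : seq 'I_n).
Hypothesis uGK : uniq (sG ++ sK).
Let g := size sG.
Let k := size sK.
Hypothesis k0 : (0 < k)%N.
Let a u := svol sK A u.

Let uG : uniq sG. Proof. by move: uGK; rewrite cat_uniq => /andP[]. Qed.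
Let uK : uniq sK. Proof. by move: uGK; rewrite cat_uniq => /and3P[]. Qed.
Let notGK i : i \in sK -> i \notin sG.
Proof.
move: uGK; rewrite cat_uniq => /and3P[_ /hasPn h _] iK; exact: h.
Qed.

(** For s > 0, the superlevel set of the k-th root of the fibre volume. *)
Let Xs (s : R) : set pt := [set u | A u /\ s ^+ k <= a u].

Let a_ge0 u : 0 <= a u. Proof. exact: svol_ge0. Qed.

Let a_zero u : (forall i, i \in sK -> u 0 i = 0) -> ~ A u -> a u = 0.
Proof.
move=> u0 nA; rewrite /a /svol iint_eq0// => x' hx; apply: ind0 => Ax; apply: nA.
have [_ bA sA] := dA; apply: (sA _ _ Ax) => i; have /andP[h _] := bA _ Ax i.
have [si|si] := boolP (i \in sK); first by rewrite u0// h lexx.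
by rewrite -hx// h lexx.
Qed.

Let ma : measurable_fun [set: n.-tuple (measurableTypeR R)] (fun t => a (rowt t)).
Proof.
have [mA _ _] := dA.
apply: (measurableT_comp (fine_measurable measurableT)).
by apply: mfun_iint; [exact: ind_ge0|exact: mfun_ind].
Qed.

Let jXs : jmeas (fun (s : measurableTypeR R) u => ind (Xs s) u : \bar R).
Proof.
have [mA _ _] := dA.
have m1 : measurable_fun setT (fun p : measurableTypeR R * n.-tuple (measurableTypeR R) =>
    p.1 ^+ k <= a (rowt p.2)).
  apply: measurable_fun_ler.
    by apply: measurable_funX; exact: measurable_fst.
  exact: (measurableT_comp ma measurable_snd).
have m2 := m1 measurableT [set true] I; rewrite setTI in m2.
have m3 : measurable (snd @^-1` [set t | A (rowt t)] :
    set (measurableTypeR R * n.-tuple (measurableTypeR R))).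
  by rewrite -[X in measurable X]setTI; exact: measurable_snd.
have := measurable_ind (R := R) (measurableI _ _ m3 m2).
by apply: eq_measurable_fun => p _; apply: eq_ind; split.
Qed.

Let a_le u : a u <= `|M| ^+ k.
Proof.
have [_ bA _] := dA; rewrite -lee_fin -(svolE _ uK bA); apply: iint_ind_le => // z Az i.
by have /andP[-> h] := bA z Az i; rewrite (le_trans h)// ler_norm.
Qed.

Let dXs s : down_set M (Xs s).
Proof.
have [_ bA sA] := dA; split.
- have := jmeas_mfun s jXs; move=> /(_ measurableT [set 1%E] (emeasurable_set1 _)).
  rewrite setTI; congr measurable; apply/seteqP; split => t /=.
    by have [//|h] := pselect (Xs s (rowt t)); rewrite ind0// => -[] /eqP; rewrite eq_sym oner_eq0.
  by move=> h; rewrite ind1.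
- by move=> x [/bA].
- move=> x y [Ax ax] xy; split; first exact: sA xy.
  by apply: (le_trans ax); exact: svol_anti.
Qed.

Let N s := svol sG (Xs s) 0.

Let Nfin s : iint sG (ind (Xs s)) 0 = (N s)%:E.
Proof. by have [_ bX _] := dXs s; rewrite (svolE _ uG bX). Qed.

Let mN : measurable_fun [set: R] N.
Proof.
apply: (measurableT_comp (fine_measurable measurableT)).
have mf := jmeas_iint sG (fun s u => ind_ge0 (Xs s) u) jXs.
have := @jmeas_comp _ _ _ _ _ _ _ id (fun _ => 0) mf (@measurable_id _ _ _).
by apply => i; exact: measurable_cst.
Qed.

Let N0 s : 0 <= N s. Proof. exact: svol_ge0. Qed.

Let N_large s : `|M| < s -> N s = 0.
Proof.
move=> Ms; rewrite /N /svol iint_eq0// => x' _; apply: ind0 => -[_].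
rewrite leNgt => /negP; apply; apply: le_lt_trans (a_le _) _.
by rewrite ltrXn2r ?nnegrE -?lt0n// (le_trans (normr_ge0 M))// ltW.
Qed.

Let Xs0 : Xs 0 = A.
Proof.
apply/seteqP; split => [u []//|u Au]; split => //.
by rewrite expr0n gtn_eqF.
Qed.

(** The layer-cake formula: integrating the weight of order m over the levels s with s^k <= a u
    gives (a u)^(m/k). *)
Let layer m : (0 < m)%N ->
  (\int[leb]_s (bw m s * N s)%:E =
   iint sG (fun u => (a u `^ (m%:R / k%:R))%:E) 0)%E.
Proof.
move=> m0.
have bX s : (0 <= (bw m s)%:E)%E by rewrite lee_fin bw_ge0.
transitivity (\int[leb]_s iint sG (fun u => (bw m s)%:E * ind (Xs s) u) 0)%E.
  apply: eq_integral => s _; rewrite EFinM -Nfin.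
  rewrite (iint_scalel (f := fun _ => (bw m s)%:E))//.
  - by move=> *; exact: ind_ge0.
  - exact: (jmeas_mfun s jXs).
rewrite iint_integral; last 2 first.
- by move=> s u; rewrite mule_ge0// ind_ge0.
- apply: emeasurable_funM => //.
  by apply/measurable_EFinP; exact: (measurableT_comp (measurable_bw m) measurable_fst).
apply: eq_iint_off => u y hu hy huy.
have {y hy huy}-> : y = u.
  apply/rowP => i; have [/huy//|iG] := boolP (i \in sG).
  by rewrite hu// hy.
have uK0 i : i \in sK -> u 0 i = 0 by move=> /notGK iG; rewrite hu// mxE.
have kR : k%:R != 0 :> R by rewrite pnatr_eq0 -lt0n.
have [Au|nAu] := pselect (A u); last first.
  rewrite a_zero// powR0 ?mulf_neq0 ?invr_eq0 ?pnatr_eq0 -?lt0n//.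
  by rewrite integral0_eq// => s _; rewrite ind0 ?mule0// => -[].
pose c := a u `^ k%:R^-1.
have c0 : 0 <= c by exact: powR_ge0.
have ck : c ^+ k = a u by rewrite -powR_mulrn// -powRrM mulVf// powRr1.
have -> : a u `^ (m%:R / k%:R) = c ^+ m by rewrite mulrC powRrM powR_mulrn.
rewrite -(integral_bw_itv c0 m0); apply: eq_integral => s _.
have [s0|s0] := ltP 0 s; last by rewrite /bw ltNge s0 /= !mul0e.
congr (_ * _)%E; apply: eq_ind; rewrite /Xs /= s0 -ck ler_pXn2r ?nnegrE ?(ltW s0)//.
by split => [[]|].
Qed.

(* By Brunn-Minkowski, the volumes of the superlevel sets of [a] cross those of a cone at most
   once. *)
Lemma berwald h s0 : let vG := svol sG A 0 in
  (0 < g)%N -> 0 < vG -> 0 < s0 ->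
  s0 ^+ k = svol (sG ++ sK) A 0 * 'C(g + k, g)%:R / vG ->
  (iint sG (fun u => (a u `^ ((k + h)%:R / k%:R))%:E) 0 <=
    (vG * (s0 ^+ (k + h) / 'C(g + (k + h), g)%:R))%:E)%E.
Proof.
move=> vG g0 vG0 s00 Hs0.
(* The profile of a cone over the section A_G; [s0] is fixed by requiring the same moment of order k
   as that of N, namely the volume of A_(G+K). *)
pose D s := vG * cut g s0 s.
have ID m : (0 < m)%N ->
    (\int[leb]_s (bw m s * D s)%:E = (vG * (s0 ^+ m / 'C(g + m, g)%:R))%:E)%E.
  move=> m0; rewrite EFinM -integral_bw_cut// -ge0_integralZl ?lee_fin ?(ltW vG0)//.
  - by apply: eq_integral => s _; rewrite -EFinM; congr EFin; rewrite mulrCA.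
  - apply/measurable_EFinP; apply: measurable_funM; [exact: measurable_bw|exact: measurable_cut].
  - by move=> s _; rewrite lee_fin mulr_ge0 ?bw_ge0 ?cut_ge0.
rewrite -layer ?addn_gt0 ?k0// -ID ?addn_gt0 ?k0//.
have cross s1 s2 : 0 < s1 -> s1 < s2 -> D s2 < N s2 -> D s1 <= N s1.
  move=> s10 s12 DN.
  have s20 : 0 < s2 by exact: lt_trans s12.
  (* Level s1 lies between level 0, where the superlevel set is A itself, and level s2. *)
  pose l := s1 / s2.
  have l01 : 0 < l < 1 by rewrite divr_gt0//= ltr_pdivrMr// mul1r.
  have ls : l * s2 = s1 by rewrite divfK// gt_eqF.
  have Y0 : Xs s2 0.
    have [[y [Ay ay]]|nY] := pselect (Xs s2 !=set0).
      split; first exact: A0.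
      apply: (le_trans ay); apply: svol_anti => // i.
      by have [_ bA _] := dA; rewrite mxE lexx; have /andP[] := bA _ Ay i.
    exfalso; move: DN; rewrite /N /svol iint_eq0 ?ltNge; last first.
      by move=> x' _; apply: ind0 => h'; apply: nY; exists x'.
    by rewrite mulr_ge0 ?(ltW vG0)// cut_ge0.
  pose al := vG `^ g%:R^-1.
  have al0 : 0 <= al by exact: powR_ge0.
  have alg : al ^+ g = vG.
    by rewrite -powR_mulrn// -powRrM mulVf ?pnatr_eq0 -?lt0n// powRr1// ltW.
  (* The positive part makes D a g-th power beyond [s0] too, as [g > 0]. Since [t] is convex with
     value 1 at 0, the bound from Brunn-Minkowski dominates D at s1. *)
  pose t s := Num.max 0 (1 - s / s0).
  have t0 s : 0 <= t s by rewrite le_max lexx.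
  have DE s : D s = (al * t s) ^+ g.
    rewrite /D /cut exprMn alg /t; congr (_ * _).
    have [ss|ss] := leP s s0.
      by rewrite max_r// subr_ge0 ler_pdivrMr// mul1r.
    by rewrite max_l ?expr0n ?gtn_eqF// subr_le0 ler_pdivlMr// mul1r ltW.
  have := @brunn_minkowski _ _ M l al (al * t s2) sG (Xs 0) (Xs s2) (Xs s1) l01 uG
    (dXs 0) (dXs s2) (dXs s1).
  rewrite Xs0 => /(_ A0 Y0) BM.
  have {}BM : ((1 - l) * al + l * (al * t s2)) ^+ g <= N s1.
    apply: BM => //.
    - move=> x y Ax [Ay ay]; split; first exact: cA.
      rewrite -ls exprMn; apply: le_trans (svol_slice_conv _ uK l01 Ax).
      by rewrite ler_wpM2l// exprn_ge0//; case/andP: l01 => /ltW.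
    - by rewrite mulr_ge0.
    - by rewrite alg.
    - by rewrite -DE ltW.
  apply: le_trans BM; rewrite DE lerXn2r ?nnegrE ?mulr_ge0//.
    case/andP: l01 => l0 l1; apply: addr_ge0; apply: mulr_ge0;
      rewrite ?subr_ge0 ?(ltW l0) ?(ltW l1)//.
    by rewrite mulr_ge0.
  have -> : (1 - l) * al + l * (al * t s2) = al * (1 - l + l * t s2) by ring.
  rewrite ler_wpM2l//; case/andP: l01 => l0 l1; rewrite {1}/t ge_max; apply/andP; split.
    by apply: addr_ge0; [rewrite subr_ge0 ltW|rewrite mulr_ge0// ltW].
  have : l * (1 - s2 / s0) <= l * t s2 by rewrite ler_wpM2l ?(ltW l0)// /t le_max lexx orbT.
  rewrite mulrBr mulrA ls mulr1; lra.
apply: (@crossing_le _ _ _ _ _ `|M|) => //.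
- by apply: measurable_funM => //; exact: measurable_cut.
- by move=> s; rewrite mulr_ge0 ?(ltW vG0)// cut_ge0.
- rewrite layer// ID//.
  have [_ bA _] := dA.
  transitivity (iint sG (iint sK (ind A)) 0).
    apply: eq_iint => u; rewrite divff ?pnatr_eq0 -?lt0n// powRr1//.
    by rewrite /a (svolE _ uK bA).
  rewrite -iint_cat (svolE _ uGK bA); congr EFin.
  have C0 : 'C(g + k, g)%:R != 0 :> R by rewrite pnatr_eq0 -lt0n bin_gt0 leq_addr.
  have v0 : vG != 0 by rewrite gt_eqF.
  by rewrite Hs0; field; rewrite C0 v0.
- by rewrite ID// ltry.
Qed.

End berwald.

Section loomis_whitney.
Context {R : realType} {n : nat}.
Local Notation pt := 'rV[R]_n.
Implicit Types (x y u : pt).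
Variables (M : R) (A : set pt).
Hypotheses (dA : down_set M A) (A0 : A 0).
Hypothesis cA : forall (l : R) x y, 0 < l < 1 -> A x -> A y -> A ((1 - l) *: x + l *: y).
Variables (sG sK sH : seq 'I_n).
Hypothesis uGKH : uniq (sG ++ sK ++ sH).
Let g := size sG.
Let k := size sK.
Let h := size sH.

Let uG : uniq sG. Proof. by move: uGKH; rewrite cat_uniq => /andP[]. Qed.
Let uKH : uniq (sK ++ sH). Proof. by move: uGKH; rewrite cat_uniq => /and3P[]. Qed.
Let uK : uniq sK. Proof. by move: uKH; rewrite cat_uniq => /andP[]. Qed.
Let uH : uniq sH. Proof. by move: uKH; rewrite cat_uniq => /and3P[]. Qed.
Let uGK : uniq (sG ++ sK).
Proof. by move: uGKH; rewrite catA cat_uniq => /andP[]. Qed.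
Let uGH : uniq (sG ++ sH).
Proof.
have : uniq (sG ++ (sH ++ sK)) by rewrite (perm_uniq (s2 := sG ++ (sK ++ sH)))//
  perm_cat2l perm_catC.
by rewrite catA cat_uniq => /andP[].
Qed.
Let notKH i : i \in sH -> i \notin sK.
Proof. by move: uKH; rewrite cat_uniq => /and3P[_ /hasPn hh _]; exact: hh. Qed.
Let notG i : i \in sK ++ sH -> i \notin sG.
Proof. by move: uGKH; rewrite cat_uniq => /and3P[_ /hasPn hh _]; exact: hh. Qed.

Let aK u := svol sK A u.
Let aH u := svol sH A u.
Let aK0 u : 0 <= aK u. Proof. exact: svol_ge0. Qed.
Let aH0 u : 0 <= aH u. Proof. exact: svol_ge0. Qed.

Let maa (s : seq 'I_n) (c : R) : mfun (fun u => (svol s A u `^ c)%:E).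
Proof.
have [mA _ _] := dA; apply/measurable_EFinP.
apply: (measurableT_comp (measurable_powR c)).
apply: (measurableT_comp (fine_measurable measurableT)).
by apply: mfun_iint; [exact: ind_ge0|exact: mfun_ind].
Qed.

(** Setting coordinates to zero stays in A, so the fibre over u is contained in the product of its
    sections along K and H. *)
Let fiber_le u : (forall i, i \in sK ++ sH -> u 0 i = 0) ->
  (iint (sK ++ sH) (ind A) u <= (aK u * aH u)%:E)%E.
Proof.
move=> u0; have [mA bA sA] := dA.
rewrite iint_cat mulrC EFinM -(svolE u uK bA).
rewrite -(iint_scalel (f := fun _ => (aH u)%:E))//; last 3 first.
- by move=> _; rewrite lee_fin.
- by move=> y; exact: ind_ge0.
- exact: mfun_ind.
apply: le_iint_off => [y|x' y hx hy hxy]; first by apply: iint_ge0 => z; exact: ind_ge0.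
have {x' hx hxy}-> : x' = y.
  apply/rowP => i; have [/hxy//|iK] := boolP (i \in sK).
  by rewrite hx// hy.
have yH i : i \in sH -> y 0 i = 0.
  by move=> iH; rewrite hy ?notKH// u0// mem_cat iH orbT.
have [Ay|nAy] := pselect (A y).
  rewrite ind1// mule1 (svolE y uH bA) lee_fin.
  apply: (svol_anti dA uH) => i; have /andP[y0 _] := bA _ Ay i.
  have [iK|iK] := boolP (i \in sK); first by rewrite u0 ?mem_cat ?iK// lexx.
  by rewrite -hy// y0 lexx.
rewrite iint_eq0 ?mule_ge0 ?ind_ge0 ?lee_fin// => x' hx; apply: ind0 => Ax; apply: nAy.
apply: (sA _ _ Ax) => i; have /andP[x0 _] := bA _ Ax i.
have [iH|iH] := boolP (i \in sH); first by rewrite yH// lexx.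
by rewrite -hx// x0 lexx.
Qed.

Let vA_le : ((svol (sG ++ sK ++ sH) A 0)%:E <= iint sG (fun u => (aK u * aH u)%:E) 0)%E.
Proof.
have [mA bA sA] := dA.
rewrite -(svolE 0 uGKH bA) iint_cat.
apply: le_iint_off => [y|x' y hx hy hxy]; first by apply: iint_ge0 => z; exact: ind_ge0.
have {x' hx hxy}-> : x' = y.
  apply/rowP => i; have [/hxy//|iK] := boolP (i \in sG).
  by rewrite hx// hy.
by apply: fiber_le => i /notG iG; rewrite hy// mxE.
Qed.

Let mK : mfun (fun u => (aK u)%:E).
Proof. by have := maa sK 1; rewrite /mfun; under eq_fun do rewrite /= powRr1//. Qed.
Let mH : mfun (fun u => (aH u)%:E).
Proof. by have := maa sH 1; rewrite /mfun; under eq_fun do rewrite /= powRr1//. Qed.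

Let vK_iint : iint sG (fun u => (aK u)%:E) 0 = (svol (sG ++ sK) A 0)%:E.
Proof.
have [mA bA sA] := dA; rewrite -(svolE 0 uGK bA) iint_cat.
by apply: eq_iint => u; rewrite -(svolE u uK bA).
Qed.
Let vH_iint : iint sG (fun u => (aH u)%:E) 0 = (svol (sG ++ sH) A 0)%:E.
Proof.
have [mA bA sA] := dA; rewrite -(svolE 0 uGH bA) iint_cat.
by apply: eq_iint => u; rewrite -(svolE u uH bA).
Qed.

Let bound s u : uniq s -> svol s A u <= `|M| ^+ size s.
Proof.
move=> us; have [_ bA _] := dA; rewrite -lee_fin -(svolE _ us bA); apply: iint_ind_le => // z Az i.
by have /andP[-> hh] := bA z Az i; rewrite (le_trans hh)// ler_norm.
Qed.

Let vA_zeroK : svol (sG ++ sK) A 0 = 0 -> svol (sG ++ sK ++ sH) A 0 = 0.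
Proof.
move=> v0; apply/eqP; rewrite eq_le svol_ge0 andbT -lee_fin; apply: (le_trans vA_le).
apply: (@le_trans _ _ (iint sG (fun u => (`|M| ^+ h)%:E * (aK u)%:E)%E 0)).
  apply: le_iint => u; first by rewrite lee_fin mulr_ge0.
  by rewrite -EFinM lee_fin mulrC ler_wpM2r// bound.
rewrite (iint_scalel (f := fun _ => (`|M| ^+ h)%:E))//.
  by rewrite vK_iint v0 mule0.
Qed.
Let vA_zeroH : svol (sG ++ sH) A 0 = 0 -> svol (sG ++ sK ++ sH) A 0 = 0.
Proof.
move=> v0; apply/eqP; rewrite eq_le svol_ge0 andbT -lee_fin; apply: (le_trans vA_le).
apply: (@le_trans _ _ (iint sG (fun u => (`|M| ^+ k)%:E * (aH u)%:E)%E 0)).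
  apply: le_iint => u; first by rewrite lee_fin mulr_ge0.
  by rewrite -EFinM lee_fin ler_wpM2r// bound.
rewrite (iint_scalel (f := fun _ => (`|M| ^+ k)%:E))//.
  by rewrite vH_iint v0 mule0.
Qed.

Let scale_pow (c v : R) m : 0 <= c -> 0 < v -> (0 < m)%N ->
  exists2 s : R, 0 < s & s ^+ m = v.
Proof.
move=> _ v0 m0; exists (v `^ m%:R^-1); first exact: powR_gt0.
by rewrite -powR_mulrn ?powR_ge0// -powRrM mulVf ?pnatr_eq0 -?lt0n// powRr1// ltW.
Qed.

(** The weighted inequality of the means for a / s^k and b / t^h with weights k/m and h/m, m = k +
    h. The exponents produce moments of order m of the k-th and h-th roots of the fibre volumes,
    which Berwald's inequality bounds. *)
Let amgm (a b s t : R) : (0 < k)%N -> (0 < h)%N -> 0 <= a -> 0 <= b -> 0 < s -> 0 < t ->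
  a * b <= s ^+ k * t ^+ h * (k%:R / (k + h)%:R * (a `^ ((k + h)%:R / k%:R) / s ^+ (k + h)) +
     h%:R / (k + h)%:R * (b `^ ((k + h)%:R / h%:R) / t ^+ (k + h))).
Proof.
move=> k0 h0 a0 b0 s0 t0; pose m := (k + h)%N.
have mR : m%:R != 0 :> R by rewrite pnatr_eq0 -lt0n addn_gt0 k0.
have kR : k%:R != 0 :> R by rewrite pnatr_eq0 -lt0n.
have hR : h%:R != 0 :> R by rewrite pnatr_eq0 -lt0n.
have l01 : 0 < (h%:R / m%:R : R) < 1.
  rewrite divr_gt0 ?ltr0n// ?addn_gt0 ?k0//= ltr_pdivrMr ?ltr0n ?addn_gt0 ?k0// mul1r.
  by rewrite ltr_nat /m -[ltnLHS]add0n ltn_add2r.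
have E : 1 - h%:R / m%:R = k%:R / m%:R :> R by rewrite /m natrD; field; rewrite -natrD.
have := @weighted_AMGM _ _ (a `^ (m%:R / k%:R) / s ^+ m) (b `^ (m%:R / h%:R) / t ^+ m) l01.
rewrite E => /(_ _ _)/le_trans H.
have root (x y : R) q : (0 < q)%N -> 0 <= x -> 0 < y ->
    (x `^ (m%:R / q%:R) / y ^+ m) `^ (q%:R / m%:R) = x / y ^+ q.
  move=> q0 x0 y0; have qR : q%:R != 0 :> R by rewrite pnatr_eq0 -lt0n.
  rewrite powRM ?powR_ge0 ?invr_ge0 ?exprn_ge0 ?(ltW y0)// -powRrM.
  rewrite (_ : m%:R / q%:R * _ = 1); last by field; rewrite mR qR.
  rewrite powRr1// powRV ?exprn_ge0 ?(ltW y0)// -!powR_mulrn ?(ltW y0)// -powRrM.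
  by congr (_ / (_ `^ _)); field.
rewrite !root// in H.
have {}H : a / s ^+ k * (b / t ^+ h) <= k%:R / m%:R * (a `^ (m%:R / k%:R) / s ^+ m) +
     h%:R / m%:R * (b `^ (m%:R / h%:R) / t ^+ m).
  by apply: H => //; rewrite divr_ge0 ?powR_ge0// exprn_ge0// ltW.
have st0 : 0 < s ^+ k * t ^+ h by rewrite mulr_gt0// exprn_gt0.
have -> : a * b = s ^+ k * t ^+ h * (a / s ^+ k * (b / t ^+ h)).
  by field; rewrite !gt_eqF ?exprn_gt0.
by rewrite ler_pM2l.
Qed.

(** The fibre volumes enter through a_K a_H, separated into two moments with the heights of the
    comparison cones as scales. Empty blocks and vanishing volumes are set apart, since those
    heights have to be positive. *)
Lemma loomis_whitney :
  svol (sG ++ sK ++ sH) A 0 * svol sG A 0 * 'C(g + k + h, g)%:R <=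
  'C(g + k, g)%:R * 'C(g + h, g)%:R * (svol (sG ++ sK) A 0 * svol (sG ++ sH) A 0).
Proof.
have [mA bA sA] := dA.
have RHS0 : 0 <= 'C(g + k, g)%:R * 'C(g + h, g)%:R * (svol (sG ++ sK) A 0 * svol (sG ++ sH) A 0).
  by rewrite !mulr_ge0// svol_ge0.
have [/size0nil K0|k0] := posnP k.
  rewrite /k K0 /= cats0 addn0 binn mul1r [leRHS]mulrC [svol _ _ _ * svol (sG ++ sH) _ _]mulrC.
  by [].
have [/size0nil H0|h0] := posnP h.
  by rewrite /h H0 /= !cats0 !addn0 binn mulr1 [leRHS]mulrC.
have [/size0nil G0|g0] := posnP g.
  rewrite /g G0 /= !bin0 !mulr1 mul1r.
  rewrite [X in _ * X](_ : _ = 1); last by rewrite /svol (_ : iint [::] (ind A) 0 = 1%E)//;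
    exact: ind1.
  by have := vA_le; rewrite G0 /= lee_fin mulr1.
have [G0|vG0] := eqVneq (svol sG A 0) 0; first by rewrite G0 mulr0 mul0r.
have [K0|vK0] := eqVneq (svol (sG ++ sK) A 0) 0; first by rewrite (vA_zeroK K0) !mul0r.
have [H0|vH0] := eqVneq (svol (sG ++ sH) A 0) 0; first by rewrite (vA_zeroH H0) !mul0r.
have {}vG0 : 0 < svol sG A 0 by rewrite lt_neqAle eq_sym vG0 svol_ge0.
have {}vK0 : 0 < svol (sG ++ sK) A 0 by rewrite lt_neqAle eq_sym vK0 svol_ge0.
have {}vH0 : 0 < svol (sG ++ sH) A 0 by rewrite lt_neqAle eq_sym vH0 svol_ge0.
have CK : 0 < 'C(g + k, g)%:R :> R by rewrite ltr0n bin_gt0 leq_addr.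
have CH : 0 < 'C(g + h, g)%:R :> R by rewrite ltr0n bin_gt0 leq_addr.
have CN : 0 < 'C(g + k + h, g)%:R :> R by rewrite ltr0n bin_gt0 -addnA leq_addr.
have [s s0 Hs] := @scale_pow 0 (svol (sG ++ sK) A 0 * 'C(g + k, g)%:R / svol sG A 0) k (lexx _)
  (divr_gt0 (mulr_gt0 vK0 CK) vG0) k0.
have [t t0 Ht] := @scale_pow 0 (svol (sG ++ sH) A 0 * 'C(g + h, g)%:R / svol sG A 0) h (lexx _)
  (divr_gt0 (mulr_gt0 vH0 CH) vG0) h0.
have BK := berwald dA A0 cA uGK k0 h g0 vG0 s0 Hs.
have BH := berwald dA A0 cA uGH h0 k g0 vG0 t0 Ht.
pose m := (k + h)%N.
have mgt : (0 < m)%N by rewrite addn_gt0 k0.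
pose cK : R := s ^+ k * t ^+ h * (k%:R / m%:R / s ^+ m).
pose cH : R := s ^+ k * t ^+ h * (h%:R / m%:R / t ^+ m).
have cK0 : 0 <= cK by rewrite /cK !(mulr_ge0, invr_ge0, exprn_ge0)// ltW.
have cH0 : 0 <= cH by rewrite /cH !(mulr_ge0, invr_ge0, exprn_ge0)// ltW.
pose f (b : bool) (u : pt) : \bar R :=
  if b then (cK%:E * (aK u `^ (m%:R / k%:R))%:E)%E else (cH%:E * (aH u `^ (m%:R / h%:R))%:E)%E.
have : ((svol (sG ++ sK ++ sH) A 0)%:E <= iint sG (fun u => \sum_(b <- [:: true;
  false]) f b u)%E 0)%E.
  apply: (le_trans vA_le); apply: le_iint => u; first by rewrite lee_fin mulr_ge0.
  rewrite !big_cons big_nil adde0 /f -!EFinM -EFinD lee_fin.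
  apply: (le_trans (amgm k0 h0 (aK0 u) (aH0 u) s0 t0)).
  rewrite le_eqVlt; apply/orP; left; apply/eqP; rewrite /cK /cH -/m; ring.
rewrite iint_sum; last 2 first.
- by case=> u; rewrite /f mule_ge0 ?lee_fin ?powR_ge0.
- by case; rewrite /f; apply: emeasurable_funM => //; exact: maa.
rewrite !big_cons big_nil adde0 /f.
rewrite (iint_scalel (f := fun _ => cK%:E))//; last 2 first.
- by move=> u; rewrite lee_fin powR_ge0.
- exact: maa.
rewrite (iint_scalel (f := fun _ => cH%:E))//; last 2 first.
- by move=> u; rewrite lee_fin powR_ge0.
- exact: maa.
move=> /le_trans H.
(* Both Berwald bounds are multiples of [B], by s^m and t^m; as k/m + h/m = 1, the two terms merge
   into s^k t^h B. *)
pose B : R := svol sG A 0 / 'C(g + k + h, g)%:R.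
have {}H : svol (sG ++ sK ++ sH) A 0 <= cK * (s ^+ m * B) + cH * (t ^+ m * B).
  rewrite -lee_fin; apply: H; rewrite EFinD (EFinM cK) (EFinM cH); apply: leeD.
    apply: lee_wpmul2l; first by rewrite lee_fin.
    by apply: (le_trans BK); rewrite lee_fin /B addnA mulrCA.
  apply: lee_wpmul2l; first by rewrite lee_fin.
  apply: (le_trans (_ : _ <= _)%E (_ : (svol sG A 0 * (t ^+ (h + k) /
    'C(g + (h + k), g)%:R))%:E <= _)%E).
    by rewrite /m [(k + h)%N]addnC.
  by rewrite lee_fin /B /m [(h + k)%N]addnC addnA mulrCA.
have {}H : svol (sG ++ sK ++ sH) A 0 <= s ^+ k * t ^+ h * B.
  apply: (le_trans H); rewrite le_eqVlt; apply/orP; left; apply/eqP.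
  have sm : s ^+ m != 0 by rewrite gt_eqF// exprn_gt0.
  have tm : t ^+ m != 0 by rewrite gt_eqF// exprn_gt0.
  have mR : k%:R + h%:R != 0 :> R by rewrite -natrD pnatr_eq0 -lt0n.
  by rewrite /cK /cH /m natrD -/m; field; rewrite sm tm mR.
rewrite -ler_pdivlMr// -ler_pdivlMr//; apply: (le_trans H).
rewrite Hs Ht /B le_eqVlt; apply/orP; left; apply/eqP.
by field; rewrite !gt_eqF.
Qed.

End loomis_whitney.

(** * Anti-blocking bodies and p-sums *)

Section anti_blocking_bodies.
Context {R : realType} {n : nat}.
Local Notation pt := 'rV[R]_n.
Implicit Types (x y w : pt) (A B C : set pt) (J : {set 'I_n}).

Definition restr J x : pt := \row_i (if i \in J then x 0 i else 0).

Lemma coord_subspaceP J x :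
  reflect (forall i, i \notin J -> x 0 i = 0) (x \in coord_subspace R J).
Proof.
apply: (iffP idP) => [/memv_sumP[v vJ ->] i iJ|x0].
  rewrite summxE big1// => j jJ; have /vlineP[c ->] := vJ j jJ.
  by rewrite !mxE eqxx /=; case: eqP => [ij|]; [rewrite ij jJ in iJ|rewrite mulr0].
rewrite [x]row_sum_delta (bigID (mem J))/= [X in _ + X]big1 ?addr0; last first.
  by move=> i /x0 ->; rewrite scale0r.
apply: rpred_sum => i iJ; rewrite rpredZ//.
apply: (subvP (sumv_sup i iJ (subvv _))); exact: memv_line.
Qed.

Lemma dotrow_delta x (i : 'I_n) : dotrow x (delta_mx 0 i) = x 0 i.
Proof.
rewrite /dotrow (bigD1 i)//= mxE !eqxx mulr1 big1 ?addr0// => j ji.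
by rewrite mxE eqxx (negbTE ji) mulr0.
Qed.

Lemma orth_projP J x y : is_orth_proj (coord_subspace R J) x y <-> y = restr J x.
Proof.
split=> [[/coord_subspaceP y0 xy]|->].
  apply/rowP => i; rewrite mxE; case: ifPn => [iJ|/y0//].
  have := xy (delta_mx 0 i); rewrite dotrow_delta !mxE => /(_ _)/eqP.
  rewrite subr_eq0 => H; apply/esym/eqP/H/coord_subspaceP => j jJ.
  by rewrite mxE eqxx; case: eqP => // ji; rewrite ji iJ in jJ.
split; first by apply/coord_subspaceP => i iJ; rewrite mxE (negbTE iJ).
move=> z /coord_subspaceP z0; rewrite /dotrow big1// => i _; rewrite !mxE.
by have [iJ|/z0 ->] := boolP (i \in J); rewrite ?subrr ?mul0r// mulr0.
Qed.

Lemma convex_setP A : convex_set A <->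
  (forall (l : R) x y, 0 < l < 1 -> A x -> A y -> A ((1 - l) *: x + l *: y)).
Proof.
split=> [/convex_setW cA l x y /andP[l0 l1] Ax Ay|cA].
  have l01 : 0 <= l <= 1 by rewrite !ltW.
  have := cA y x (mem_set Ay) (mem_set Ax) (Itv01 (ltW l0) (ltW l1)) l0 l1.
  by move/set_mem; rewrite addrC.
apply/convex_setW => x y /set_mem Ax /set_mem Ay l l0 l1; apply/mem_set.
have := cA l%:num y x; rewrite l0 l1 => /(_ isT Ay Ax).
by rewrite addrC.
Qed.

(** Projections provide the points with some coordinates annihilated; convex combinations with these
    provide every smaller point. Conversely, closure under shrinking puts each projection inside the
    body. *)
Lemma anti_blockingP A : anti_blocking A <->
  [/\ down_body A & forall (l : R) x y, 0 < l < 1 -> A x -> A y -> A ((1 - l) *: x + l *: y)].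
Proof.
split=> [[[[x0 Ax0] cA kA] A0 PA]|[[A0 cA pA dA] kA]]; last first.
  split => //.
    by split; [exists 0|exact: cA|exact/convex_setP].
  move=> J; apply/seteqP; split => y.
    move=> [x Ax /orth_projP ->]; split; last first.
      by apply/coord_subspaceP => i iJ; rewrite mxE (negbTE iJ).
    apply: (dA _ _ Ax) => i; have h := pA _ Ax i; rewrite mxE.
    by case: ifP => _; rewrite ?h lexx ?h.
  move=> [Ay /coord_subspaceP y0]; exists y => //; apply/orth_projP/rowP => i; rewrite mxE.
  by case: ifPn => [|/y0].
have {}kA := (convex_setP A).1 kA.
have rA J x : A x -> A (restr J x).
  move=> Ax; have : orth_proj_set (coord_subspace R J) A (restr J x).
    by exists x => //; exact/orth_projP.
  by rewrite PA => -[].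
split => //; split => //.
- suff -> : (0 : pt) = restr finset.set0 x0 by exact: rA.
  by apply/rowP => i; rewrite !mxE finset.in_set0.
- move=> x y Ax xy.
  have H (l : seq 'I_n) : A (\row_i (if i \in l then y 0 i else x 0 i)).
    elim: l => [|i l IH].
      by rewrite (_ : \row_i _ = x)//; apply/rowP => i; rewrite mxE.
    set z := \row_i _ in IH.
    have [il|il] := boolP (i \in l).
      rewrite (_ : \row_j _ = z)//; apply/rowP => j; rewrite !mxE inE.
      by case: eqP => // ->; rewrite il.
    have /andP[y0 yx] := xy i.
    have [yx'|yx'] := eqVneq (y 0 i) (x 0 i).
      rewrite (_ : \row_j _ = z)//; apply/rowP => j; rewrite !mxE inE.
      by case: eqP => // ->; rewrite (negbTE il).
    have {yx'}yx : y 0 i < x 0 i by rewrite lt_neqAle yx' yx.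
    have x_gt0 : 0 < x 0 i by exact: le_lt_trans yx.
    pose J : {set 'I_n} := [set~ i]%SET.
    have [y00|y00] := eqVneq (y 0 i) 0.
      rewrite (_ : \row_j _ = restr J z); first exact: rA.
      by apply/rowP => j; rewrite !mxE !inE; have [->|ji] := eqVneq j i; rewrite ?y00.
    have yi0 : 0 < y 0 i by rewrite lt_neqAle eq_sym y00.
    (* Coordinate [i] is lowered from x_i to y_i by mixing z, with weight t, and its projection
       along e_i. *)
    pose t := y 0 i / x 0 i.
    have t01 : 0 < t < 1 by rewrite divr_gt0//= ltr_pdivrMr// mul1r.
    rewrite (_ : \row_j _ = (1 - t) *: restr J z + t *: z); first by apply: kA => //; exact: rA.
    apply/rowP => j; rewrite !mxE !inE; have [->|ji] := eqVneq j i.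
      by rewrite (negbTE il) /= mulr0 add0r /t divfK// gt_eqF.
    by rewrite /= -mulrDl subrK mul1r.
  have := H (enum 'I_n); rewrite (_ : \row_i _ = y)//.
  by apply/rowP => i; rewrite mxE mem_enum.
Qed.

Lemma down_body_bounded A : down_body A -> exists2 M, 0 <= M & down_set M A.
Proof.
move=> [A0 cA pA dA]; have [M [_ HM]] := compact_bounded cA.
exists (`|M| + 1); first by rewrite addr_ge0.
split => //; first exact: compact_mset.
move=> x Ax i; rewrite pA//=.
have := HM (`|M| + 1); rewrite (le_lt_trans (ler_norm M)) ?ltrDl// => /(_ isT x Ax).
apply: le_trans; rewrite -[leLHS]ger0_norm ?pA//.
rewrite [leRHS]mx_normrE.
by apply: (le_trans _ (le_bigmax _ _ (ord0, i))).
Qed.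

End anti_blocking_bodies.

Section lp_sums.
Context {R : realType} {n : nat}.
Local Notation pt := 'rV[R]_n.
Implicit Types (x y w : pt) (A B C K L : set pt).

Definition fam (T : Type) (a b c : T) (k : 'I_3) : T :=
  if k == col0 then a else if k == col1 then b else c.

Lemma down_body0 : down_body ([set 0] : set pt).
Proof.
split => //.
- exact: compact_set1.
- by move=> x -> i; rewrite mxE.
- move=> x y -> h; apply/rowP => i; have := h i; rewrite !mxE => h'.
  by apply/eqP; rewrite eq_le andbC.
Qed.

Lemma down_family_psum r (F : 'I_3 -> set pt) : 0 <= r -> (forall k, down_body (F k)) ->
  down_family (psum r F).
Proof.
move=> r0 gF; split => [X [tau [t0 t1 tX]] k i|X Y [tau [t0 t1 tX]] YX].
  have [a Fa ->] := tX k; have [_ _ pF _] := gF k.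
  by rewrite mxE mulr_ge0 ?powR_ge0 ?(pF _ Fa).
exists tau; split => // k; have [a Fa XE] := tX k; have [_ _ pF dF] := gF k.
have [t00|tn0] := eqVneq (tau k `^ r) 0.
  exists a => //; rewrite t00 scale0r; apply/rowP => i; have := YX k i.
  by rewrite XE t00 scale0r mxE => h; apply/eqP; rewrite eq_le andbC.
have tgt : 0 < tau k `^ r by rewrite lt_neqAle eq_sym tn0 powR_ge0.
exists ((tau k `^ r)^-1 *: Y k); last by rewrite scalerA mulfV// scale1r.
apply: (dF _ _ Fa) => i; have := YX k i; rewrite XE !mxE => /andP[h1 h2].
by rewrite mulr_ge0 ?invr_ge0 ?(ltW tgt)//= mulrC ler_pdivrMr// mulrC.
Qed.

Lemma down_body_scale (A : set pt) c x : down_body A -> 0 <= c <= 1 -> A x -> A (c *: x).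
Proof.
move=> [_ _ pA dA] /andP[c0 c1] Ax; apply: (dA _ _ Ax) => i.
by have h := pA _ Ax i; rewrite mxE mulr_ge0//= ler_piMl.
Qed.

Lemma powR_le1 (t r : R) : 0 <= r -> 0 <= t <= 1 -> 0 <= t `^ r <= 1.
Proof.
move=> r0 /andP[t0 t1]; rewrite powR_ge0/=.
have := @ge0_ler_powR R r r0 t 1; rewrite !nnegrE t0 ler01 powR1.
by apply.
Qed.

Lemma psum_le r (F : 'I_3 -> set pt) M X : 0 <= r -> 0 <= M ->
  (forall k, down_set M (F k)) -> psum r F X -> forall k i, X k 0 i <= M.
Proof.
move=> r0 M0 bF [tau [t0 t1 tX]] k i; have [a Fa ->] := tX k.
have [_ bFk _] := bF k; have /andP[a0 aM] := bFk _ Fa i.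
rewrite mxE (le_trans _ aM)// ler_piMl//.
have : 0 <= tau k <= 1 by rewrite t0 -t1 (bigD1 k)//= lerDl sumr_ge0.
by move=> /(powR_le1 r0)/andP[].
Qed.

(** One formula covers all p >= 1: at p = 1 the exponent is 0 and every power equals 1, including
    0^0. *)
Lemma lp_sumE (p : R) K L : 1 <= p ->
  lp_sum p K L = [set z | exists x y (t : R), [/\ K x, L y, 0 <= t <= 1 &
      z = (1 - t) `^ (1 - p^-1) *: x + t `^ (1 - p^-1) *: y]].
Proof.
move=> p1; rewrite /lp_sum; case: eqVneq => [->|pn1].
  rewrite invr1 subrr; apply/seteqP; split => z /=.
    move=> [x Kx [y Ly <-]]; exists x, y, 0; split => //; first by rewrite lexx ler01.
    by rewrite !powRr0 !scale1r.
  move=> [x [y [t [Kx Ly _ ->]]]]; exists x => //; exists y => //.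
  by rewrite !powRr0 !scale1r.
have -> : fine (hoelder_conjugate p%:E)^-1%E = 1 - p^-1 :> R; last by [].
have p0 : p%:E != 0%E :> \bar R by rewrite eqe gt_eqF// (lt_le_trans ltr01).
have := @hoelder_conjugate_eq1 R p%:E (ltNyr _) p0.
rewrite inver gt_eqF ?(lt_le_trans ltr01)//.
case: (_^-1)%E => [s||] //= /eqP; rewrite -EFinD eqe => /eqP h.
by lra.
Qed.

Section parameters.
Variables (p : R) (p1 : 1 <= p).
Let r : R := 1 - p^-1.

Let r0 : 0 <= r.
Proof. by rewrite /r subr_ge0 invf_le1// (lt_le_trans ltr01). Qed.

Lemma col_ind (P : 'I_3 -> Prop) : P col0 -> P col1 -> P col2 -> forall k, P k.
Proof.
move=> P0 P1 P2 [[|[|[|//]]] h].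
- by rewrite (_ : Ordinal h = col0)//; exact: val_inj.
- by rewrite (_ : Ordinal h = col1)//; exact: val_inj.
- by rewrite (_ : Ordinal h = col2)//; exact: val_inj.
Qed.

Lemma sum_col (V : zmodType) (f : 'I_3 -> V) : \sum_k f k = f col0 + f col1 + f col2.
Proof. by rewrite !big_ord_recl big_ord0 addr0 addrA. Qed.

Lemma sect_NoneP (F : 'I_3 -> set pt) w : sect (psum r F) (fun _ => None) w <->
  exists tau0 tau1 tau2 a b c, [/\ [/\ 0 <= tau0, 0 <= tau1, 0 <= tau2 & tau0 + tau1 + tau2 = 1],
   F col0 a, F col1 b, F col2 c &
   w = tau0 `^ r *: a - tau1 `^ r *: b - tau2 `^ r *: c].
Proof.
split=> [[X [tau [t0 t1 tX]] wX]|[t0 [t1 [t2 [a [b [c [[h0 h1 h2 h3] Fa Fb Fc ->]]]]]]]].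
  have [a Fa aE] := tX col0; have [b Fb bE] := tX col1; have [c Fc cE] := tX col2.
  exists (tau col0), (tau col1), (tau col2), a, b, c; split => //.
    by split => //; rewrite -t1 sum_col.
  apply/rowP => i; rewrite (wX i).1 sum_col aE bE cE !mxE /mask /=; ring.
exists (fam (t0 `^ r *: a) (t1 `^ r *: b) (t2 `^ r *: c)).
  exists (fam t0 t1 t2); split.
  - by apply: col_ind.
  - by rewrite sum_col.
  - by apply: col_ind; [exists a|exists b|exists c].
move=> i; split => //; rewrite sum_col /mask /fam /= !mxE; ring.
Qed.

(** The weight placed on [[set 0]] is lost; the other two, of total s <= 1, are renormalised and
    both points are shrunk by s^r. *)
Lemma lp_sum2 A B : down_body A -> down_body B ->
  lp_sum p A (neg_set B) = sect (psum r (fam A B [set 0])) (fun _ => None).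
Proof.
move=> gA gB; rewrite lp_sumE//; apply/seteqP; split => w /=.
  move=> [a [_ [t [Aa [b Bb <-] /andP[t0 t1] ->]]]]; apply/sect_NoneP.
  exists (1 - t), t, 0, a, b, 0; split => //.
    by split; rewrite ?subr_ge0// addr0 subrK.
  by rewrite scaler0 subr0 scalerN.
move=> /sect_NoneP[t0 [t1 [t2 [a [b [c [[h0 h1 h2 h3] Aa Bb ->]]]]]]].
move=> ->; rewrite /fam /= in Aa Bb; rewrite scaler0 subr0.
pose s := t0 + t1; have s01 : 0 <= s <= 1 by rewrite /s addr_ge0//= -h3 lerDl.
have /andP[s0 s1] := s01.
exists (s `^ r *: a), (- (s `^ r *: b)), (if s == 0 then 0 else t1 / s); split.
- by apply: down_body_scale => //; exact: powR_le1.
- by exists (s `^ r *: b) => //; apply: down_body_scale => //; exact: powR_le1.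
- case: eqVneq => [_|sn0]; first by rewrite lexx ler01.
  have sgt : 0 < s by rewrite lt_neqAle eq_sym sn0.
  by rewrite divr_ge0//= ler_pdivrMr// mul1r /s lerDr.
rewrite scalerN !scalerA; case: eqVneq => [s00|sn0].
  have /eqP := s00; rewrite /s paddr_eq0// => /andP[/eqP -> /eqP ->].
  rewrite -/r addr0 subr0 powR1 mul1r; congr (_ - _ *: _).
  have [->|rn0] := eqVneq r 0; first by rewrite powRr0 mulr1.
  by rewrite powR0// mulr0.
have sgt : 0 < s by rewrite lt_neqAle eq_sym sn0.
rewrite -!powRM ?divr_ge0//; last first.
  by rewrite subr_ge0 ler_pdivrMr// mul1r /s lerDr.
rewrite divfK// mulrBl mul1r divfK//.
by rewrite /s addrK.
Qed.

(** Nested binary weights multiply to weights of total 1; conversely the inner weight is t1 / (1 -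
    t2), with an arbitrary value when the last summand takes all the weight. *)
Lemma lp_sum3 A B C : down_body A -> down_body B -> down_body C ->
  lp_sum p (lp_sum p A (neg_set B)) (neg_set C) =
  sect (psum r (fam A B C)) (fun _ => None).
Proof.
move=> gA gB gC; rewrite !lp_sumE//; apply/seteqP; split => w /=.
  move=> [_ [_ [s [[a [_ [t [Aa [b Bb <-] /andP[t0 t1] ->]]]] [c Cc <-] /andP[s0 s1] ->]]]].
  apply/sect_NoneP.
  exists ((1 - s) * (1 - t)), ((1 - s) * t), s, a, b, c; split => //.
    split; rewrite ?mulr_ge0 ?subr_ge0//; ring.
  by rewrite !powRM ?subr_ge0// !scalerN scalerDr scalerN !scalerA.
move=> /sect_NoneP[t0 [t1 [t2 [a [b [c [[h0 h1 h2 h3] Aa Bb Cc ->]]]]]]].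
rewrite /fam /= in Aa Bb Cc.
have t21 : t2 <= 1 by rewrite -h3 lerDr addr_ge0.
have s1 : 1 - t2 = t0 + t1 by rewrite -h3 addrK.
pose t := if 1 - t2 == 0 then 0 else t1 / (1 - t2).
exists ((1 - t) `^ r *: a + t `^ r *: - b), (- c), t2; split => //; [|by exists c|by rewrite h2|].
- exists a, (- b), t; split => //; first by exists b.
  rewrite /t; case: eqVneq => [_|sn0]; first by rewrite lexx ler01.
  have sgt : 0 < 1 - t2 by rewrite lt_neqAle eq_sym sn0 subr_ge0.
  by rewrite divr_ge0 ?(ltW sgt)//= ler_pdivrMr// mul1r s1 lerDr.
rewrite scalerDr !scalerN !scalerA; congr (_ - _); rewrite /t.
case: eqVneq => [s00|sn0].
  have : t0 + t1 == 0 by rewrite -s1 s00.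
  rewrite paddr_eq0// => /andP[/eqP -> /eqP ->].
  rewrite -/r s00 subr0 powR1 mulr1; congr (_ - _ *: _).
  have [->|rn0] := eqVneq r 0; first by rewrite powRr0 mulr1.
  by rewrite powR0// mulr0.
have sgt : 0 < 1 - t2 by rewrite lt_neqAle eq_sym sn0 subr_ge0.
rewrite -!powRM ?divr_ge0 ?(ltW sgt)//; last first.
  by rewrite subr_ge0 ler_pdivrMr// mul1r s1 lerDr.
rewrite [_ * (t1 / _)]mulrC divfK// mulrBr mulr1 [_ * (t1 / _)]mulrC divfK//.
by rewrite s1 addrK.
Qed.

End parameters.
End lp_sums.

(** * The upper bound *)

Section svol_facts.
Context {R : realType} {n : nat}.
Local Notation pt := 'rV[R]_n.
Implicit Types (s : seq 'I_n) (X : set pt).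

Lemma svol_perm s1 s2 X x : mset X -> perm_eq s1 s2 -> svol s1 X x = svol s2 X x.
Proof.
move=> mX s12; congr fine; apply: iint_perm => //; last exact: mfun_ind.
by move=> y; exact: ind_ge0.
Qed.

Lemma svol_nil X : X 0 -> svol [::] X 0 = 1.
Proof. by move=> X0; rewrite /svol (_ : iint _ _ _ = 1%E)//; exact: ind1. Qed.

Lemma svol_set0 s : uniq s -> s != [::] -> svol s [set (0 : pt)] 0 = 0.
Proof.
move=> us sn0; apply/eqP; rewrite eq_le svol_ge0 andbT -lee_fin.
have b0 (x : pt) : [set 0] x -> forall i, 0 <= x 0 i <= 0.
  by move=> -> i; rewrite mxE lexx.
rewrite -(svolE _ us b0); apply: le_trans (iint_ind_le _ _ us b0) _ => //.
by case: s sn0 {us} => //= i s _; rewrite expr0n.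
Qed.

Lemma cidx_uniq (d : 'I_n -> 'I_3) k : uniq (cidx d k).
Proof. by rewrite filter_uniq ?enum_uniq. Qed.

Lemma mem_cidx (d : 'I_n -> 'I_3) k i : (i \in cidx d k) = (d i == k).
Proof. by rewrite mem_filter mem_enum andbT. Qed.

Lemma cidx_perm (d : 'I_n -> 'I_3) :
  perm_eq (cidx d col0 ++ cidx d col2 ++ cidx d col1) (enum 'I_n).
Proof.
apply: uniq_perm; [|exact: enum_uniq|].
  rewrite !cat_uniq !cidx_uniq/= andbT.
  apply/andP; split; apply/hasPn => i; rewrite ?mem_cat !mem_cidx.
    by move=> /orP[] /eqP ->.
  by move=> /eqP ->.
move=> i; rewrite !mem_cat !mem_cidx mem_enum inE.
by move: (d i); apply: col_ind.
Qed.

Lemma cidx_pi1 (d : 'I_n -> 'I_3) :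
  [/\ perm_eq (cidx (pi1 \o d) col0) (cidx d col0 ++ cidx d col2),
      cidx (pi1 \o d) col1 = cidx d col1 & cidx (pi1 \o d) col2 = [::]].
Proof.
split.
- apply: uniq_perm; first exact: cidx_uniq.
    rewrite cat_uniq !cidx_uniq/= andbT.
    by apply/hasPn => i; rewrite !mem_cidx => /eqP ->.
  move=> i; rewrite mem_cat !mem_cidx /=.
  by move: (d i); apply: col_ind.
- apply: eq_filter => i /=; by move: (d i); apply: col_ind.
- rewrite /cidx (@eq_filter _ _ pred0) ?filter_pred0// => i /=.
  by move: (d i); apply: col_ind.
Qed.

Lemma cidx_pi2 (d : 'I_n -> 'I_3) :
  [/\ perm_eq (cidx (pi2 \o d) col0) (cidx d col0 ++ cidx d col1),
      cidx (pi2 \o d) col1 = cidx d col2 & cidx (pi2 \o d) col2 = [::]].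
Proof.
split.
- apply: uniq_perm; first exact: cidx_uniq.
    rewrite cat_uniq !cidx_uniq/= andbT.
    by apply/hasPn => i; rewrite !mem_cidx => /eqP ->.
  move=> i; rewrite mem_cat !mem_cidx /=.
  by move: (d i); apply: col_ind.
- apply: eq_filter => i /=; by move: (d i); apply: col_ind.
- rewrite /cidx (@eq_filter _ _ pred0) ?filter_pred0// => i /=.
  by move: (d i); apply: col_ind.
Qed.

End svol_facts.

Lemma prod_col (V : pzSemiRingType) (f : 'I_3 -> V) :
  \prod_(k <- [:: col0; col1; col2]) f k = f col0 * (f col1 * f col2).
Proof. by rewrite !big_cons big_nil mulr1. Qed.

Section leaves.
Context {R : realType} {n : nat}.
Local Notation pt := 'rV[R]_n.
Implicit Types (A B C X : set pt) (F : 'I_3 -> set pt) (d : 'I_n -> 'I_3).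
Variables (r : R) (r0 : 0 <= r).

Definition gam (m : nat) : R := Gamma (1 + m%:R * r).

Lemma gam_gt0 m : 0 < gam m.
Proof. by apply: Gamma_gt0; rewrite mulr_ge0. Qed.

Lemma gam0 : gam 0 = 1.
Proof.
rewrite /gam mul0r GammaE /Gam.
have := @expm_tail R setT 0 (lexx _); rewrite oppr0 expR0.
move=> /(_ (fun _ _ => I)) /(_ (fun t h _ => ltW h)) E.
rewrite (_ : integral _ _ _ = 1%E)// -E; apply: eq_integral => t _.
by rewrite powRr0 ind1.
Qed.

(** The volume of the section of colouring [d], as [volume_sect] gives it. *)
Definition leaf F d : R :=
  (\prod_(k <- [:: col0; col1; col2]) (svol (cidx d k) (F k) 0 * gam (size (cidx d k)))) / gam n.

Lemma leafE F d : (forall k, down_body (F k)) -> fine (cvol (psum r F) (Some \o d)) = leaf F d.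
Proof.
move=> gF; have gn := gam_gt0 n.
have := volume_sect r0 gF d; rewrite (Gam_Gamma (mulr_ge0 _ r0))// -/(gam n).
rewrite (eq_bigr (fun k => (svol (cidx d k) (F k) 0 * gam (size (cidx d k)))%:E)); last first.
  move=> k _; rewrite (Gam_Gamma (mulr_ge0 _ r0))// -/(gam _) EFinM.
  have [M _ [_ bF _]] := down_body_bounded (gF k).
  by rewrite (svolE _ (cidx_uniq d k) bF).
rewrite prodEFin /leaf /cvol; set P := \prod_(k <- _) _.
(* An infinite volume would contradict the finite product on the other side. *)
case: volume => [v||] /=.
- by rewrite -EFinM => -[<-]; rewrite mulfK// gt_eqF.
- by rewrite mulyr gtr0_sg// mul1e.
- by rewrite mulNyr gtr0_sg// mul1e.
Qed.

Lemma leaf_ge0 F d : 0 <= leaf F d.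
Proof.
rewrite divr_ge0 ?(ltW (gam_gt0 _))//.
by rewrite prodr_ge0// => k _; rewrite mulr_ge0 ?svol_ge0// ltW ?gam_gt0.
Qed.

Lemma leaf3E F d : leaf F d =
  svol (cidx d col0) (F col0) 0 * gam (size (cidx d col0)) *
  (svol (cidx d col1) (F col1) 0 * gam (size (cidx d col1)) *
   (svol (cidx d col2) (F col2) 0 * gam (size (cidx d col2)))) / gam n.
Proof. by rewrite /leaf prod_col. Qed.

Lemma leaf2E F d : cidx d col2 = [::] -> F col2 0 -> leaf F d =
  svol (cidx d col0) (F col0) 0 * gam (size (cidx d col0)) *
  (svol (cidx d col1) (F col1) 0 * gam (size (cidx d col1))) / gam n.
Proof.
have E (a b c z : R) : z = 1 -> a * (b * z) / c = a * b / c by move=> ->; rewrite mulr1.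
move=> c2 F0; rewrite leaf3E; apply: E.
by rewrite c2 svol_nil// gam0 mulr1.
Qed.

Lemma leaf_eq0 F d k : svol (cidx d k) (F k) 0 = 0 -> leaf F d = 0.
Proof.
move=> h; suff E : \prod_(k <- [:: col0; col1; col2])
    (svol (cidx d k) (F k) 0 * gam (size (cidx d k))) = 0 by rewrite /leaf E mul0r.
apply/eqP; rewrite prodf_seq_eq0; apply/hasP; exists k; last by rewrite h mul0r eqxx.
by move: (k); apply: col_ind.
Qed.

(** The volumes and Gamma factors of the blocks of B and C occur equally on both sides. What remains
    is the local Loomis-Whitney inequality for A, with K the block of C and H that of B, multiplied
    by the Gamma factors. *)
Lemma leaf_le A B C d (b : R) : down_body A -> 
  (forall (l : R) x y, 0 < l < 1 -> A x -> A y -> A ((1 - l) *: x + l *: y)) ->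
  (forall g k h, (g + k + h)%N = n ->
    dn2 R n (g + k) (g + h) * (gam g * gam n / (gam (g + k) * gam (g + h))) <= b) ->
  svol (enum 'I_n) A 0 * leaf (fam A B C) d <=
  b * (leaf (fam A B [set 0]) (pi1 \o d) * leaf (fam A C [set 0]) (pi2 \o d)).
Proof.
move=> gA cA Hb; have [M M0 dA] := down_body_bounded gA; have [A0 _ _ _] := gA.
have [mA _ _] := dA.
have [p0 p1 p2] := cidx_pi1 d; have [q0 q1 q2] := cidx_pi2 d.
rewrite leaf3E !leaf2E// /fam /= p1 q1.
rewrite (svol_perm 0 mA p0) (svol_perm 0 mA q0) (perm_size p0) (perm_size q0) !size_cat.
rewrite -(svol_perm 0 mA (cidx_perm d)).
have uGKH : uniq (cidx d col0 ++ cidx d col2 ++ cidx d col1).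
  by rewrite (perm_uniq (cidx_perm d)) enum_uniq.
have := loomis_whitney dA A0 cA uGKH.
have szn : (size (cidx d col0) + size (cidx d col2) + size (cidx d col1))%N = n.
  by have := perm_size (cidx_perm d); rewrite !size_cat size_enum_ord addnA.
have := Hb _ _ _ szn; rewrite szn.
have := svol_ge0 (cidx d col0 ++ cidx d col2) A 0.
have := svol_ge0 (cidx d col0 ++ cidx d col1) A 0.
have := svol_ge0 (cidx d col1) B 0; have := svol_ge0 (cidx d col2) C 0.
set g := size (cidx d col0) in szn *; set k := size (cidx d col2) in szn *.
set h := size (cidx d col1) in szn *.
rewrite /dn2 (_ : (g + k + (g + h) - n = g)%N); last by rewrite -szn; lia.
have Cg : 0 < 'C(n, g)%:R :> R by rewrite ltr0n bin_gt0 -szn -addnA leq_addr.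
rewrite natrM.
move: (svol (cidx d col0 ++ cidx d col2 ++ cidx d col1) A 0) => V.
move: (svol (cidx d col0) A 0) => vG.
move: (svol (cidx d col0 ++ cidx d col2) A 0) => vGK.
move: (svol (cidx d col0 ++ cidx d col1) A 0) => vGH.
move: (svol (cidx d col1) B 0) (svol (cidx d col2) C 0) => vB vC.
move: Cg; move: ('C(n, g)%:R : R) => c.
move: ('C(g + k, g)%:R : R) => c1; move: ('C(g + h, g)%:R : R) => c2 c0.
have := gam_gt0 g; have := gam_gt0 k; have := gam_gt0 h; have := gam_gt0 n.
have := gam_gt0 (g + k); have := gam_gt0 (g + h).
move: (gam g) (gam h) (gam k) (gam n) (gam (g + k)) (gam (g + h)).
move=> Gg Gh Gk Gn Ggk Ggh a1 a2 a3 a4 a5 a6 C0 B0 b1 b2 Hb' LW.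
have H1 : V * vG * Gg * Gn <= b * (vGK * vGH) * (Ggk * Ggh).
  have h1 : V * vG <= c1 * c2 / c * (vGK * vGH).
    by rewrite [leRHS]mulrAC ler_pdivlMr.
  have h2 : c1 * c2 / c * (Gg * Gn) <= b * (Ggk * Ggh).
    by rewrite -ler_pdivrMr ?mulr_gt0// -[leLHS]mulrA.
  apply: (@le_trans _ _ (c1 * c2 / c * (vGK * vGH) * (Gg * Gn))).
    by rewrite -[leLHS]mulrA ler_wpM2r// mulr_ge0// ltW.
  rewrite [leLHS](_ : _ = (c1 * c2 / c * (Gg * Gn)) * (vGK * vGH)); last by ring.
  rewrite [leRHS](_ : _ = (b * (Ggk * Ggh)) * (vGK * vGH)); last by ring.
  by rewrite ler_wpM2r// mulr_ge0.
have -> : V * (vG * Gg * (vB * Gh * (vC * Gk)) / Gn) =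
  V * vG * Gg * Gn * (vB * Gh * (vC * Gk) / (Gn * Gn)).
  by field; rewrite gt_eqF.
have -> : b * (vGK * Ggk * (vB * Gh) / Gn * (vGH * Ggh * (vC * Gk) / Gn)) =
  b * (vGK * vGH) * (Ggk * Ggh) * (vB * Gh * (vC * Gk) / (Gn * Gn)).
  by field; rewrite gt_eqF.
by rewrite ler_wpM2r// divr_ge0// ?mulr_ge0// ltW.
Qed.

End leaves.

Section sum_volumes.
Context {R : realType} {n : nat}.
Local Notation pt := 'rV[R]_n.
Implicit Types (A B C : set pt) (F : 'I_3 -> set pt) (d : 'I_n -> 'I_3).
Variables (r : R) (r0 : 0 <= r).

Definition wvol F : R := fine (cvol (psum r F) (fun _ => None)).

Lemma psum_regular F : (forall k, down_body (F k)) -> exists M : R,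
  [/\ down_family (psum r F), forall X, psum r F X -> forall k i, X k 0 i <= M
    & forall c, mset (sect (psum r F) c)].
Proof.
move=> gF; have [m Hm] : {m : 'I_3 -> R & forall k, 0 <= m k /\ down_set (m k) (F k)}.
  apply: (@boolp.choice _ R (fun k M => 0 <= M /\ down_set M (F k))) => k;
    have [M M0 dM] := down_body_bounded (gF k).
  by exists M.
exists (\sum_k m k); split.
- exact: down_family_psum.
- move=> X; apply: psum_le => //; first by rewrite sumr_ge0// => k _; have [] := Hm k.
  move=> k; have [_ h] := Hm k; apply: down_set_le h.
  by rewrite (bigD1 k)//= lerDl sumr_ge0// => j _; have [] := Hm j.
- move=> c; apply: compact_mset; apply: compact_sect => // k.
  by have [] := gF k.
Qed.

Lemma pc_enum d : pc (enum 'I_n) d = fun _ => None.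
Proof. by apply/funext => i; rewrite /pc mem_enum. Qed.

Variables (F : 'I_3 -> set pt) (gF : forall k, down_body (F k)).

Lemma wvolE : volume (sect (psum r F) (fun _ => None)) = (wvol F)%:E.
Proof.
have [M [h1 h2 h3]] := psum_regular gF.
have /andP[v0 v1] := cvol_fin h1 h2 (fun _ => None).
by rewrite /wvol -/(cvol _ _) fineK// ge0_fin_numE.
Qed.

Lemma wvol_le_ctree d : wvol F <= ctree [:: col0; col1; col2] (enum 'I_n) (leaf r F) d.
Proof.
have [M [h1 h2 h3]] := psum_regular gF.
have := cvol_le_ctree h1 h2 h3 d (enum_uniq 'I_n); rewrite pc_enum.
congr (_ <= _); congr ctree; apply/funext => d'; exact: leafE.
Qed.

Lemma ctree_le_wvol d : ctree [:: col0; col1] (enum 'I_n) (leaf r F) d <= wvol F.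
Proof.
have [M [h1 h2 h3]] := psum_regular gF.
have := ctree_le_cvol h1 h2 h3 d (enum_uniq 'I_n); rewrite pc_enum.
congr (_ <= _); congr ctree; apply/funext => d'; exact: leafE.
Qed.

Lemma leaf_le_wvol d : leaf r F d <= wvol F.
Proof.
have [M [h1 h2 h3]] := psum_regular gF.
have := cvol_Some_le h1 h2 h3 d (enum_uniq 'I_n); rewrite pc_enum.
by rewrite leafE.
Qed.

Lemma wvol_ge0 : 0 <= wvol F.
Proof. by apply: le_trans (leaf_le_wvol (fun _ => col0)); exact: leaf_ge0. Qed.

End sum_volumes.

Lemma fam_down_body {R : realType} {n : nat} (A B C : set 'rV[R]_n) :
  down_body A -> down_body B -> down_body C -> forall k, down_body (fam A B C k).
Proof. by move=> ? ? ?; apply: col_ind. Qed.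

Lemma volume_svol {R : realType} {n : nat} (A : set 'rV[R]_n) : down_body A ->
  volume A = (svol (enum 'I_n) A 0)%:E.
Proof.
move=> gA; have [M _ [_ bA _]] := down_body_bounded gA.
by rewrite (volume_iint _ 0) (svolE _ (enum_uniq _) bA).
Qed.

Section bound.
Context {R : realType} {n : nat}.
Variables (p : R) (p1 : 1 <= p).
Let r : R := 1 - p^-1.

Let r0 : 0 <= r.
Proof. by rewrite /r subr_ge0 invf_le1// (lt_le_trans ltr01). Qed.

Lemma volume_boundE b : volume_bound n p b <-> forall A B C : set 'rV[R]_n,
  anti_blocking A -> anti_blocking B -> anti_blocking C ->
  svol (enum 'I_n) A 0 * wvol r (fam A B C) <=
    b * wvol r (fam A B [set 0]) * wvol r (fam A C [set 0]).
Proof.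
have E A B C : anti_blocking A -> anti_blocking B -> anti_blocking C ->
  ((volume A * volume (lp_sum p (lp_sum p A (neg_set B)) (neg_set C)) <=
     b%:E * volume (lp_sum p A (neg_set B)) * volume (lp_sum p A (neg_set C)))%E =
   (svol (enum 'I_n) A 0 * wvol r (fam A B C) <=
    b * wvol r (fam A B [set 0]) * wvol r (fam A C [set 0]))).
  move=> /anti_blockingP[gA _] /anti_blockingP[gB _] /anti_blockingP[gC _].
  have g0 := @down_body0 R n.
  rewrite lp_sum3// !lp_sum2// -/r volume_svol// !wvolE//; try exact: fam_down_body.
split=> H A B C aA aB aC; have := H A B C aA aB aC; by rewrite E.
Qed.

Lemma upper_bound b : 0 <= b -> (forall g k h, (g + k + h)%N = n ->
    dn2 R n (g + k) (g + h) * (gam r g * gam r n / (gam r (g + k) * gam r (g + h))) <= b) ->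
  volume_bound n p b.
Proof.
move=> b0 Hb; apply/volume_boundE => A B C.
move=> /anti_blockingP[gA cA] /anti_blockingP[gB _] /anti_blockingP[gC _].
have g0 := @down_body0 R n.
have gAB := fam_down_body gA gB g0; have gAC := fam_down_body gA gC g0.
have gABC := fam_down_body gA gB gC.
set V := svol _ _ _; have V0 : 0 <= V by exact: svol_ge0.
have w1 := wvol_ge0 r0 gAB; have w2 := wvol_ge0 r0 gAC.
(* The trees are compared with the constant b / V, so V = 0 is set apart. *)
have [VE|Vn0] := eqVneq V 0; first by rewrite VE mul0r; do 2 apply: mulr_ge0 => //.
have Vgt : 0 < V by rewrite lt_neqAle eq_sym Vn0.
rewrite mulrC -ler_pdivlMr// mulrAC -mulrA mulrAC -mulrA.
(* Only a starting point, as every coordinate is recoloured. *)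
pose d (_ : 'I_n) := col0.
apply: le_trans (wvol_le_ctree r0 gABC d) _.
apply: (@le_trans _ _ (b / V * (ctree [:: col0;
  col1] (enum 'I_n) (leaf r (fam A B [set 0])) (pi1 \o d) *
   ctree [:: col0; col1] (enum 'I_n) (leaf r (fam A C [set 0])) (pi2 \o d)))).
  apply: ctree_mul; [by rewrite divr_ge0|exact: leaf_ge0|exact: leaf_ge0|].
  have G (u v : R) : V * u <= b * v -> u <= b / V * v.
    by move=> uv; rewrite mulrAC ler_pdivlMr// mulrC.
  by move=> d'; apply: G; exact: leaf_le.
rewrite -mulrA; apply: ler_wpM2l => //.
rewrite -[leRHS]mulrA [X in _ <= _ * X]mulrC; apply: ler_wpM2l; first by rewrite invr_ge0.
by apply: ler_pM; try (apply: ctree_ge0 => ?; exact: leaf_ge0); exact: ctree_le_wvol.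
Qed.

End bound.

(** * Extremal bodies *)

Lemma continuous_sumR {R : realType} (T : topologicalType) m (F : T -> 'I_m -> R) :
  (forall k, continuous (F^~ k)) -> continuous (fun p => \sum_k F p k).
Proof.
move=> cF p; apply: cvg_big => //=; first exact: add_continuous.
by move=> k _; exact: cF.
Qed.

Section polytopes.
Context {R : realType} {n : nat}.
Local Notation pt := 'rV[R]_n.
Local Notation leb := (@lebesgue_measure R).
Implicit Types (a : 'I_n -> 'I_n -> R) (c b : 'I_n -> R).

Definition poly a c : set pt :=
  [set x | (forall i, 0 <= x 0 i) /\ forall j, \sum_i a j i * x 0 i <= c j].

Lemma poly_le a c x i : (forall j i, 0 <= a j i) -> (forall i, a i i = 1) ->
  poly a c x -> x 0 i <= c i.
Proof.
move=> a0 a1 [x0 xc]; apply: le_trans (xc i).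
by rewrite (bigD1 i)//= a1 mul1r lerDl sumr_ge0// => j _; rewrite mulr_ge0.
Qed.

Lemma closed_poly a c : closed (poly a c).
Proof.
have -> : poly a c = (\bigcap_i [set x : pt | 0 <= x 0 i]) `&`
    (\bigcap_j [set x : pt | \sum_i a j i * x 0 i <= c j]).
  apply/seteqP; split => x [h1 h2].
    by split => i _; [exact: h1|exact: h2].
  by split => i; [exact: (h1 i I)|exact: (h2 i I)].
apply: closedI; apply: closed_bigI => i _.
  have /continuous_closedP h : continuous (fun x : pt => x 0 i) by exact: coord_continuous.
  exact: (h [set y | 0 <= y] (@closed_ge _ _)).
have /continuous_closedP h : continuous (fun x : pt => \sum_j a i j * x 0 j).
  apply: (@continuous_sumR R pt n (fun x j => a i j * x 0 j)) => j x.
  apply: (@continuousM _ _ (fun=> a i j) (fun x : pt => x 0 j)).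
    exact: cst_continuous.
  exact: coord_continuous.
exact: (h [set y | y <= c i] (@closed_le _ _)).
Qed.

Lemma anti_blocking_poly a c : (forall j i, 0 <= a j i) -> (forall i, a i i = 1) ->
  (forall i, 0 <= c i) -> anti_blocking (poly a c).
Proof.
move=> a0 a1 c0; apply/anti_blockingP; split.
  split.
  - split => [i|j]; first by rewrite mxE.
    by rewrite big1// => i _; rewrite mxE mulr0.
  - apply: (subclosed_compact (closed_poly (c := c))
      (@rV_compact R n (fun i => `[0, c i]%classic) _)); first by move=> i; exact: segment_compact.
    by move=> x Px i /=; rewrite in_itv/= (poly_le _ a0 a1 Px) andbT; case: Px.
  - by move=> x [].
  - move=> x y [x0 xc] yx; split => [i|j]; first by case/andP: (yx i).
    apply: le_trans (xc j); apply: ler_sum => i _; rewrite ler_wpM2l//.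
    by case/andP: (yx i).
move=> l x y /andP[l0 l1] [x0 xc] [y0 yc]; have l1' : 0 <= 1 - l by rewrite subr_ge0 ltW.
split => [i|j].
  by rewrite !mxE addr_ge0// mulr_ge0// ltW.
rewrite (eq_bigr (fun i => (1 - l) * (a j i * x 0 i) + l * (a j i * y 0 i))); last first.
  by move=> i _; rewrite !mxE; ring.
rewrite big_split/= -!mulr_sumr [leRHS](_ : _ = (1 - l) * c j + l * c j); last by ring.
by rewrite lerD// ler_wpM2l// ltW.
Qed.

Definition cube b : set pt := poly (fun j i => (i == j)%:R) b.

Lemma cubeP b x : cube b x <-> forall i, 0 <= x 0 i <= b i.
Proof.
have E j : \sum_i (i == j)%:R * x 0 i = x 0 j.
  by rewrite (bigD1 j)//= eqxx mul1r big1 ?addr0// => i /negbTE ->; rewrite mul0r.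
split=> [[x0 xb] i|h]; first by rewrite x0 -E xb.
by split => i; rewrite ?E; case/andP: (h i).
Qed.

Lemma anti_blocking_cube b : (forall i, 0 <= b i) -> anti_blocking (cube b).
Proof. by move=> b0; apply: anti_blocking_poly => // i; rewrite eqxx. Qed.

Lemma iint_cube b (s : seq 'I_n) (x : pt) : uniq s -> (forall i, 0 <= b i) ->
  (forall i, i \notin s -> 0 <= x 0 i <= b i) ->
  iint s (ind (cube b)) x = (\prod_(i <- s) b i)%:E.
Proof.
move=> us b0; elim: s us x => [|i s IH] /= us x xb.
  by rewrite big_nil ind1//; apply/cubeP => i; exact: xb.
have /andP[si us'] := us.
pose J : set R := `[0, b i]%classic.
transitivity (\int[leb]_t ((\prod_(j <- s) b j)%:E * ind J t))%E.
  apply: eq_integral => t _.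
  have [Jt|Jt] := pselect (J t).
    rewrite ind1// mule1 IH// => j js; rewrite updE; case: eqP => [->|/eqP ji].
      by move: Jt; rewrite /J/= in_itv.
    by apply: xb; rewrite inE negb_or ji.
  rewrite [X in (_ * X)%E]ind0// mule0 iint_eq0// => x' hx'; apply: ind0 => /cubeP /(_ i).
  by rewrite hx'// updE eqxx => h; apply: Jt; rewrite /J/= in_itv.
rewrite ge0_integralZl//; last 3 first.
- by apply: (@measurable_ind _ _ (measurableTypeR R)); exact: measurable_itv.
- by move=> t _; exact: ind_ge0.
- by rewrite lee_fin prodr_ge0.
rewrite integral_ind /J// lebesgue_measure_itv/= lte_fin big_cons mulrC EFinM.
case: ltP => [_|bi]; first by rewrite -EFinD subr0.
by have /eqP -> : b i == 0; rewrite ?eq_le ?b0 ?andbT.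
Qed.

Lemma svol_cube b (s : seq 'I_n) : uniq s -> (forall i, 0 <= b i) ->
  svol s (cube b) 0 = \prod_(i <- s) b i.
Proof.
by move=> us b0; rewrite /svol iint_cube// => i _; rewrite mxE lexx b0.
Qed.

(** A beta integral with m = 1, up to the scaling by s^g. *)
Lemma integral_simplex g (s : R) : 0 <= s ->
  (\int[leb]_t (if (0 <= t <= s)%R then (s - t) ^+ g else 0)%:E = (s ^+ g.+1 / g.+1%:R)%:E)%E.
Proof.
rewrite le_eqVlt => /predU1P[<-|s0].
  rewrite exprS !mul0r; apply/eqP; rewrite eq_le; apply/andP; split; last first.
    apply: integral_ge0 => t _; rewrite lee_fin; case: ifP => // /andP[t0 t1].
    by rewrite exprn_ge0// subr_ge0.
  pose J : set R := `[0, 0]%classic.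
  apply: (@le_trans _ _ (\int[leb]_t ind J t)%E); last first.
    by rewrite integral_ind /J// lebesgue_measure_itv/= ltxx.
  apply: ge0_le_integralT => t.
    rewrite lee_fin; case: ifP => // /andP[t0 t1].
    by rewrite exprn_ge0// subr_ge0.
  case: ifP => t0; last by rewrite ind_ge0.
  have /eqP -> : t == 0 by rewrite eq_le andbC.
  rewrite ind1 /J/= ?in_itv/= ?lexx// lee_fin subrr.
  by case: g => [|g]; rewrite ?expr0// exprS mul0r.
have -> : (\int[leb]_t (if (0 <= t <= s)%R then (s - t) ^+ g else 0)%:E =
    \int[leb]_(t in `[0%R, s]) ((s - t) ^+ g)%:E)%E.
  rewrite [RHS]integral_mkcond; apply: eq_integral => t _; rewrite patchE.
  by rewrite mem_setE in_itv/=; case: ifP.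
rewrite -integral_itv_obnd_cbnd//; last first.
  apply/measurable_EFinP; apply: measurable_funTS; apply: measurable_funX.
  exact: measurable_funB.
have := integral_bw_cut g s0 (ltn0Sn 0); rewrite addn1 binSn expr1 => E.
rewrite exprSr -mulrA EFinM -E -ge0_integralZl//; last 3 first.
- apply/measurable_EFinP; apply: measurable_funM; [exact: measurable_bw|exact: measurable_cut].
- by move=> t _; rewrite lee_fin mulr_ge0 ?bw_ge0 ?cut_ge0.
- by rewrite lee_fin exprn_ge0// ltW.
rewrite [LHS]integral_mkcond; apply: eq_integral => t _; rewrite patchE.
rewrite mem_setE in_itv/= /bw /cut expr0 mulr1 -EFinM.
case: ifP => [/andP[t0 ts]|/negbT]; first by rewrite t0 ts mul1r -exprMn mulrBr mulr1 mulrCA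
  divff ?gt_eqF ?mulr1.
by rewrite negb_and => /orP[|] /negbTE ->; rewrite ?mul0r ?mulr0.
Qed.

End polytopes.

Section extremal_body.
Context {R : realType} {n : nat}.
Local Notation pt := 'rV[R]_n.
Local Notation leb := (@lebesgue_measure R).
Variables (G : seq 'I_n) (uG : uniq G).
Implicit Types (x : pt) (L l : seq 'I_n).

(** Over the standard simplex in the coordinates [G], the fibre in the other coordinates is a cube
    of side 1 minus the sum over [G]. Fibres are thus products, and the roots of their volumes are
    linear, as in the comparison cone. *)
Definition extremal : set pt := poly (fun j i => ((i \in G) || (i == j))%:R) (fun=> 1).

Let sg x : R := \sum_(i <- G) x 0 i.

Lemma anti_blocking_extremal : anti_blocking extremal.
Proof. by apply: anti_blocking_poly => // i; rewrite eqxx orbT. Qed.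

Lemma extremalP x : extremal x <-> [/\ forall i, 0 <= x 0 i, forall j, j \in G -> sg x <= 1
  & forall j, j \notin G -> x 0 j + sg x <= 1].
Proof.
have sgE : sg x = \sum_(i in G) x 0 i by rewrite /sg big_uniq.
have E1 j : j \in G -> \sum_i ((i \in G) || (i == j))%:R * x 0 i = sg x.
  move=> jG; rewrite sgE [RHS]big_mkcond; apply: eq_bigr => i _.
  have -> : (i \in G) || (i == j) = (i \in G) by case: eqP => [->|]; rewrite ?jG ?orbF.
  by case: ifP; rewrite ?mul1r ?mul0r.
have E2 j : j \notin G -> \sum_i ((i \in G) || (i == j))%:R * x 0 i = x 0 j + sg x.
  move=> jG; rewrite (bigD1 j)//= eqxx orbT mul1r sgE; congr (_ + _).
  rewrite [LHS]big_mkcond [RHS]big_mkcond; apply: eq_bigr => i _.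
  case: eqP => [->|_] /=; first by rewrite (negbTE jG).
  by rewrite orbF; case: ifP; rewrite ?mul1r ?mul0r.
split=> [[x0 h]|[x0 h1 h2]].
  by split => // j jG; have := h j; [rewrite E1|rewrite E2].
split => // j; have [jG|jG] := boolP (j \in G); first by rewrite E1 ?(h1 j).
by rewrite E2 ?h2.
Qed.

(** The volume of an m-dimensional fibre of the extremal body, extended by 0 outside the simplex. *)
Let ws m x : R := if [forall i, 0 <= x 0 i] && (sg x <= 1) then (1 - sg x) ^+ m else 0.

Let sg_upd x i t : i \in G -> x 0 i = 0 -> sg (upd x i t) = sg x + t.
Proof.
move=> iG xi; rewrite /sg !(bigD1_seq i iG uG)/= xi add0r updE eqxx addrC.
by congr (_ + _); apply: eq_bigr => j /negbTE ji; rewrite updE ji.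
Qed.

(** A Dirichlet integral, evaluated one coordinate at a time; each step raises the exponent of the
    remaining length by one. *)
Let iint_ws m l x : uniq l -> {subset l <= G} -> (forall i, i \in l -> x 0 i = 0) ->
  (forall i, 0 <= x 0 i) -> sg x <= 1 ->
  iint l (fun y => (ws m y)%:E) x =
    ((1 - sg x) ^+ (m + size l) * (m`!%:R / (m + size l)`!%:R))%:E.
Proof.
elim: l x => [|i l IH] x /=.
  move=> _ _ _ x0 sx; rewrite /ws addn0 divff ?mulr1 ?sx ?andbT; last first.
    by rewrite pnatr_eq0 -lt0n fact_gt0.
  by case: forallP.
move=> /andP[il ul] lG xl x0 sx.
have iG : i \in G by rewrite lG ?mem_head.
have xi : x 0 i = 0 by rewrite xl ?mem_head.
pose w : R := m`!%:R / (m + size l)`!%:R.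
have w0 : 0 <= w by rewrite divr_ge0.
transitivity (\int[leb]_t (w%:E *
    (if (0 <= t <= 1 - sg x)%R then (1 - sg x - t) ^+ (m + size l) else 0)%:E))%E.
  apply: eq_integral => t _; rewrite -EFinM.
  have x'0 j : j != i -> 0 <= upd x i t 0 j.
    by move=> /negbTE ji; rewrite updE ji.
  have x'l j : j \in l -> upd x i t 0 j = 0.
    move=> jl; rewrite updE; case: eqP => [ji|_]; first by rewrite -ji jl in il.
    by rewrite xl// inE jl orbT.
  case: ifP => [/andP[t0 ts]|ht].
    rewrite IH//.
    - by rewrite sg_upd// opprD addrA mulrC.
    - by move=> j jl; rewrite lG// inE jl orbT.
    - by move=> j; have [->|/x'0//] := eqVneq j i; rewrite updE eqxx.
    - by rewrite sg_upd// addrC -lerBrDr.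
  rewrite mulr0 iint_eq0// => y hy; rewrite /ws; case: ifP => // /andP[/forallP y0 sy].
  exfalso; move: ht; rewrite (_ : 0 <= t); last first.
    by have := y0 i; rewrite hy// updE eqxx.
  rewrite lerBrDr addrC -(sg_upd t iG xi)/= => /negP; apply; apply: le_trans sy.
  apply: ler_sum => j _; have [jl|jl] := boolP (j \in l); first by rewrite x'l.
  by rewrite hy.
rewrite ge0_integralZl//; last 2 first.
- apply/measurable_EFinP; apply: measurable_fun_if => //.
    by apply: measurable_and; [exact: measurable_fun_ler|exact: measurable_fun_ler].
  by apply: measurable_funTS; apply: measurable_funX; exact: measurable_funB.
- move=> t _; rewrite lee_fin; case: ifP => // /andP[_ ts].
  by rewrite exprn_ge0// subr_ge0.
rewrite integral_simplex ?subr_ge0// -EFinM addnS /w factS natrM; congr EFin.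
have h : (m + size l)`!%:R != 0 :> R by rewrite pnatr_eq0 -lt0n fact_gt0.
have h' : (m + size l).+1%:R != 0 :> R by rewrite pnatr_eq0.
move: h h'; move: (_ ^+ _) (_%:R) (_%:R) (_%:R) => a b c e h h'.
by field; rewrite h h'.
Qed.

Lemma svol_extremal L : uniq (G ++ L) ->
  svol (G ++ L) extremal 0 = (size L)`!%:R / (size G + size L)`!%:R.
Proof.
rewrite cat_uniq => /and3P[_ /hasPn LG uL].
have s0 : sg 0 = 0 by rewrite /sg big1// => i _; rewrite mxE.
rewrite /svol iint_cat (_ : iint G _ _ = iint G (fun y => (ws (size L) y)%:E) 0).
  rewrite iint_ws ?s0 ?subr0 ?expr1n ?mul1r ?[(size G + _)%N]addnC//.
  - by move=> i _; rewrite mxE.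
  - by move=> i; rewrite mxE.
apply: eq_iint_off => x y hx hy hxy.
have -> : y = x.
  by apply/rowP => i; have [/hxy//|iG] := boolP (i \in G); rewrite hx// hy.
rewrite /ws; case: ifPn => [/andP[/forallP x0 sx]|hs].
  (* The fibre over x, written as a box; coordinates outside [L] are capped by x itself and impose
     nothing. *)
  pose b i := if i \in L then 1 - sg x else x 0 i.
  have b0 i : 0 <= b i by rewrite /b; case: ifP => // _; rewrite subr_ge0.
  transitivity (iint L (ind (cube b)) x).
    apply: eq_iint_off => x' y' hx' hy' hxy'.
    have -> : y' = x'.
      by apply/rowP => i; have [/hxy'//|iL] := boolP (i \in L); rewrite hx'// hy'.
    have sx' : sg x' = sg x.
      apply: eq_big_seq => i iG; rewrite hx'//; apply/negP => iL.
      by have := LG _ iL; rewrite /= iG.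
    have E : extremal x' <-> cube b x'.
      split=> [/extremalP[h0 h1 h2]|/cubeP h].
        apply/cubeP => i; rewrite h0 /b /=; case: ifP => iL; last by rewrite hx' ?iL.
        by have := h2 i (LG _ iL); rewrite sx' lerBrDr.
      apply/extremalP; split => [i|j jG|j jG]; first by case/andP: (h i).
        by rewrite sx'.
      have /andP[_] := h j; rewrite /b sx' -lerBrDr; case: ifP => // jL _.
      by rewrite hx' ?jL// hx// mxE subr_ge0.
    by apply/eqP; rewrite eq_le !le_ind//; apply E.
  rewrite iint_cube//; last first.
    by move=> i iL; rewrite x0 /b (negbTE iL) lexx.
  congr EFin; rewrite big_seq (eq_bigr (fun=> 1 - sg x)); last by move=> i iL; rewrite /b iL.
  by rewrite -big_seq big_const_seq count_predT -Monoid.iteropE.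
rewrite iint_eq0// => x' hx'; apply: ind0 => /extremalP[h0 h1 h2].
have sx' : sg x' = sg x.
  apply: eq_big_seq => i iG; rewrite hx'//; apply/negP => iL.
  by have := LG _ iL; rewrite /= iG.
move: hs; rewrite negb_and => /orP[/forallPn[i]|].
  have [iL|iL] := boolP (i \in L); last by rewrite -hx'// h0.
  by rewrite hx ?mxE ?lexx//; exact: LG.
rewrite -sx'; case: (G =P [::]) => [GE|/eqP G0].
  by rewrite /sg GE big_nil ler01.
have [i iG] : exists i, i \in G by case: G G0 => // i ? _; exists i; rewrite mem_head.
by rewrite (h1 i iG).
Qed.

End extremal_body.

(** * The lower bound *)

Lemma prodr_const_in (R : pzSemiRingType) (I : eqType) (s : seq I) (f : I -> R) (c : R) :
  (forall i, i \in s -> f i = c) -> \prod_(i <- s) f i = c ^+ size s.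
Proof.
move=> fc; rewrite (eq_big_seq (fun=> c))// big_const_seq count_predT.
by rewrite iter_mulr_1.
Qed.

Section sharpness.
Context {R : realType} {n : nat}.
Local Notation pt := 'rV[R]_n.
Implicit Types (A : set pt) (d : 'I_n -> 'I_3) (l : seq 'I_n).

(** At most one leaf is the distinguished colouring; each of the 3^|l| leaves costs at most [ep]. *)
Lemma ctree_top l d d1 (Phi : ('I_n -> 'I_3) -> R) (al ep : R) : 0 <= al -> 0 <= ep -> uniq l ->
  (forall d', Phi d' <= (if [forall i, d' i == d1 i] then al else 0) + ep) ->
  ctree [:: col0; col1; col2] l Phi d <=
    (if [forall i, (i \in l) || (d i == d1 i)] then al else 0) + 3 ^+ size l * ep.
Proof.
move=> al0 ep0 ul HP; elim: l ul d => [|i l IH] /= ul d; first by rewrite mul1r.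
have /andP[il ul'] := ul.
rewrite !big_cons big_nil addr0.
pose Q d' := [forall j, (j \in l) || (d' j == d1 j)].
have QE k : Q (recolor d i k) = [forall j, (j \in i :: l) || (d j == d1 j)] && (k == d1 i).
  apply/forallP/andP => [h|[/forallP h /eqP kE] j]; last first.
    have := h j; rewrite inE /recolor; case: eqP => [->|_] /=; first by rewrite kE eqxx orbT.
    by [].
  split; last by have := h i; rewrite (negbTE il) /recolor eqxx.
  apply/forallP => j; rewrite inE; case: eqP => //= /eqP ji.
  by have := h j; rewrite /recolor (negbTE ji).
have := IH ul' (recolor d i col0); have := IH ul' (recolor d i col1);
  have := IH ul' (recolor d i col2).
rewrite -!/(Q _) !QE; set P := [forall _, _].
have [k0 [k1 k2]] : ((col0 == d1 i) + (col1 == d1 i) + (col2 == d1 i) = 1)%N /\ True /\ True.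
  by split => //; move: (d1 i); apply: col_ind.
set a := ctree _ _ _ _; set b := ctree _ _ _ _; set c := ctree _ _ _ _.
rewrite exprS -mulrA; move: (3 ^+ size l * ep) => E ha hb hc.
move: k0 ha hb hc; case: P; case: (col0 == _); case: (col1 == _); case: (col2 == _) => //= _ *; lra.
Qed.

Variables (r : R) (r0 : 0 <= r).
Local Notation gam := (gam r).

Let gsum : R := \sum_(m < n.+1) gam m.

Let gam_le m : (m <= n)%N -> gam m <= gsum.
Proof.
move=> mn; rewrite /gsum (bigD1 (Ordinal (mn : (m < n.+1)%N)))//= lerDl sumr_ge0// => i _.
by rewrite ltW// gam_gt0.
Qed.

Let size_cidx d k : (size (cidx d k) <= n)%N.
Proof. by rewrite size_filter (leq_trans (count_size _ _))// size_enum_ord. Qed.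

(* Only the colouring [d1] contributes in the top order lam ^ size. *)
Lemma wvol_cube_le A (E : pred 'I_n) (d1 : 'I_n -> 'I_3) :
  down_body A -> (forall x, A x -> forall i, x 0 i <= 1) ->
  (forall i, d1 i = if E i then col1 else col0) ->
  exists2 K : R, 0 <= K & forall lam : R, 1 <= lam ->
  wvol r (fam A (cube (fun i => if E i then lam else 0)) [set 0]) <=
  lam ^+ size (cidx d1 col1) * (svol (cidx d1 col0) A 0 * gam (size (cidx d1 col0)) *
    gam (size (cidx d1 col1)) / gam n + K / lam).
Proof.
move=> gA A1 d1E; set e := size (cidx d1 col1).
set al := _ / gam n; pose K1 : R := gsum * gsum / gam n.
have gs0 : 0 <= gsum by apply: le_trans (gam_le (leq0n n)); rewrite ltW// gam_gt0.
have gn0 : 0 <= (gam n)^-1 by rewrite invr_ge0 ltW// gam_gt0.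
have gam_ge0 m : 0 <= gam m by rewrite ltW// gam_gt0.
have K10 : 0 <= K1 by rewrite /K1 !mulr_ge0.
have al0 : 0 <= al by rewrite /al !mulr_ge0// svol_ge0.
exists (3 ^+ n * K1) => [|lam lam1]; first by rewrite mulr_ge0.
have lam0 : 0 < lam by rewrite (lt_le_trans ltr01).
pose b i := if E i then lam else 0.
have b0 i : 0 <= b i by rewrite /b; case: ifP => // _; rewrite ltW.
have gF : forall k, down_body (fam A (cube b) [set 0] k).
  apply: fam_down_body => //; last exact: down_body0.
  by have /anti_blockingP[] := anti_blocking_cube b0.
apply: le_trans (wvol_le_ctree r0 gF d1) _.
have le0 : 0 <= lam ^+ e by rewrite exprn_ge0// ltW.
have ep0 : 0 <= lam ^+ e / lam * K1 by rewrite mulr_ge0// divr_ge0// ltW.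
apply: le_trans (@ctree_top _ _ d1 _ (lam ^+ e * al) (lam ^+ e / lam * K1) _ ep0 (enum_uniq _) _) _.
- by rewrite mulr_ge0.
- have shuffle (u v w x y : R) : u * v * (y * w) / x = y * (u * v * w / x) by ring.
  move=> d'.
  have top0 : 0 <= (if [forall i, d' i == d1 i] then lam ^+ e * al else 0).
    by case: ifP => // _; rewrite mulr_ge0.
  have [c2|c2] := eqVneq (cidx d' col2) [::]; last first.
    by rewrite (leaf_eq0 _ (svol_set0 (cidx_uniq _ _) c2)) addr_ge0.
  have sBE : svol (cidx d' col1) (cube b) 0 = \prod_(i <- cidx d' col1) b i.
    by apply: svol_cube; first exact: cidx_uniq.
  (* The cube has side 0 outside [E], so a colouring that assigns it such a coordinate contributes
     nothing. Among the others, all but [d1] use fewer than [e] coordinates of the cube and lose a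
     factor lam. *)
  have [/allP cE|/allPn[i ic iE]] := boolP (all E (cidx d' col1)); last first.
    rewrite (@leaf_eq0 _ _ _ _ _ col1) ?addr_ge0//.
    by rewrite sBE (bigD1_seq i)//= ?cidx_uniq// /b (negbTE iE) mul0r.
  rewrite leaf2E// /fam /= sBE.
  case: ifPn => [/forallP d'E|d'E].
    have -> : d' = d1 by apply/funext => i; exact/eqP.
    rewrite -[leLHS]addr0 lerD//.
    rewrite (@prodr_const_in _ _ _ _ lam); last first.
      by move=> i; rewrite mem_cidx d1E /b; case: ifP.
    rewrite -/e le_eqVlt; apply/orP; left; apply/eqP.
    exact: shuffle.
  rewrite add0r.
  have lt : (size (cidx d' col1) < e)%N.
    have [i iE] : exists i, d' i != d1 i by move/forallPn: d'E.
    have d'i : d' i = col0.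
      have : i \notin cidx d' col2 by rewrite c2.
      have := cE i; rewrite !mem_cidx; move: iE; rewrite d1E.
      move: (d' i); apply: col_ind => //=; case: (E i) => //.
      by move=> _ /(_ isT).
    have iE' : E i by move: iE; rewrite d'i d1E; case: (E i).
    rewrite -[X in (X < _)%N]/(size (cidx d' col1)) (_ : (_ < _)%N = (size (i :: cidx d' col1)
      <= e)%N)//.
    apply: uniq_leq_size => [|j].
      by rewrite /= cidx_uniq mem_cidx d'i.
    rewrite inE => /orP[/eqP ->|/cE jE]; rewrite mem_cidx d1E ?iE' ?jE//.
  have sA : svol (cidx d' col0) A 0 <= 1.
    rewrite -lee_fin; have [M _ [_ bA _]] := down_body_bounded gA.
    have bA1 x : A x -> forall i, 0 <= x 0 i <= 1.
      by move=> Ax i; rewrite A1// andbT; have [_ _ pA _] := gA; exact: pA.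
    rewrite -(svolE _ (cidx_uniq _ _) bA1).
    by have := iint_ind_le 0 ler01 (cidx_uniq d' col0) bA1; rewrite expr1n.
  have sB : \prod_(i <- cidx d' col1) b i <= lam ^+ e / lam.
    rewrite (@prodr_const_in _ _ _ _ lam); last by move=> i /cE iE; rewrite /b iE.
    have eS : e = e.-1.+1 by rewrite prednK// (leq_ltn_trans _ lt).
    rewrite eS exprSr mulfK ?gt_eqF//; apply: ler_weXn2l => //.
    by rewrite -ltnS -eS.
  rewrite [leRHS](_ : _ = 1 * gsum * (lam ^+ e / lam * gsum) / gam n); last by rewrite /K1; ring.
  rewrite ler_wpM2r//; apply: ler_pM.
  - by rewrite mulr_ge0 ?svol_ge0.
  - by rewrite mulr_ge0 ?prodr_ge0.
  - by apply: ler_pM; rewrite ?svol_ge0 ?gam_le.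
  - by apply: ler_pM; rewrite ?prodr_ge0 ?gam_le.
have -> : [forall i, (i \in enum 'I_n) || (d1 i == d1 i)].
  by apply/forallP => i; rewrite eqxx orbT.
rewrite size_enum_ord mulrDr lerD// le_eqVlt; apply/orP; left; apply/eqP; ring.
Qed.
End sharpness.

Lemma le_of_perturbations {R : realType} (X c al be K L : R) :
  0 <= c -> 0 <= al -> 0 <= be -> 0 <= K -> 0 <= L ->
  (forall lam, 1 <= lam -> X <= c * ((al + K / lam) * (be + L / lam))) -> X <= c * (al * be).
Proof.
move=> c0 al0 be0 K0 L0 H; rewrite leNgt; apply/negP => lt.
pose del := X - c * (al * be); have del0 : 0 < del by rewrite subr_gt0.
pose D := c * (al * L + be * K + K * L).
have D0 : 0 <= D by rewrite mulr_ge0// !addr_ge0// mulr_ge0.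
(* For lam >= 1 the product exceeds its limit by at most D / lam, and this choice makes D / lam
   smaller than the supposed gap [del]. *)
pose lam := 1 + D / del.
have lam1 : 1 <= lam by rewrite lerDl divr_ge0// ltW.
have lam0 : 0 < lam by rewrite (lt_le_trans ltr01).
have /(le_trans (H _ lam1)) : c * ((al + K / lam) * (be + L / lam)) <= c * (al * be) + D / lam.
  have i1 : lam^-1 <= 1 by rewrite invf_le1.
  have i0 : 0 <= lam^-1 by rewrite invr_ge0 ltW.
  rewrite (_ : _ * _ = c * (al * be) + c * (al * L + be * K + K * L / lam) / lam); last by ring.
  rewrite lerD2l ler_wpM2r// /D ler_wpM2l// lerD2l.
  by rewrite ler_piMr// mulr_ge0.
rewrite -lerBlDl -/del ler_pdivlMr// /lam mulrDr mulr1 mulrCA divff ?gt_eqF// mulr1.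
by rewrite gerDr leNgt del0.
Qed.

Section lower_bound.
Context {R : realType} {n : nat}.
Local Notation pt := 'rV[R]_n.
Variables (p : R) (p1 : 1 <= p).
Let r : R := 1 - p^-1.

Let r0 : 0 <= r.
Proof. by rewrite /r subr_ge0 invf_le1// (lt_le_trans ltr01). Qed.

Lemma exists_coloring g k h : (g + k + h)%N = n -> exists d : 'I_n -> 'I_3,
  [/\ size (cidx d col0) = g, size (cidx d col2) = k & size (cidx d col1) = h].
Proof.
move=> gkh; exists (fun i => if (i < g)%N then col0 else if (i < g + k)%N then col2 else col1).
have count_lt (P : pred nat) : size [seq i <- enum 'I_n | P (val i)] = count P (iota 0 n).
  by rewrite size_filter -val_enum_ord count_map.
have cT (P : pred nat) m s : {in iota m s, P =1 predT} -> count P (iota m s) = s.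
  by move=> PT; rewrite (eq_in_count PT) count_predT size_iota.
have cF (P : pred nat) m s : {in iota m s, P =1 pred0} -> count P (iota m s) = 0%N.
  by move=> PT; rewrite (eq_in_count PT) count_pred0.
have iE : iota 0 n = iota 0 g ++ iota g k ++ iota (g + k) h.
  by rewrite -gkh -addnA iotaD add0n iotaD.
pose f c (i : nat) := (if (i < g)%N then col0 else if (i < g + k)%N then col2 else col1) == c.
rewrite /cidx; split.
- rewrite (count_lt (f col0)) iE !count_cat (cT _ 0 g) ?(cF _ g k) ?(cF _ (g + k)%N h) ?addn0//=
    => i; rewrite mem_iota /f => hi.
  + by rewrite ltnNge (leq_trans (leq_addr _ _) (proj1 (andP hi)))/= ltnNge (proj1 (andP hi)).
  + by case/andP: hi => h1 h2; rewrite ltnNge h1 h2.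
  + by case/andP: hi => _ ->.
- rewrite (count_lt (f col2)) iE !count_cat (cF _ 0 g) ?(cT _ g k) ?(cF _ (g + k)%N h) ?addn0//=
    => i; rewrite mem_iota /f => hi.
  + by rewrite ltnNge (leq_trans (leq_addr _ _) (proj1 (andP hi)))/= ltnNge (proj1 (andP hi)).
  + by case/andP: hi => h1 h2; rewrite ltnNge h1 h2.
  + by case/andP: hi => _ ->.
- rewrite (count_lt (f col1)) iE !count_cat (cF _ 0 g) ?(cF _ g k) ?(cT _ (g + k)%N h) ?addn0//=
    => i; rewrite mem_iota /f => hi.
  + by rewrite ltnNge (leq_trans (leq_addr _ _) (proj1 (andP hi)))/= ltnNge (proj1 (andP hi)).
  + by case/andP: hi => h1 h2; rewrite ltnNge h1 h2.
  + by case/andP: hi => _ ->.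
Qed.

Lemma lower_bound c g k h : volume_bound n p c -> (g + k + h)%N = n ->
  dn2 R n (g + k) (g + h) * (gam r g * gam r n / (gam r (g + k) * gam r (g + h))) <= c.
Proof.
move=> /(volume_boundE p1); rewrite -/r => Hc gkh.
have gE : (g + k + (g + h) - n = g)%N by rewrite -gkh; lia.
have [d [dg dk dh]] := exists_coloring gkh.
pose A : set pt := extremal (cidx d col0).
have aA : anti_blocking A := anti_blocking_extremal _.
have /anti_blockingP[gA _] := aA; have [_ cA _ _] := gA.
have mA : mset A by exact: compact_mset.
have A1 x : A x -> forall i, x 0 i <= 1.
  by move=> Ax i; apply: poly_le Ax => [j l|j]; rewrite ?eqxx ?orbT.
have vA L : uniq (cidx d col0 ++ L) ->
    svol (cidx d col0 ++ L) A 0 = (size L)`!%:R / (g + size L)`!%:R.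
  by move=> uL; rewrite svol_extremal ?dg// cidx_uniq.
have uGKH : uniq (cidx d col0 ++ cidx d col2 ++ cidx d col1).
  by rewrite (perm_uniq (cidx_perm d)) enum_uniq.
have := uGKH; rewrite !cat_uniq => /and3P[uG]; rewrite has_cat negb_or.
move=> /andP[GK GH] /and3P[uK KH uH].
have vV : svol (enum 'I_n) A 0 = (k + h)`!%:R / n`!%:R.
  by rewrite -(svol_perm 0 mA (cidx_perm d)) vA// size_cat dk dh addnA gkh.
have vG : svol (cidx d col0) A 0 = 1 / g`!%:R.
  by have := vA [::]; rewrite cats0 addn0; apply.
have vGK : svol (cidx d col0 ++ cidx d col2) A 0 = k`!%:R / (g + k)`!%:R.
  by rewrite vA ?dk// cat_uniq uG uK GK.
have vGH : svol (cidx d col0 ++ cidx d col1) A 0 = h`!%:R / (g + h)`!%:R.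
  by rewrite vA ?dh// cat_uniq uG uH GH.
have [p0 p1' _] := cidx_pi1 d; have [q0 q1' _] := cidx_pi2 d.
have [K K0 HK] := @wvol_cube_le R n r r0 A (fun i => d i == col1) (pi1 \o d) gA A1 (fun=> erefl).
have [L L0 HL] := @wvol_cube_le R n r r0 A (fun i => d i == col2) (pi2 \o d) gA A1 (fun=> erefl).
move: HK HL; rewrite p1' q1' (svol_perm 0 mA p0) (svol_perm 0 mA q0).
rewrite (perm_size p0) (perm_size q0) !size_cat dg dk dh vGK vGH => HK HL.
set al := _ / gam r n in HK; set be := _ / gam r n in HL.
have gp m := gam_gt0 r0 m; have fp m : 0 < m`!%:R :> R by rewrite ltr0n fact_gt0.
have al0 : 0 < al by rewrite /al !mulr_gt0// invr_gt0.
have be0 : 0 < be by rewrite /be !mulr_gt0// invr_gt0.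
(* The coefficient of lam^(h + k) in the volume of A times the contribution of [d] to the sum of
   three bodies; [al] and [be] are the leading coefficients of the two sums of two bodies. *)
pose X := (k + h)`!%:R / n`!%:R * (1 / g`!%:R * gam r g * (gam r h * gam r k) / gam r n).
have X0 : 0 < X by rewrite /X !mulr_gt0// invr_gt0.
have HX lam : 1 <= lam -> X <= c * ((al + K / lam) * (be + L / lam)).
  move=> lam1; have lam0 : 0 < lam by rewrite (lt_le_trans ltr01).
  pose b (e : 'I_3) (i : 'I_n) := if d i == e then lam else 0.
  have b0 e i : 0 <= b e i by rewrite /b; case: ifP => // _; rewrite ltW.
  have aB e : anti_blocking (cube (b e)) by exact: anti_blocking_cube.
  have gB e : down_body (cube (b e)) by have /anti_blockingP[] := aB e.
  have g0 := @down_body0 R n.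
  have vb e : svol (cidx d e) (cube (b e)) 0 = lam ^+ size (cidx d e).
    rewrite svol_cube ?cidx_uniq//; apply: prodr_const_in => i.
    by rewrite mem_cidx /b => ->.
  have h1 := Hc A _ _ aA (aB col1) (aB col2).
  have h2 : X * lam ^+ (h + k) <= svol (enum 'I_n) A 0 * wvol r (fam A (cube (b col1)) (cube (b
    col2))).
    rewrite vV /X -mulrA ler_pM2l ?divr_gt0//.
    apply: le_trans (leaf_le_wvol r0 (fam_down_body gA (gB col1) (gB col2)) d).
    rewrite leaf3E /fam /= !vb vG dg dk dh exprD.
    move: (1 / _) (gam r g) (gam r h) (gam r k) (gam r n)^-1 (lam ^+ h) (lam ^+ k) => *.
    by rewrite le_eqVlt; apply/orP; left; apply/eqP; ring.
  have h3 := wvol_ge0 r0 (fam_down_body gA (gB col1) g0).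
  have h4 := wvol_ge0 r0 (fam_down_body gA (gB col2) g0).
  have h5 := HK _ lam1; have h6 := HL _ lam1.
  have h7 := le_trans h2 h1.
  (* A negative [c] would make the right-hand side of the volume bound nonpositive, while the
     left-hand side is positive. *)
  have c0 : 0 <= c.
    rewrite leNgt; apply/negP => c0.
    have : 0 < X * lam ^+ (h + k) by rewrite mulr_gt0// exprn_gt0.
    rewrite ltNge (le_trans h7)// -mulrA nmulr_rle0// mulr_ge0//.
  have lhk : 0 < lam ^+ (h + k) by rewrite exprn_gt0.
  rewrite -(ler_pM2r lhk); apply: le_trans h7 _.
  rewrite -!mulrA ler_wpM2l// exprD.
  rewrite [leRHS](_ : _ = (lam ^+ h * (al + K / lam)) * (lam ^+ k * (be + L / lam))); last by ring.
  exact: ler_pM.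
have c0 : 0 <= c.
  rewrite leNgt; apply/negP => c0; have := HX _ (lexx 1); rewrite leNgt (lt_le_trans _ (ltW X0))//.
  have P a b : 0 < a -> 0 <= b -> 0 < a + b / 1 :> R by move=> a0 b0; rewrite divr1 ltr_wpDr.
  by rewrite nmulr_rlt0 ?(mulr_gt0 (P _ _ al0 K0) (P _ _ be0 L0)).
have XL := le_of_perturbations c0 (ltW al0) (ltW be0) K0 L0 HX.
have nz m : gam r m != 0 by rewrite gt_eqF.
have fz m : m`!%:R != 0 :> R by rewrite gt_eqF.
rewrite -(ler_pM2r (mulr_gt0 al0 be0)).
apply: le_trans XL; rewrite le_eqVlt; apply/orP; left; apply/eqP.
rewrite /dn2 gE.
have bE a b : 'C(a + b, a)%:R = (a + b)`!%:R / (a`!%:R * b`!%:R) :> R.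
  have := bin_fact (leq_addr b a); rewrite addKn => <-.
  by rewrite !natrM mulfK// mulf_neq0.
have bn : 'C(n, g)%:R = n`!%:R / (g`!%:R * (k + h)`!%:R) :> R by rewrite -gkh -addnA bE.
rewrite natrM !bE bn /X /al /be.
have := fz n; have := fz g; have := fz h; have := fz k; have := fz (g + k)%N.
have := fz (g + h)%N; have := fz (k + h)%N.
have := nz n; have := nz (g + k)%N; have := nz (g + h)%N.
move: (n`!%:R : R) (g`!%:R : R) (h`!%:R : R) (k`!%:R : R) ((g + k)`!%:R : R).
move: ((g + h)`!%:R : R) ((k + h)`!%:R : R).
move: (gam r n) (gam r g) (gam r h) (gam r k) (gam r (g + k)) (gam r (g + h)).
move=> z1 z2 z3 z4 z5 z6 z7 z8 z9 z10 z11 z12 z13 a1 a2 a3 a4 a5 a6 a7 a8 a9 a10.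
clear -a1 a2 a3 a4 a5 a6 a7 a8 a9 a10.
by field; rewrite ?a1 ?a2 ?a3 ?a4 ?a5 ?a6 ?a7 ?a8 ?a9 ?a10.
Qed.

End lower_bound.

(** Under (i, j) = (g + k, g + h) the number i + j - n is g, the size of the block of A. *)
Lemma btermE (R : realType) (n : nat) (p : R) (q : \bar R) : 1 <= p ->
  (p%:E^-1 + q^-1 = 1)%E -> forall g k h, (g + k + h)%N = n ->
  bterm n q (g + k) (g + h) =
    dn2 R n (g + k) (g + h) * (gam (1 - p^-1) g * gam (1 - p^-1) n /
      (gam (1 - p^-1) (g + k) * gam (1 - p^-1) (g + h))).
Proof.
move=> p1 pq g k h gkh.
have rE : fine q^-1%E = 1 - p^-1 :> R.
  move: pq; rewrite inver gt_eqF ?(lt_le_trans ltr01)//.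
  by case: (q^-1)%E => [s||] //= /eqP; rewrite -EFinD eqe => /eqP h'; lra.
by rewrite /bterm rE (_ : (g + k + (g + h) - n = g)%N)//; rewrite -gkh; lia.
Qed.

Theorem theorem20 (R : realType) (n : nat) (p : R) (q : \bar R)
  (hp : 1 <= p) (hq : (1 < q)%E) (hpq : (p%:E^-1 + q^-1 = 1)%E) :
  is_smallest_bound n p
    (\big[Num.max/0]_(i < n.+1) \big[Num.max/0]_(j < n.+1 | (n <= i + j)%N)
       bterm n q i j).
Proof.
split.
  apply: upper_bound => //.
    by elim/big_ind: _ => // [x y x0 y0|i _]; rewrite ?le_max ?x0// bigmax_ge_id.
  move=> g k h gkh; rewrite -(btermE hp hpq gkh).
  have i_lt : (g + k < n.+1)%N by rewrite ltnS -gkh leq_addr.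
  have j_lt : (g + h < n.+1)%N by rewrite ltnS -gkh; lia.
  apply: le_trans (le_bigmax _ _ (Ordinal i_lt)) => /=.
  apply: le_trans (le_bigmax_cond _ _ (_ : (n <= Ordinal i_lt + Ordinal j_lt)%N)) => //=.
  by rewrite -gkh; lia.
move=> c /= Hc; have L := lower_bound hp Hc.
(* The default value 0 of the maximum must not exceed [c] either; the pair (n, n), that is k = h =
   0, shows this. *)
have c0 : 0 <= c.
  have := L n 0 0; rewrite !addn0 => /(_ erefl); apply: le_trans.
  have r0 : 0 <= 1 - p^-1 by rewrite subr_ge0 invf_le1// (lt_le_trans ltr01).
  by rewrite mulr_ge0// ?divr_ge0// mulr_ge0// ltW// gam_gt0.
apply: bigmax_le => // i _; apply: bigmax_le => // j nij.
(* Block sizes recovered from (i, j): g = i + j - n, k = n - j, h = n - i. *)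
have gkh : (i + j - n + (n - j) + (n - i))%N = n.
  by have := ltn_ord i; have := ltn_ord j; lia.
have := L _ _ _ gkh; rewrite -(btermE hp hpq gkh).
have -> : (i + j - n + (n - j) = i)%N by have := ltn_ord j; lia.
by have -> : (i + j - n + (n - i) = j)%N by have := ltn_ord i; lia.
Qed.
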